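(* Let $M$ be a simple highest weight $\mathfrak g$-representation of highest weight $\Lambda$ with respect to a positive system $\Delta^+$, and let $L_0(\mu)$ be a $\mathfrak g_{\bar0}$-composition factor of $M\otimes M(\mathfrak g_{\bar1})$ of highest weight $\mu$. Then $\mathrm D^2$ acts on the composition factor $L_0(\mu)$ by the scalar $$2\bigl((\mu+\rho_{\bar1}+2\rho,\ \mu+\rho_{\bar1})-(\Lambda+2\rho,\Lambda)\bigr),$$ where $\mathrm D$ is the relative Dirac operator for $(\mathfrak g,\mathfrak g_{\bar0})$.
   Context: $\mathfrak g=\mathfrak g_{\bar0}\oplus\mathfrak g_{\bar1}$ is one of the complex Lie superalgebras $\mathfrak{sl}(m|n)$ ($m,n\ge1$, $m\neq n$), $\mathfrak{gl}(n|n)$ ($n\ge1$), $\mathfrak{osp}(m|2n)$ ($m,n\ge1$), or the exceptional $F(4)$. The invariant form $(X,Y)$ is $\mathrm{str}(XY)$ for $\mathfrak{sl},\mathfrak{gl}$, $\frac12\mathrm{str}(XY)$ for $\mathfrak{osp}$, $\frac16\mathrm{str}_{\mathfrak g}(\mathrm{ad}X\,\mathrm{ad}Y)$ for $F(4)$; the form $(\cdot,\cdot)$ on $\mathfrak h^*$ is the one induced by it; $B=\frac12(\cdot,\cdot)$ on $\mathfrak g$. $\mathfrak h\subseteq\mathfrak g_{\bar0}$ is a Cartan subalgebra, $\Delta=\Delta_{\bar0}\sqcup\Delta_{\bar1}$ the roots, $\Delta^+=\Delta_{\bar0}^+\sqcup\Delta_{\bar1}^+$ a positive system, where $\Delta_{\bar0}^+$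 is a fixed standard positive system of the even roots; $\rho=\rho_{\bar0}-\rho_{\bar1}$, $\rho_{\bar z}=\frac12\sum_{\alpha\in\Delta_{\bar z}^+}\alpha$; $\mathfrak n_{\bar1}^\pm=\bigoplus_{\alpha\in\Delta_{\bar1}^+}\mathfrak g^{\pm\alpha}$. $L_0(\mu)$ is the simple highest weight $\mathfrak g_{\bar0}$-module with respect to $\Delta_{\bar0}^+$. Fix bases $\{\partial_i\}_{i=1}^N$ of $\mathfrak n_{\bar1}^+$ and $\{x_i\}_{i=1}^N$ of $\mathfrak n_{\bar1}^-$ with $B(\partial_i,x_j)=\frac12\delta_{ij}$. The Weyl algebra $\mathscr W(\mathfrak g_{\bar1})$ is the algebra of polynomial differential operators in $x_1,\dots,x_N$ with $\partial_i=\partial/\partial x_i$, and $M(\mathfrak g_{\bar1})=\mathbb C[x_1,\dots,x_N]$ is its oscillator module. $\mathfrak g_{\bar0}$ acts on $M(\mathfrak g_{\bar1})$ through the Lie algebra homomorphism $\alpha:\mathfrak g_{\bar0}\to\mathscr W(\mathfrak g_{\bar1})$, $$\alpha(X)=\sum_{i,j=1}^N\bigl(B(X,[\partial_i,\partial_j])x_ix_j+B(X,[x_i,x_j])\partial_i\partial_j\bigr)-2\sum_{i,j=1}^NB(X,[x_i,\partial_j])x_j\partial_i-\sum_{l=1}^NB(X,[\partial_l,x_l]),$$ and on $M\otimes M(\mathfrak g_{\bar1})$ diagonally by $X\otimes1+1\otimes\alpha(X)$. The Dirac operator is $\mathrm D=2\sum_{i=1}^N(\partial_i\otimes x_i-x_i\otimes\partial_i)\in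 U(\mathfrak g)\otimes\mathscr W(\mathfrak g_{\bar1})$ (ordinary tensor product of algebras), acting on $M\otimes M(\mathfrak g_{\bar1})$; it commutes with the diagonal $\mathfrak g_{\bar0}$-action. A composition factor means a simple $\mathfrak g_{\bar0}$-subquotient; all of these are highest weight modules. *)

(* Defs.v *)
From HB Require Import structures.
From mathcomp Require Import all_boot all_order all_algebra.
From mathcomp Require Import boolp classical_sets functions cardinality fsbigop reals.
From mathcomp Require Import complex.
From mathcomp Require Import mpoly.

Set Implicit Arguments.
Unset Strict Implicit.
Unset Printing Implicit Defensive.

Import Order.TTheory GRing.Theory Num.Theory.
Local Open Scope classical_set_scope.
Local Open Scope ring_scope.

Definition bilinear_fun (K : nzRingType) (U V W : lmodType K)
    (f : U -> V -> W) : Prop :=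
  (forall v, linear (fun u => f u v)) /\ (forall u, linear (f u)).

Definition is_subspace (K : nzRingType) (V : lmodType K) (W : set V) : Prop :=
  W 0 /\ (forall (a : K) u v, W u -> W v -> W (a *: u + v)).

(* Parities are booleans: [gr false] is the even part and [gr true] the odd   *)
(* part, so that (-1) ^+ (i && j) is the sign (-1)^(|X||Y|).                  *)
Record lieSuperalgebra (K : fieldType) : Type := LieSuperalgebra {
  lsa_sort :> vectType K;
  gr : bool -> {vspace lsa_sort};
  gr_sum : (gr false + gr true)%VS = fullv;
  gr_cap : (gr false :&: gr true)%VS = 0%VS;
  bracket : lsa_sort -> lsa_sort -> lsa_sort;
  bracket_bilinear : bilinear_fun bracket;
  bracket_gr : forall i j X Y,
    X \in gr i -> Y \in gr j -> bracket X Y \in gr (i (+) j);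
  bracket_skew : forall i j X Y, X \in gr i -> Y \in gr j ->
    bracket X Y = - ((-1) ^+ (i && j) *: bracket Y X);
  bracket_jacobi : forall i j X Y Z, X \in gr i -> Y \in gr j ->
    bracket X (bracket Y Z) =
      bracket (bracket X Y) Z + (-1) ^+ (i && j) *: bracket Y (bracket X Z)
}.

Record supermodule (K : fieldType) (g : lieSuperalgebra K) : Type :=
  Supermodule {
  sm_sort :> lmodType K;
  sm_gr : bool -> set sm_sort;
  sm_gr_subspace : forall i, is_subspace (sm_gr i);
  sm_gr_sum : forall v,
    exists v0 v1, [/\ sm_gr false v0, sm_gr true v1 & v = v0 + v1];
  sm_gr_cap : forall v, sm_gr false v -> sm_gr true v -> v = 0;
  sm_act : g -> {linear sm_sort -> sm_sort};
  sm_act_linear : forall v, linear (fun X => sm_act X v);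
  sm_act_gr : forall i j X v,
    X \in gr g i -> sm_gr j v -> sm_gr (i (+) j) (sm_act X v);
  sm_act_bracket : forall i j X Y v, X \in gr g i -> Y \in gr g j ->
    sm_act (bracket X Y) v =
      sm_act X (sm_act Y v) - (-1) ^+ (i && j) *: sm_act Y (sm_act X v)
}.

Section Supermodules.
Variables (K : fieldType) (g : lieSuperalgebra K) (M : supermodule g).

Definition is_submodule (W : set M) : Prop :=
  is_subspace W /\ (forall X v, W v -> W (sm_act M X v)).

Definition is_graded (W : set M) : Prop :=
  forall v0 v1, sm_gr false v0 -> sm_gr true v1 -> W (v0 + v1) ->
    W v0 /\ W v1.

Definition simple_supermodule : Prop :=
  (exists v : M, v != 0) /\
  (forall W, is_submodule W -> is_graded W ->
     (forall v, W v -> v = 0) \/ (forall v, W v)).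

End Supermodules.

Section MatrixSuperalgebras.
Variable K : fieldType.

Definition strace p q (A : 'M[K]_(p + q)) : K :=
  \tr (ulsubmx A) - \tr (drsubmx A).

Definition mx_parity p q (i : bool) (A : 'M[K]_(p + q)) : Prop :=
  if i then ulsubmx A = 0 /\ drsubmx A = 0
  else ursubmx A = 0 /\ dlsubmx A = 0.

Definition strmx p q (A : 'M[K]_(p + q)) : 'M[K]_(p + q) :=
  block_mx (ulsubmx A)^T (dlsubmx A)^T (- (ursubmx A)^T) (drsubmx A)^T.

(* Gram matrix of the even supersymmetric form on K^(m|2n): symmetric on the  *)
(* even part, symplectic on the odd part.                                     *)
Definition osp_gram m n : 'M[K]_(m + (n + n)) :=
  block_mx 1%:M 0 0 (block_mx 0 1%:M (- 1%:M) 0).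

(* On homogeneous A this is b(A v, w) + (-1)^(|A||v|) b(v, A w) = 0.          *)
Definition osp_mx m n : set 'M[K]_(m + (n + n)) :=
  [set A | strmx A *m osp_gram m n + osp_gram m n *m A = 0].

Definition sl_mx m n : set 'M[K]_(m + n) := [set A | strace A = 0].

(* phi is an isomorphism of g onto the Lie superalgebra of supermatrices L. *)
Definition mx_iso (g : lieSuperalgebra K) p q (L : set 'M[K]_(p + q))
    (phi : {linear g -> 'M[K]_(p + q)}) : Prop :=
  [/\ injective phi,
      forall A, (exists X, phi X = A) <-> L A,
      forall i X, X \in gr g i -> mx_parity i (phi X) &
      forall i j X Y, X \in gr g i -> Y \in gr g j ->
        phi (bracket X Y) =
          phi X *m phi Y - (-1) ^+ (i && j) *: (phi Y *m phi X)].

End MatrixSuperalgebras.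

(* F(4) is the simple Lie superalgebra whose even part is sl(2) + so(7) and   *)
(* whose odd part is the even-part module C^2 (x) spin, unique by Kac's       *)
(* classification.                                                            *)

Section F4.
Variable K : fieldType.

(* An 8-dimensional module over the Clifford algebra of K^7. *)
Definition clifford7 (gam : 'I_7 -> 'M[K]_8) : Prop :=
  forall i j, gam i *m gam j + gam j *m gam i = ((i == j)%:R *+ 2)%:M.

(* The spin representation of so(7); both 8-dimensional Clifford modules      *)
(* restrict to it.                                                            *)
Definition spin7 (gam : 'I_7 -> 'M[K]_8) (Z : 'M[K]_7) : 'M[K]_8 :=
  4%:R^-1 *: \sum_i \sum_j Z i j *: (gam i *m gam j).

Variable g : lieSuperalgebra K.

Definition simple_lsa : Prop :=
  (exists X Y : g, bracket X Y != 0) /\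
  (forall I : {vspace g},
     I = (I :&: gr g false + I :&: gr g true)%VS ->
     (forall X Y, Y \in I -> bracket X Y \in I) ->
     I = 0%VS \/ I = fullv).

Definition is_F4 : Prop :=
  simple_lsa /\
  exists (gam : 'I_7 -> 'M[K]_8) (a : {linear g -> 'M[K]_2})
         (s : {linear g -> 'M[K]_7}) (o : {linear g -> 'M[K]_(2, 8)}),
  [/\ clifford7 gam,
      [/\ forall X, X \in gr g false -> \tr (a X) = 0 /\ (s X)^T = - s X,
          forall A Z, \tr A = 0 -> Z^T = - Z ->
            exists! X, [/\ X \in gr g false, a X = A & s X = Z],
          {in gr g false &, forall X Y,
             a (bracket X Y) = a X *m a Y - a Y *m a X} &
          {in gr g false &, forall X Y,
             s (bracket X Y) = s X *m s Y - s Y *m s X}],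
      forall B, exists! X, X \in gr g true /\ o X = B &
      (* 'M_(2, 8) = K^2 (x) K^8 *)
      forall X Y, X \in gr g false -> Y \in gr g true ->
        o (bracket X Y) = a X *m o Y + o Y *m (spin7 gam (s X))^T].

(* Trace of f on the even part minus trace of f on the odd part; daddv_pi     *)
(* projects onto one part along the other.                                    *)
Definition lsa_str (f : g -> g) : K :=
  \sum_(b : bool) (-1) ^+ b *
    \sum_(k < \dim (gr g b))
      coord (vbasis (gr g b)) k
        (daddv_pi (gr g b) (gr g (~~ b)) (f (vbasis (gr g b))`_k)).

End F4.

Inductive listed_algebra (K : fieldType) (g : lieSuperalgebra K)
    (form : g -> g -> K) : Prop :=
| Listed_sl (m n : nat) of (1 <= m)%N & (1 <= n)%N & m != n &
    exists2 phi : {linear g -> 'M[K]_(m + n)}, mx_iso (@sl_mx K m n) phi &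
      forall X Y, form X Y = strace (phi X *m phi Y)
| Listed_gl (n : nat) of (1 <= n)%N &
    exists2 phi : {linear g -> 'M[K]_(n + n)}, mx_iso setT phi &
      forall X Y, form X Y = strace (phi X *m phi Y)
| Listed_osp (m n : nat) of (1 <= m)%N & (1 <= n)%N &
    exists2 phi : {linear g -> 'M[K]_(m + (n + n))},
      mx_iso (@osp_mx K m n) phi &
      forall X Y, form X Y = 2%:R^-1 * strace (phi X *m phi Y)
| Listed_F4 of is_F4 g &
    forall X Y, form X Y = 6%:R^-1 * lsa_str (bracket X \o bracket Y).

Section Roots.
Variables (R : realType) (g : lieSuperalgebra R[i]).
Local Notation C := R[i].

(* Cartan subalgebra of the reductive Lie algebra g_0: an abelian, self-      *)
(* centralising subalgebra of elements acting semisimply on g.                *)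
Definition cartan_subalgebra (h : {vspace g}) : Prop :=
  [/\ (h <= gr g false)%VS,
      {in h &, forall H H', bracket H H' = 0},
      forall X, X \in gr g false -> {in h, forall H, bracket H X = 0} ->
        X \in h &
      forall H, H \in h -> exists2 b : seq g, basis_of fullv b &
        forall X, X \in b -> exists c : C, bracket H X = c *: X].

Variable h : {vspace g}.

Definition hdual := 'Hom(subvs_of h, C^o).

(* The root space { X | [H, X] = alpha(H) X for all H in h }, see rootspaceP. *)
Definition rootspace (alpha : hdual) : {vspace g} :=
  lker (linfun (fun X : g =>
    linfun (fun H : subvs_of h => bracket (vsval H) X - alpha H *: X))).

Lemma rootspaceP (alpha : hdual) (X : g) :
  reflect (forall H : subvs_of h, bracket (vsval H) X = alpha H *: X)
          (X \in rootspace alpha).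
Proof.
have [bl br] := bracket_bilinear g.
pose F X (H : subvs_of h) : g := bracket (vsval H) X - alpha H *: X.
have linF Y : linear (F Y).
  move=> a H H'; rewrite /F !linearP /= bl scalerBr addrACA -opprD.
  by rewrite [in X in _ - X]scalerDl -scalerA.
have FE Y H : linfun (F Y) H = F Y H.
  pose m := GRing.isLinear.Build _ _ _ _ (F Y) (linF Y).
  pose F' : {linear subvs_of h -> g} := HB.pack (F Y) m.
  exact: (lfunE F').
have linG : linear (fun Y => linfun (F Y)).
  move=> a Y Z; apply/lfunP => H; rewrite add_lfunE scale_lfunE !FE /F br.
  by rewrite scalerDr scalerBr !scalerA addrACA -opprD [alpha H * a]mulrC.
have GE Y : linfun (fun Y => linfun (F Y)) Y = linfun (F Y).
  pose m := GRing.isLinear.Build _ _ _ _ (fun Y => linfun (F Y)) linG.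
  pose G' : {linear g -> 'Hom(subvs_of h, g)} :=
    HB.pack (fun Y => linfun (F Y)) m.
  exact: (lfunE G').
rewrite /rootspace memv_ker -/(F) GE; apply: (iffP eqP) => [E H|E].
  by apply/eqP; rewrite -subr_eq0 -[_ - _]/(F X H) -FE E zero_lfunE.
by apply/lfunP => H; rewrite FE zero_lfunE /F E subrr.
Qed.

Definition roots : set hdual :=
  [set alpha | alpha != 0 /\ rootspace alpha != 0%VS].

Definition roots_of (i : bool) : set hdual :=
  [set alpha | alpha != 0 /\ (gr g i :&: rootspace alpha)%VS != 0%VS].

(* The roots that are positive for a real-linear functional on h^* vanishing  *)
(* on no root; each such functional is alpha |-> Re (alpha H0), H0 in h.      *)
Definition positive_system (Dp : set hdual) : Prop :=
  exists H0 : subvs_of h,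
    (forall alpha, roots alpha -> complex.Re (alpha H0) != 0) /\
    Dp = [set alpha | roots alpha /\ 0 < complex.Re (alpha H0)].

Variable Dp : set hdual.

Definition posroots (i : bool) : set hdual := Dp `&` roots_of i.

Definition rho_of (i : bool) : hdual :=
  2%:R^-1 *: (\sum_(alpha \in posroots i) alpha).

Definition rho : hdual := rho_of false - rho_of true.

Definition nplus_odd : {vspace g} :=
  \big[addv/0%VS]_(alpha \in posroots true) rootspace alpha.

Definition nminus_odd : {vspace g} :=
  \big[addv/0%VS]_(alpha \in posroots true) rootspace (- alpha).

Variable form : g -> g -> C.

(* The element t of h with (t, H) = lambda(H) for all H in h. *)
Definition hsharp (lambda : hdual) : subvs_of h :=
  xget 0 [set t | forall H : subvs_of h, form (vsval t) (vsval H) = lambda H].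

Definition hform (lambda mu : hdual) : C :=
  form (vsval (hsharp lambda)) (vsval (hsharp mu)).

(* U(g) v = M is expressed as: v lies in no proper submodule. *)
Definition highest_weight_module (M : supermodule g) (Lambda : hdual) : Prop :=
  exists v : M,
    [/\ v != 0,
        forall alpha X, Dp alpha -> X \in rootspace alpha -> sm_act M X v = 0,
        forall H : subvs_of h, sm_act M (vsval H) v = Lambda H *: v &
        forall W : set M, is_submodule W -> W v -> forall w, W w].

End Roots.

Record tensor_product (K : nzRingType) (U V : lmodType K) : Type :=
  TensorProduct {
  tp_sort :> lmodType K;
  tens : U -> V -> tp_sort;
  tens_bilinear : bilinear_fun tens;
  tens_lift : forall (W : lmodType K) (f : U -> V -> W), bilinear_fun f ->
    exists F : {linear tp_sort -> W}, forall u v, F (tens u v) = f u v;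
  tens_unique : forall (W : lmodType K) (F G : {linear tp_sort -> W}),
    (forall u v, F (tens u v) = G (tens u v)) -> F =1 G
}.

Section TensorOperators.
Variables (K : nzRingType) (U V : lmodType K) (T : tensor_product U V).
Variables (f : {linear U -> U}) (f' : {linear V -> V}).

Lemma tens_op_bilinear : bilinear_fun (fun u v => tens T (f u) (f' v)).
Proof.
have [tl tr] := tens_bilinear T.
by split=> [v a u u'|u a v v']; rewrite linearP ?tl ?tr.
Qed.

(* The operator f (x) f', characterised by tens_opE. *)
Definition tens_op : {linear T -> T} :=
  projT1 (cid (tens_lift T tens_op_bilinear)).

Lemma tens_opE u v : tens_op (tens T u v) = tens T (f u) (f' v).
Proof. exact: (projT2 (cid (tens_lift T tens_op_bilinear))). Qed.

End TensorOperators.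

Section Dirac.
Variables (R : realType) (g : lieSuperalgebra R[i]).
Local Notation C := R[i].
Variable form : g -> g -> C.

Definition Bform (X Y : g) : C := 2%:R^-1 * form X Y.

Variables (N : nat) (d x : N.-tuple g).
Local Notation P := {mpoly C[N]}.
Local Notation "'d_ i" := (tnth d i) (at level 8, i at level 2).
Local Notation "'x_ i" := (tnth x i) (at level 8, i at level 2).

Definition mulX (i : 'I_N) (p : P) : P := 'X_i * p.

Lemma mulX_linear i : linear (mulX i).
Proof. by move=> a p q; rewrite /mulX mulrDr -scalerAr. Qed.

HB.instance Definition _ (i : 'I_N) :=
  GRing.isLinear.Build C P P *:%R (mulX i) (mulX_linear i).

(* The action of alpha(X) on the oscillator module C[x_1, ..., x_N]; here d_i *)
(* and x_i in the brackets are the basis vectors of n_1^+ and n_1^-, while    *)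
(* mulX i and mderiv i are the Weyl algebra generators x_i and d/dx_i.        *)
Definition osc (X : g) (p : P) : P :=
  \sum_i \sum_j
     (Bform X (bracket 'd_i 'd_j) *: mulX i (mulX j p)
      + Bform X (bracket 'x_i 'x_j) *: mderiv i (mderiv j p))
  - 2%:R *: (\sum_i \sum_j
       Bform X (bracket 'x_i 'd_j) *: mulX j (mderiv i p))
  - (\sum_l Bform X (bracket 'd_l 'x_l)) *: p.

Lemma osc_linear X : linear (osc X).
Proof.
have lin_sum n (F : 'I_n -> P -> P) :
    (forall i, linear (F i)) -> linear (fun p => \sum_i F i p).
  move=> linF a p q; rewrite scaler_sumr -big_split /=.
  by apply: eq_bigr => i _; rewrite linF.
have linZ (c : C) (F : P -> P) : linear F -> linear (fun p => c *: F p).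
  by move=> linF a p q; rewrite linF scalerDr !scalerA [c * a]mulrC.
have linD (F G : P -> P) : linear F -> linear G -> linear (fun p => F p + G p).
  by move=> linF linG a p q; rewrite linF linG scalerDr addrACA.
have linB (F G : P -> P) : linear F -> linear G -> linear (fun p => F p - G p).
  by move=> linF linG a p q; rewrite linF linG scalerBr opprD addrACA.
apply: (linB); [apply: (linB)|by apply: (linZ _ id)].
- apply: (lin_sum) => i; apply: (lin_sum) => j; apply: linD.
    by apply: (linZ) => a p q; rewrite !linearP.
  by apply: (linZ) => a p q; rewrite !linearP.
- apply: (linZ); apply: (lin_sum) => i; apply: (lin_sum) => j.
  by apply: (linZ) => a p q; rewrite !linearP.
Qed.

HB.instance Definition _ (X : g) :=
  GRing.isLinear.Build C P P *:%R (osc X) (osc_linear X).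

Variables (M : supermodule g) (T : tensor_product M P).

(* X (x) 1 + 1 (x) alpha(X) *)
Definition diag_act (X : g) (w : T) : T :=
  tens_op T (sm_act M X) idfun w + tens_op T idfun (osc X) w.

Definition dirac (w : T) : T :=
  2%:R *: \sum_(i < N)
    (tens_op T (sm_act M 'd_i) (mulX i) w
     - tens_op T (sm_act M 'x_i) (mderiv i) w).

Definition is_g0_submodule (W : set T) : Prop :=
  is_subspace W /\
  (forall X w, X \in gr g false -> W w -> W (diag_act X w)).

(* U / V is a simple highest weight g_0-module of highest weight mu, that is, *)
(* it is isomorphic to L_0(mu).                                               *)
Definition composition_factor (h : {vspace g}) (Dp : set (hdual h))
    (mu : hdual h) (U V : set T) : Prop :=
  [/\ is_g0_submodule U, is_g0_submodule V, V `<=` U,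
      forall W, is_g0_submodule W -> V `<=` W -> W `<=` U ->
        W `<=` V \/ U `<=` W &
      exists u, [/\ U u, ~ V u,
        forall alpha X, posroots Dp false alpha ->
          X \in (gr g false :&: rootspace alpha)%VS -> V (diag_act X u) &
        forall H : subvs_of h, V (diag_act (vsval H) u - mu H *: u)]].

End Dirac.

(* Main.v *)
(** The invariant form makes [D^2 = 2 (Omega_diag - Omega_g - C)] on M (x) C[x], where
    [Omega_diag] is the Casimir operator of g_0 in the diagonal action, [Omega_g] that of g
    in M, and [C] that of g_0 in the oscillator module.  [C] is a scalar: its quartic part
    cancels by the Jacobi identity and its quadratic part is antisymmetric.  Each of the
    three operators is evaluated on a highest weight vector; for [Omega_diag] this is the
    one of the composition factor, taken modulo V.

    This uses that the form is nondegenerate, that root spaces are lines, and that no odd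
    weight vanishes.  For the matrix superalgebras these are read off after diagonalising
    the Cartan subalgebra by an even matrix.  For F(4), a weight vector of the spin module
    is fixed by a product of three commuting Clifford idempotents, which has trace 1 and
    hence rank 1.  If the form is zero, there are no odd roots and D = 0. *)

Require Import Defs.
From HB Require Import structures.
From mathcomp Require Import all_boot all_order all_algebra.
From mathcomp Require Import boolp classical_sets functions cardinality fsbigop reals.
From mathcomp Require Import complex.
From mathcomp Require Import mpoly.
From mathcomp Require Import ring spectral.

Set Implicit Arguments.
Unset Strict Implicit.
Unset Printing Implicit Defensive.

Import Order.TTheory GRing.Theory Num.Theory.
Local Open Scope classical_set_scope.
Local Open Scope ring_scope.

(** * Bilinear maps and weight vectors *)

(** Dual families enter only through the canonical tensor sum e_k (x) f_k, which does not depend on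
    the families chosen; so the given bases d, x and the root vectors can be exchanged at will. D is
    twice this tensor for g_1, with the second factor in the Weyl algebra, and symmetrising its
    square produces the Casimir tensors. On the odd roots the tensor gives sum [d_i, x_i], the
    element of h dual to 2 rho_1: hence 1 has weight - rho_1, and the odd part of Omega_g changes 2
    rho_0 into 2 rho. Since rho = rho_0 - rho_1, the number (mu + 2 rho_0, mu) - (- rho_1 + 2 rho_0,
    - rho_1) equals (mu + rho_1 + 2 rho, mu + rho_1), which is the shape of the scalar.
    One-dimensional root spaces give every root a single parity, so that n_1^+ and n_1^- consist of
    odd elements; absence of an odd zero weight gives g_1 = n_1^+ + n_1^-. The obstacle is that the
    Cartan subalgebra is arbitrary. No conjugacy theorem is invoked: h is diagonalised because the
    span of its weight rows is stable under enough of the algebra to be the whole space. *)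

Section Bilinear.
Variables (K : nzRingType) (U V W : lmodType K) (f : U -> V -> W).
Hypothesis f_bil : bilinear_fun f.

Lemma bilDl u u' v : f (u + u') v = f u v + f u' v.
Proof. by have := f_bil.1 v 1 u u'; rewrite !scale1r. Qed.

Lemma bilDr u v v' : f u (v + v') = f u v + f u v'.
Proof. by have := f_bil.2 u 1 v v'; rewrite !scale1r. Qed.

Lemma bil0l v : f 0 v = 0.
Proof. by apply: (addrI (f 0 v)); rewrite -bilDl !addr0. Qed.

Lemma bil0r u : f u 0 = 0.
Proof. by apply: (addrI (f u 0)); rewrite -bilDr !addr0. Qed.

Lemma bilZl a u v : f (a *: u) v = a *: f u v.
Proof. by have := f_bil.1 v a u 0; rewrite !addr0 bil0l addr0. Qed.

Lemma bilZr a u v : f u (a *: v) = a *: f u v.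
Proof. by have := f_bil.2 u a v 0; rewrite !addr0 bil0r addr0. Qed.

Lemma bilNl u v : f (- u) v = - f u v.
Proof. by rewrite -scaleN1r bilZl scaleN1r. Qed.

Lemma bilNr u v : f u (- v) = - f u v.
Proof. by rewrite -scaleN1r bilZr scaleN1r. Qed.

Lemma bilBl u u' v : f (u - u') v = f u v - f u' v.
Proof. by rewrite bilDl bilNl. Qed.

Lemma bilBr u v v' : f u (v - v') = f u v - f u v'.
Proof. by rewrite bilDr bilNr. Qed.

Lemma bil_suml (I : Type) (r : seq I) (P : pred I) (F : I -> U) v :
  f (\sum_(i <- r | P i) F i) v = \sum_(i <- r | P i) f (F i) v.
Proof. exact: (big_morph (f^~ v) (fun u u' => bilDl u u' v) (bil0l v)). Qed.

Lemma bil_sumr (I : Type) (r : seq I) (P : pred I) (F : I -> V) u :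
  f u (\sum_(i <- r | P i) F i) = \sum_(i <- r | P i) f u (F i).
Proof. exact: (big_morph (f u) (bilDr u) (bil0r u)). Qed.

End Bilinear.

Lemma bracket_bil (K : fieldType) (g : lieSuperalgebra K) :
  bilinear_fun (@bracket K g).
Proof. exact: bracket_bilinear. Qed.

Section WeightIndependence.
Variables (K : fieldType) (V : lmodType K) (J : Type) (A : J -> V -> V).
Hypothesis A_linear : forall j, linear (A j).

(** For an index i of the tail some [A j] separates it from the head [i0]. Subtracting the
    eigenvalue of the head kills the head term, and the shorter relation forces a nonzero multiple
    of [Y i] to vanish. *)
Lemma weight_independence (I : eqType) (r : seq I) (wt : I -> J -> K)
    (Y : I -> V) :
  uniq r ->
  {in r &, forall i i', wt i =1 wt i' -> i = i'} ->
  {in r, forall i j, A j (Y i) = wt i j *: Y i} ->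
  \sum_(i <- r) Y i = 0 -> {in r, forall i, Y i = 0}.
Proof.
elim: r Y => [//|i0 r IH] Y /= /andP[i0r ur] wt_inj AY sum0.
have A0 j : A j 0 = 0 by have := A_linear j (-1) 0 0; rewrite scaler0 addr0 scaleN1r addNr.
have AD j u v : A j (u + v) = A j u + A j v.
  by have := A_linear j 1 u v; rewrite !scale1r.
have Asum j : A j (\sum_(i <- i0 :: r) Y i) = \sum_(i <- i0 :: r) A j (Y i).
  exact: (big_morph _ (AD j) (A0 j)).
have Yr : {in r, forall i, Y i = 0}.
  move=> i ir.
  have [j nij] : exists j, wt i j != wt i0 j.
    apply: contrapT => /forallNP h.
    have e : i = i0.
      apply: wt_inj; rewrite ?mem_head // ?inE ?ir ?orbT // => j.
      by apply/eqP; apply: contrapT => /negP; apply: h.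
    by rewrite -e ir in i0r.
  pose Z i := (wt i j - wt i0 j) *: Y i.
  have : Z i = 0.
    apply: (IH Z) => //.
    - by move=> a b ar br; apply: wt_inj; rewrite inE ?ar ?br orbT.
    - move=> a ar k; rewrite /Z.
      have /(_ k) /= := A_linear _ (wt a j - wt i0 j) (Y a) 0.
      rewrite addr0 A0 addr0 => ->.
      by rewrite AY ?inE ?ar ?orbT // !scalerA mulrC.
    - have : \sum_(i <- i0 :: r) Z i = 0.
        under eq_bigr do rewrite /Z scalerBl.
        rewrite big_split /= sumrN -scaler_sumr sum0 scaler0 subr0.
        transitivity (\sum_(i <- i0 :: r) A j (Y i)).
          by rewrite !big_seq; apply: eq_bigr => a /AY ->.
        by rewrite -Asum sum0 A0.
      by rewrite big_cons {1}/Z subrr scale0r add0r.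
  by rewrite /Z => /eqP; rewrite scaler_eq0 subr_eq0 (negPf nij) => /eqP.
move=> i; rewrite inE => /orP[/eqP->|/Yr//].
move: sum0; rewrite big_cons big_seq big1 ?addr0 //.
Qed.

End WeightIndependence.

Lemma linear_hom (K : nzRingType) (U V : vectType K) (f : U -> V) :
  linear f -> exists F : 'Hom(U, V), F =1 f.
Proof.
move=> lf; pose m := GRing.isLinear.Build _ _ _ _ f lf.
pose f' : {linear U -> V} := HB.pack f m.
by exists (linfun f') => u; rewrite (lfunE f').
Qed.

Section SumOf.
Variables (V : zmodType) (P : V -> Prop).

(** Additive closure of a predicate, witnessed by a list. For predicates stable under scaling, such
    as being a weight vector, this is the linear span, without a choice of basis. *)
Definition sum_of (v : V) : Prop :=
  exists2 s : seq V, v = \sum_(u <- s) u & {in s, forall u, P u}.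

Lemma sum_of0 : sum_of 0.
Proof. by exists [::]; rewrite ?big_nil. Qed.

Lemma sum_of1 v : P v -> sum_of v.
Proof. by exists [:: v]; [rewrite big_seq1|move=> u; rewrite inE => /eqP->]. Qed.

Lemma sum_ofD u v : sum_of u -> sum_of v -> sum_of (u + v).
Proof.
move=> [s -> hs] [t -> ht]; exists (s ++ t); first by rewrite big_cat.
by move=> w; rewrite mem_cat => /orP[/hs|/ht].
Qed.

Lemma sum_of_sum (I : Type) (r : seq I) (Q : pred I) (F : I -> V) :
  (forall i, Q i -> sum_of (F i)) -> sum_of (\sum_(i <- r | Q i) F i).
Proof.
move=> h; elim: r => [|i r IH]; first by rewrite big_nil; apply: sum_of0.
by rewrite big_cons; case: ifP => // /h; move/sum_ofD; apply.
Qed.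

Lemma sum_of_ind (Q : V -> Prop) :
  Q 0 -> (forall u v, Q u -> Q v -> Q (u + v)) -> (forall u, P u -> Q u) ->
  forall v, sum_of v -> Q v.
Proof.
move=> Q0 QD PQ v [s -> hs]; rewrite big_seq.
by elim/big_ind: _ => // u us; apply/PQ/hs.
Qed.

End SumOf.

Lemma sum_of_sub (V : zmodType) (P Q : V -> Prop) :
  (forall v, P v -> sum_of Q v) -> forall v, sum_of P v -> sum_of Q v.
Proof.
by move=> PQ; apply: sum_of_ind => //; [apply: sum_of0|apply: sum_ofD].
Qed.

(** [Y c] gathers the terms of the expansion of X in the eigenbasis whose eigenvalue is c; the list
    r holds the distinct eigenvalues. *)
Lemma eigen_split (K : fieldType) (V : vectType K) (f : V -> V) (b : seq V) :
  linear f -> basis_of fullv b ->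
  (forall X, X \in b -> exists c, f X = c *: X) ->
  forall X, exists r : seq K, exists2 Y : K -> V,
    uniq r /\ X = \sum_(c <- r) Y c & forall c, f (Y c) = c *: Y c.
Proof.
move=> lf bb beig X.
have f0 : f 0 = 0 by have := lf (-1) 0 0; rewrite scaler0 addr0 scaleN1r addNr.
have fZ a u : f (a *: u) = a *: f u by have := lf a u 0; rewrite !addr0 f0 addr0.
have fD u v : f (u + v) = f u + f v by have := lf 1 u v; rewrite !scale1r.
have [ev evP] : exists ev : V -> K, forall u, u \in b -> f u = ev u *: u.
  have : forall u, exists c, u \in b -> f u = c *: u.
    by move=> u; case: (boolP (u \in b)) => [/beig[c]|]; [exists c|exists 0].
  by move=> /boolp.choice[ev evP]; exists ev.
have Xb : X = \sum_(i < size b) coord (in_tuple b) i X *: b`_i.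
  by apply: (@coord_span _ _ _ (in_tuple b)); rewrite (span_basis bb) memvf.
exists (undup (map ev b)).
exists (fun c => \sum_(i < size b | ev b`_i == c) coord (in_tuple b) i X *: b`_i).
  split; first exact: undup_uniq.
  rewrite {1}Xb (exchange_big_dep xpredT) //=; apply: eq_bigr => i _.
  rewrite -big_filter filter_undup.
  rewrite (_ : undup _ = [:: ev b`_i]) ?big_seq1 //.
  have : ev b`_i \in map ev b by apply/map_f/mem_nth.
  rewrite -mem_undup => h; rewrite -filter_undup.
  rewrite (eq_filter (a2 := pred1 (ev b`_i))); last by move=> c /=; rewrite eq_sym.
  by rewrite filter_pred1_uniq ?undup_uniq.
move=> c; rewrite (big_morph f fD f0) scaler_sumr; apply: eq_bigr => i /eqP ic.
by rewrite fZ evP ?mem_nth // ic !scalerA mulrC.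
Qed.

Section WeightDecomposition.
Variables (R : realType) (g : lieSuperalgebra R[i]) (h : {vspace g}).
Hypothesis h_cartan : cartan_subalgebra h.
Local Notation br := (@bracket _ g).
Let bb := bracket_bil g.

Definition weight_vector (X : g) : Prop :=
  exists alpha : hdual h, X \in rootspace alpha.

Lemma bracket_linear (H : g) : linear (br H).
Proof. exact: bb.2. Qed.

Lemma h_even H : H \in h -> H \in gr g false.
Proof. by case: h_cartan => /subvP hg _ _ _ /hg. Qed.

Lemma jacobi_even H X Y : H \in gr g false ->
  br H (br X Y) = br (br H X) Y + br X (br H Y).
Proof.
move=> H0.
have key i : {in gr g i, forall X, br H (br X Y) = br (br H X) Y + br X (br H Y)}.
  by move=> Z Zi; rewrite (bracket_jacobi Y H0 Zi) /= expr0 scale1r.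
have : X \in (gr g false + gr g true)%VS by rewrite gr_sum memvf.
case/memv_addP => X0 /key k0 [X1 /key k1 ->].
by rewrite !(bilDl bb, bilDr bb) k0 k1 addrACA.
Qed.

Lemma h_comm H H' X : H \in h -> H' \in h -> br H (br H' X) = br H' (br H X).
Proof.
move=> Hh Hh'; case: h_cartan => _ hc _ _.
by rewrite jacobi_even ?h_even // (hc H H') // (bil0l bb) add0r.
Qed.

(** Splitting a joint eigenvector along one more H keeps the pieces joint eigenvectors: H' commutes
    with H, so the defects (H' - l) Y c are H-eigenvectors for distinct eigenvalues with sum zero,
    and vanish. *)
Lemma joint_eigen (s : seq g) : {subset s <= h} ->
  forall X, sum_of (fun Y => {in s, forall H, exists c, br H Y = c *: Y}) X.
Proof.
elim: s => [|H s IH] sh X; first by apply: sum_of1.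
have {}IH := IH (fun Y hY => sh Y (mem_behead (s := H :: s) hY)).
have Hh : H \in h by apply: sh; rewrite mem_head.
apply: sum_of_sub (IH X) => {X} X hX.
have [b bf beig] : exists2 b : seq g, basis_of fullv b &
  forall X, X \in b -> exists c, br H X = c *: X by case: h_cartan => _ _ _; apply.
have [r [Y [ur XY] HY]] := eigen_split (bracket_linear H) bf beig X.
rewrite XY big_seq; apply: sum_of_sum => c cr; apply: sum_of1 => H'.
rewrite inE => /orP[/eqP->|H's]; first by exists c.
have [l hl] := hX _ H's; exists l; apply/eqP; rewrite -subr_eq0; apply/eqP.
have H'h : H' \in h by apply: sh; rewrite inE H's orbT.
pose Z c := br H' (Y c) - l *: Y c.
apply: (@weight_independence _ _ unit (fun=> br H) _ _ r (fun c _ => c) Z) => //.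
- by move=> _; apply: bracket_linear.
- by move=> a e _ _ /(_ tt).
- move=> a _ _; rewrite /Z (bilBr bb) (bilZr bb) h_comm // HY (bilZr bb) scalerBr.
  by rewrite !scalerA mulrC.
- rewrite sumrB -scaler_sumr -(bil_sumr bb) -XY hl.
  by rewrite subrr.
Qed.

(** The eigenvalue is linear in H because it is a coordinate of [br H X] divided by the same,
    nonzero, coordinate of X. *)
Lemma weight_vectorP X :
  {in h, forall H, exists c, br H X = c *: X} -> weight_vector X.
Proof.
move=> hX; have [->|X0] := eqVneq X 0; first by exists 0; apply: mem0v.
have [k kX] : exists k, coord (vbasis fullv) k X != 0.
  apply: contrapT => /forallNP hk; move/negP: X0; apply; apply/eqP.
  rewrite (coord_vbasis (memvf X)) big1 // => k _.
  by have /negP := hk k; rewrite negbK => /eqP->; rewrite scale0r.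
have lf : linear (fun H : subvs_of h =>
   (coord (vbasis fullv) k (br (vsval H) X) / coord (vbasis fullv) k X : R[i]^o)).
  move=> a H H'; rewrite linearP (bilDl bb) (bilZl bb) linearP.
  by rewrite mulrDl -mulrA.
have [F hF] := linear_hom lf; exists F; apply/rootspaceP => H; rewrite hF.
have [c ->] := hX _ (subvsP H).
by rewrite linearZ /= -mulrA divff ?mulr1.
Qed.

Lemma weight_span X : sum_of weight_vector X.
Proof.
have sub : {subset vbasis h <= h} by move=> H /vbasis_mem.
apply: sum_of_sub (joint_eigen sub X) => Y hY; apply/sum_of1/weight_vectorP.
move=> H /coord_vbasis ->.
have /boolp.choice[c hc] : forall i : 'I_(\dim h),
    exists c, br (vbasis h)`_i Y = c *: Y.
  by move=> i; apply: hY; rewrite mem_nth ?size_tuple.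
exists (\sum_i coord (vbasis h) i H * c i).
rewrite (bil_suml bb) scaler_suml; apply: eq_bigr => i _.
by rewrite (bilZl bb) hc scalerA.
Qed.

End WeightDecomposition.

(** * Invariant forms *)

Lemma span_ind (K : fieldType) (V : vectType K) (s : seq V) (P : V -> Prop) :
  P 0 -> (forall a u v, P u -> P v -> P (a *: u + v)) ->
  {in s, forall u, P u} -> forall v, v \in <<s>>%VS -> P v.
Proof.
move=> P0 PD Ps v /(@coord_span _ _ _ (in_tuple s)) ->.
elim/big_rec: _ => // i u _; apply: PD; apply: Ps.
by apply: mem_nth; case: i.
Qed.

Section InvariantForms.
Variables (K : fieldType) (g : lieSuperalgebra K).

Definition invariant_form (form : g -> g -> K) : Prop :=
  [/\ bilinear_fun (form : g -> g -> K^o),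
      forall i j X Y, X \in gr g i -> Y \in gr g j -> i != j -> form X Y = 0,
      forall i j X Y, X \in gr g i -> Y \in gr g j ->
        form X Y = (-1) ^+ (i && j) * form Y X &
      forall X Y Z, form (bracket X Y) Z = form X (bracket Y Z)].

Definition nondegenerate (form : g -> g -> K) : Prop :=
  forall X, (forall Y, form X Y = 0) -> X = 0.

Lemma gr_split (X : g) :
  exists X0 X1, [/\ X0 \in gr g false, X1 \in gr g true & X = X0 + X1].
Proof.
have : X \in (gr g false + gr g true)%VS by rewrite gr_sum memvf.
by case/memv_addP => X0 ? [X1 ? ->]; exists X0, X1.
Qed.

Lemma gr_disjoint z (X : g) : X \in gr g z -> X \in gr g (~~ z) -> X = 0.
Proof.
move=> h1 h2; apply/eqP; rewrite -memv0 -(gr_cap g) memv_cap.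
by case: z h1 h2 => /= -> ->.
Qed.

Lemma gr_ind (P : g -> Prop) :
  (forall X Y, P X -> P Y -> P (X + Y)) ->
  (forall i X, X \in gr g i -> P X) -> forall X, P X.
Proof.
by move=> PD Pi X; have [X0 [X1 [h0 h1 ->]]] := gr_split X; apply: PD; eauto.
Qed.

Lemma bracket_even_skew z (H X : g) :
  H \in gr g false -> X \in gr g z -> bracket X H = - bracket H X.
Proof. by move=> H0 X0; rewrite (bracket_skew X0 H0) andbF expr0 scale1r. Qed.

Lemma bracket_even_skew' (H X : g) :
  H \in gr g false -> bracket X H = - bracket H X.
Proof.
move=> H0; have bb := bracket_bil g; elim/gr_ind: X => [X Y h1 h2|i X].
  by rewrite (bilDl bb) (bilDr bb) h1 h2 opprD.
exact: bracket_even_skew.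
Qed.

Variable form : g -> g -> K.

(** A list of pairs, so that dual families can be concatenated, swapped and mapped. The order of the
    arguments of [form] matters: on the odd part the form is skew. *)
Definition dual_pair (S S' : {vspace g}) (ps : seq (g * g)) : Prop :=
  [/\ {in ps, forall p, p.1 \in S /\ p.2 \in S'},
      {in S, forall X, X = \sum_(p <- ps) form X p.2 *: p.1} &
      {in S', forall Y, Y = \sum_(p <- ps) form p.1 Y *: p.2}].

Hypothesis form_inv : invariant_form form.
Let fb : bilinear_fun (form : g -> g -> K^o). Proof. by case: form_inv. Qed.

Lemma form_ad (H X Y : g) : H \in gr g false ->
  form (bracket H X) Y = - form X (bracket H Y).
Proof.
move=> H0; have [_ _ _ hinv] := form_inv.
by rewrite -hinv (bracket_even_skew' _ H0) (bilNl fb) opprK.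
Qed.

Lemma dual_pair_span (I : eqType) (r : seq I) (e f : I -> g) :
  uniq r -> {in r &, forall i j, form (e i) (f j) = (i == j)%:R} ->
  dual_pair <<map e r>>%VS <<map f r>>%VS [seq (e i, f i) | i <- r].
Proof.
move=> ur ef.
split=> [p /mapP[i ir ->]|X X0|Y Y0].
- by split; apply/memv_span/map_f.
- elim/span_ind: X / X0 => [|a X Y XE YE|_ /mapP[i ir ->]].
  + by rewrite big1 // => p _; rewrite (bil0l fb) scale0r.
  + rewrite [in LHS]XE [in LHS]YE scaler_sumr -big_split; apply: eq_bigr => p _ /=.
    by rewrite (bilDl fb) (bilZl fb) scalerDl scalerA.
  + rewrite big_map (bigD1_seq i) //= ef // eqxx scale1r big_seq_cond big1 ?addr0 //.
    by move=> j /andP[jr ji]; rewrite ef // eq_sym (negPf ji) scale0r.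
- elim/span_ind: Y / Y0 => [|a X Y XE YE|_ /mapP[i ir ->]].
  + by rewrite big1 // => p _; rewrite (bil0r fb) scale0r.
  + rewrite [in LHS]XE [in LHS]YE scaler_sumr -big_split; apply: eq_bigr => p _ /=.
    by rewrite (bilDr fb) (bilZr fb) scalerDl scalerA.
  + rewrite big_map (bigD1_seq i) //= ef // eqxx scale1r big_seq_cond big1 ?addr0 //.
    by move=> j /andP[jr ji]; rewrite ef // (negPf ji) scale0r.
Qed.

(* The tensor sum_k e_k (x) f_k depends only on S and S'. *)
Lemma dual_pair_indep S S' ps qs (W : lmodType K) (B : g -> g -> W) :
  bilinear_fun B -> dual_pair S S' ps -> dual_pair S S' qs ->
  \sum_(p <- ps) B p.1 p.2 = \sum_(q <- qs) B q.1 q.2.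
Proof.
move=> Bb [psS _ psR] [qsS qsL _].
transitivity (\sum_(p <- ps) \sum_(q <- qs) form p.1 q.2 *: B q.1 p.2).
  rewrite !big_seq; apply: eq_bigr => p /psS[p1 _].
  by rewrite {1}(qsL _ p1) (bil_suml Bb); apply: eq_bigr => q _; rewrite (bilZl Bb).
rewrite exchange_big !big_seq; apply: eq_bigr => q /qsS[_ q2].
by rewrite {2}(psR _ q2) (bil_sumr Bb); apply: eq_bigr => p _; rewrite (bilZr Bb).
Qed.

(** Invariance of the canonical tensor: by invariance of the form, the matrices of ad H on S and S'
    in dual families are negative transposes of each other. *)
Lemma dual_pair_inv S S' ps (W : lmodType K) (B : g -> g -> W) (H : g) :
  bilinear_fun B -> dual_pair S S' ps -> H \in gr g false ->
  {in S, forall X, bracket H X \in S} -> {in S', forall X, bracket H X \in S'} ->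
  \sum_(p <- ps) B (bracket H p.1) p.2 = - \sum_(p <- ps) B p.1 (bracket H p.2).
Proof.
move=> Bb [psS psL psR] H0 HS HS'.
transitivity (\sum_(p <- ps) \sum_(q <- ps) form (bracket H p.1) q.2 *: B q.1 p.2).
  rewrite !big_seq; apply: eq_bigr => p /psS[/HS p1 _].
  by rewrite {1}(psL _ p1) (bil_suml Bb); apply: eq_bigr => q _; rewrite (bilZl Bb).
rewrite exchange_big -sumrN !big_seq; apply: eq_bigr => q /psS[_ /HS' q2].
rewrite [in RHS](psR _ q2) (bil_sumr Bb) -sumrN; apply: eq_bigr => p _.
by rewrite form_ad // scaleNr (bilZr Bb).
Qed.

End InvariantForms.

(** * Roots *)

Section RootTheory.
Variables (R : realType) (g : lieSuperalgebra R[i]) (h : {vspace g}).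
Variable form : g -> g -> R[i].
Hypothesis h_cartan : cartan_subalgebra h.
Hypothesis form_inv : invariant_form form.
Hypothesis form_nd : nondegenerate form.
Hypothesis root_line : forall (alpha : hdual h) X Y, alpha != 0 ->
  X \in rootspace alpha -> Y \in rootspace alpha -> X != 0 -> exists c, Y = c *: X.
Hypothesis odd_zero_weight : forall X, X \in gr g true ->
  {in h, forall H, bracket H X = 0} -> X = 0.
Local Notation br := (@bracket _ g).
Let bb := bracket_bil g.
Let fb : bilinear_fun (form : g -> g -> R[i]^o). Proof. by case: form_inv. Qed.
Implicit Types alpha beta : hdual h.

Lemma form_parity i j X Y :
  X \in gr g i -> Y \in gr g j -> i != j -> form X Y = 0.
Proof. by case: form_inv => _ + _ _; apply. Qed.

Lemma form_skew i X Y : X \in gr g i -> Y \in gr g i ->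
  form X Y = (-1) ^+ i * form Y X.
Proof. by move=> hX hY; case: form_inv => _ _ /(_ _ _ _ _ hX hY); rewrite andbb. Qed.

Lemma formA X Y Z : form (br X Y) Z = form X (br Y Z).
Proof. by case: form_inv. Qed.

Lemma form_h_sym H X : H \in gr g false -> form H X = form X H.
Proof.
move=> H0; elim/gr_ind: X => [X Y h1 h2|[] X hX].
- by rewrite (bilDl fb) (bilDr fb) h1 h2.
- by rewrite (form_parity H0 hX) // (form_parity hX H0).
- by rewrite (form_skew H0 hX) expr0 mul1r.
Qed.

Lemma cartan_even H : H \in h -> H \in gr g false.
Proof. exact: h_even. Qed.

Lemma rootspace_ad alpha X H : X \in rootspace alpha -> H \in h ->
  br H X = alpha (vsproj h H) *: X.
Proof. by move=> /rootspaceP + Hh => /(_ (vsproj h H)); rewrite vsprojK. Qed.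

Lemma cartan_rootspace0 H : H \in h -> H \in rootspace (0 : hdual h).
Proof.
move=> Hh; apply/rootspaceP => H'; rewrite zero_lfunE scale0r.
by case: h_cartan => _ hc _ _; rewrite hc ?subvsP.
Qed.

(** As H is even, the defect of X0 is even and equals minus the defect of X1, which is odd; both
    vanish. *)
Lemma rootspace_parts alpha X0 X1 : X0 \in gr g false -> X1 \in gr g true ->
  X0 + X1 \in rootspace alpha -> X0 \in rootspace alpha /\ X1 \in rootspace alpha.
Proof.
move=> h0 h1 /rootspaceP hX.
have key (H : subvs_of h) : br (vsval H) X0 - alpha H *: X0 = 0
    /\ br (vsval H) X1 - alpha H *: X1 = 0.
  have E : br (vsval H) X0 - alpha H *: X0 = - (br (vsval H) X1 - alpha H *: X1).
    apply/eqP; rewrite -subr_eq0 opprK addrACA -opprD -(bilDr bb) -scalerDr.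
    by rewrite hX subrr.
  have He := cartan_even (subvsP H).
  have e0 : br (vsval H) X0 - alpha H *: X0 \in gr g false.
    by rewrite rpredB ?rpredZ // -[false]/(addb false false) bracket_gr.
  have e1 : br (vsval H) X1 - alpha H *: X1 \in gr g true.
    by rewrite rpredB ?rpredZ // -[true]/(addb false true) bracket_gr.
  have z : br (vsval H) X0 - alpha H *: X0 = 0.
    by apply: (@gr_disjoint _ _ false) => //; rewrite E rpredN.
  by rewrite z in E; split=> //; apply: oppr_inj; rewrite -E oppr0.
by split; apply/rootspaceP => H; apply/eqP; rewrite -subr_eq0; case: (key H) => /eqP ? /eqP.
Qed.

Lemma rootspace0_cartan X : X \in rootspace (0 : hdual h) -> X \in h.
Proof.
have [X0 [X1 [h0 h1 ->]]] := gr_split X.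
case/(rootspace_parts h0 h1) => z0 z1.
have -> : X1 = 0.
  apply: odd_zero_weight => // H Hh.
  by rewrite (rootspace_ad z1 Hh) zero_lfunE scale0r.
rewrite addr0; case: h_cartan => _ _ + _; apply=> // H Hh.
by rewrite (rootspace_ad z0 Hh) zero_lfunE scale0r.
Qed.

Lemma rootspace_form alpha beta X Y : X \in rootspace alpha ->
  Y \in rootspace beta -> alpha + beta != 0 -> form X Y = 0.
Proof.
move=> hX hY ab.
have [H nz] : exists H, (alpha + beta) H != 0.
  apply: contrapT => /forallNP h0; move/negP: ab; apply; apply/eqP/lfunP => H.
  by rewrite zero_lfunE; apply/eqP; have /negP := h0 H; rewrite negbK.
have := form_ad form_inv X Y (cartan_even (subvsP H)).
move/rootspaceP: hX => ->; move/rootspaceP: hY => ->.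
rewrite (bilZl fb) (bilZr fb) => /eqP; rewrite -addr_eq0 -scalerDl scaler_eq0.
by rewrite add_lfunE in nz; rewrite (negPf nz) => /eqP.
Qed.

Lemma rootspace_bracket alpha beta X Y : X \in rootspace alpha ->
  Y \in rootspace beta -> br X Y \in rootspace (alpha + beta).
Proof.
move=> /rootspaceP hX /rootspaceP hY; apply/rootspaceP => H.
rewrite jacobi_even ?(cartan_even (subvsP H)) // hX hY (bilZl bb) (bilZr bb).
by rewrite add_lfunE scalerDl.
Qed.

(** X pairs to zero with weight vectors of weight other than - alpha and with the other parity.
    Since weight vectors span g, nondegeneracy leaves a partner of weight - alpha and parity i,
    which is rescaled. *)
Lemma rootspace_partner i alpha X : X \in gr g i -> X \in rootspace alpha ->
  X != 0 -> exists Y, [/\ Y \in gr g i, Y \in rootspace (- alpha) & form X Y = 1].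
Proof.
move=> Xi Xa X0.
suff [Y [Yi Ya nz]] : exists Y, [/\ Y \in gr g i, Y \in rootspace (- alpha) & form X Y != 0].
  exists ((form X Y)^-1 *: Y); rewrite !rpredZ //; split=> //.
  by rewrite (bilZr fb); apply: mulVf.
apply: contrapT => /forallNP hN; move/negP: X0; apply; apply/eqP/form_nd.
move=> Y; elim/sum_of_ind: {Y}(weight_span h_cartan Y).
- exact: (bil0r fb).
- by move=> Y Z; rewrite (bilDr fb) => -> ->; rewrite addr0.
move=> Y [beta Yb]; case: (boolP (alpha + beta == 0)) => [/eqP ab|ab]; last first.
  exact: (rootspace_form Xa Yb ab).
have {}ab : beta = - alpha by apply/eqP; rewrite -addr_eq0 addrC ab.
have [Y0 [Y1 [h0 h1 E]]] := gr_split Y; rewrite E in Yb *.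
have [z0 z1] := rootspace_parts h0 h1 Yb; rewrite ab in z0 z1.
rewrite (bilDr fb) -[RHS]addr0; congr (_ + _).
  case: i Xi hN => Xi hN; first exact: (form_parity Xi h0).
  by apply/eqP; apply: contrapT => /negP nz; apply: (hN Y0).
case: i Xi hN => Xi hN; last exact: (form_parity Xi h1).
by apply/eqP; apply: contrapT => /negP nz; apply: (hN Y1).
Qed.

Lemma rootspace_homogeneous alpha X i : alpha != 0 -> X \in gr g i ->
  X \in rootspace alpha -> X != 0 -> {subset rootspace alpha <= gr g i}.
Proof.
move=> a0 Xi Xa X0 Y Ya; have [c ->] := root_line a0 Xa Ya X0.
exact: rpredZ.
Qed.

Lemma weight_family : exists2 r : seq (hdual h), uniq r &
  forall X, exists2 Y : hdual h -> g, X = \sum_(a <- r) Y a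
    & forall a, Y a \in rootspace a.
Proof.
have [wt wtP] : exists wt : g -> hdual h,
    forall X, weight_vector h X -> X \in rootspace (wt X).
  have : forall X, exists a : hdual h, weight_vector h X -> X \in rootspace a.
    by move=> X; case: (pselect (weight_vector h X)) => [[a]|]; [exists a|exists 0].
  by move=> /boolp.choice[wt]; exists wt.
have : forall k : 'I_(\dim {:g}), exists s : seq g,
    (vbasis {:g})`_k = \sum_(u <- s) u /\ {in s, forall u, weight_vector h u}.
  by move=> k; case: (weight_span h_cartan (vbasis {:g})`_k) => s; exists s.
move=> /boolp.choice[s sP].
pose r := undup [seq wt u | k <- enum 'I_(\dim {:g}), u <- s k].
exists r; first exact: undup_uniq.
pose Q X := exists2 Y : hdual h -> g, X = \sum_(a <- r) Y a
    & forall a, Y a \in rootspace a.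
have Q0 : Q 0 by exists (fun=> 0) => [|a]; rewrite ?big1 ?mem0v.
have QD a u v : Q u -> Q v -> Q (a *: u + v).
  move=> [Y -> hY] [Z -> hZ]; exists (fun b => a *: Y b + Z b).
    by rewrite scaler_sumr big_split.
  by move=> b; rewrite rpredD ?rpredZ ?hY ?hZ.
move=> X; rewrite (coord_vbasis (memvf X)) -/(Q _).
elim/big_rec: _ => // k v _; apply: (QD).
have [-> sw] := sP k.
rewrite big_seq; elim/big_rec: _ => // u v' us; rewrite -[u]scale1r; apply: (QD).
exists (fun a => if a == wt u then u else 0).
  have ur : wt u \in r.
    by rewrite mem_undup; apply/allpairsPdep; exists k, u; rewrite mem_enum.
  rewrite (bigD1_seq (wt u)) ?undup_uniq //= eqxx big1 ?addr0 //.
  by move=> a /negPf ->.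
by move=> a; case: eqP => [->|_]; [apply/wtP/sw|apply: mem0v].
Qed.

Lemma weights_free (r : seq (hdual h)) (Y : hdual h -> g) : uniq r ->
  {in r, forall a, Y a \in rootspace a} -> \sum_(a <- r) Y a = 0 ->
  {in r, forall a, Y a = 0}.
Proof.
move=> ur hY; apply: (@weight_independence _ _ (subvs_of h) (fun H => br (vsval H)) _ _ r
  (fun a H => a H) Y) => //.
- by move=> H; apply: bracket_linear.
- by move=> a b _ _ E; apply/lfunP.
- by move=> a /hY /rootspaceP.
Qed.

(** A root outside the list of weights would have a root vector that is also a sum of vectors of
    other weights, against independence of weights. *)
Lemma root_enum : exists2 r : seq (hdual h), uniq r &
  forall alpha, alpha \in r <-> Defs.roots alpha.
Proof.
have [r ur rP] := weight_family.
exists [seq a <- r | (a != 0) && (rootspace a != 0%VS)]; first exact: filter_uniq.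
move=> a; rewrite mem_filter; split=> [/andP[/andP[]]//|[-> hr]].
rewrite hr /=; apply: contrapT => /negP ar.
have X0 : vpick (rootspace a) != 0 by rewrite vpick0.
have [Y XY hY] := rP (vpick (rootspace a)).
have : forall b, b \in a :: r -> (fun b => if b == a then - vpick (rootspace a) else Y b) b = 0.
  apply: weights_free; first by rewrite /= ar.
    by move=> b _; case: eqP => [->|_]; rewrite ?rpredN ?memv_pick.
  rewrite big_cons eqxx big_seq_cond (eq_bigr Y).
    by rewrite -big_seq_cond -XY addNr.
  by move=> b /andP[br _]; case: eqP => // ba; rewrite -ba br in ar.
move/(_ a (mem_head _ _)); rewrite /= eqxx => /eqP; rewrite oppr_eq0.
by rewrite (negPf X0).
Qed.

(** The parity z parts [Z a] of the weight components suffice: X minus their sum has parity z and is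
    also a sum of elements of the other parity. *)
Lemma homogeneous_weight_family z X : X \in gr g z ->
  exists r : seq (hdual h), exists2 Y : hdual h -> g,
  uniq r /\ X = \sum_(a <- r) Y a
    & forall a, Y a \in rootspace a /\ Y a \in gr g z.
Proof.
move=> Xz; have [r ur rP] := weight_family; have [Y XY hY] := rP X.
have : forall a, exists Z, [/\ Z \in gr g z, Y a - Z \in gr g (~~ z) & Z \in rootspace a].
  move=> a; have [Y0 [Y1 [h0 h1 E]]] := gr_split (Y a).
  have := hY a; rewrite E => /(rootspace_parts h0 h1)[e0 e1].
  by case: (z); [exists Y1|exists Y0]; split=> //; rewrite ?addrK // addrC addKr.
move=> /boolp.choice[Z ZP]; exists r, Z; last by move=> a; have [] := ZP a.
split=> //; apply/eqP; rewrite -subr_eq0; apply/eqP/(@gr_disjoint _ _ z).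
  by rewrite rpredB // rpred_sum // => a _; have [] := ZP a.
by rewrite XY -sumrB rpred_sum // => a _; have [] := ZP a.
Qed.

Variable Dp : set (hdual h).
Hypothesis Dp_pos : positive_system Dp.

(** If alpha is negative at [H0], then - alpha is again a root, because nondegeneracy pairs the root
    space of alpha with that of - alpha. *)
Lemma positive_opp alpha : Defs.roots alpha -> Dp alpha \/ Dp (- alpha).
Proof.
have [H0 [H0n ->]] := Dp_pos; move=> ra.
have [nz rn] := ra; have := H0n _ ra.
case: (ltrgt0P (complex.Re (alpha H0))) => // s _; first by left.
right; split; last by rewrite opp_lfunE raddfN /= oppr_gt0.
split; first by rewrite oppr_eq0.
have X0 : vpick (rootspace alpha) != 0 by rewrite vpick0.
have Xa := memv_pick (rootspace alpha).
have [Y0 [Y1 [h0 h1 E]]] := gr_split (vpick (rootspace alpha)).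
rewrite E in X0 Xa; have [z0 z1] := rootspace_parts h0 h1 Xa.
suff [Z [Za Z0]] : exists Z, Z \in rootspace (- alpha) /\ Z != 0.
  by apply: contraNneq Z0 => e; rewrite e memv0 in Za.
have nz1 Z W : form W Z = 1 -> Z != 0.
  by apply: contra_eq_neq => ->; rewrite (bil0r fb) eq_sym oner_eq0.
have [e0|n0] := eqVneq Y0 0; last first.
  by have [Z [_ Za /nz1 Z0]] := rootspace_partner h0 z0 n0; exists Z.
rewrite e0 add0r in X0.
by have [Z [_ Za /nz1 Z0]] := rootspace_partner h1 z1 X0; exists Z.
Qed.

Lemma positive_add alpha beta : Dp alpha -> Dp beta -> alpha + beta != 0.
Proof.
have [H0 [H0n ->]] := Dp_pos; move=> [_ a0] [_ b0].
apply/eqP => /(congr1 (fun a : hdual h => complex.Re (a H0))).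
rewrite zero_lfunE add_lfunE raddfD /= => /eqP.
by rewrite gt_eqF ?addr_gt0.
Qed.

Lemma positive_add3 alpha beta gamma : Dp alpha -> Dp beta -> Dp gamma ->
  alpha + beta + gamma != 0.
Proof.
have [H0 [H0n ->]] := Dp_pos; move=> [_ a0] [_ b0] [_ c0].
apply/eqP => /(congr1 (fun a : hdual h => complex.Re (a H0))).
rewrite zero_lfunE !add_lfunE !raddfD /= => /eqP.
by rewrite gt_eqF ?addr_gt0.
Qed.

Lemma positive_root alpha : Dp alpha -> Defs.roots alpha.
Proof. by have [H0 [H0n ->]] := Dp_pos; case. Qed.

Lemma positive_neq0 alpha : Dp alpha -> alpha != 0.
Proof. by move/positive_root; case. Qed.

Lemma roots_of_sub z alpha : roots_of z alpha -> Defs.roots alpha.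
Proof.
move=> [nz hn]; split=> //; apply: contraNneq hn => ->.
by rewrite capv0.
Qed.

Lemma posroots_enum z : exists2 r : seq (hdual h), uniq r &
  forall alpha, alpha \in r <-> posroots Dp z alpha.
Proof.
have [r ur rP] := root_enum.
exists [seq a <- r | `[< posroots Dp z a >]]; first exact: filter_uniq.
move=> a; rewrite mem_filter; split=> [/andP[/asboolP]//|h1].
by apply/andP; split; [apply/asboolP|apply/rP; case: h1 => _ /roots_of_sub].
Qed.

Definition pos_seq z : seq (hdual h) := s2val (cid2 (posroots_enum z)).

Lemma pos_seq_uniq z : uniq (pos_seq z).
Proof. exact: (s2valP (cid2 (posroots_enum z))). Qed.

Lemma pos_seqP z alpha : alpha \in pos_seq z <-> posroots Dp z alpha.
Proof. exact: (s2valP' (cid2 (posroots_enum z))). Qed.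

Lemma root_vectors_exist : exists ef : hdual h -> g * g, forall z alpha,
  alpha \in pos_seq z ->
  [/\ (ef alpha).1 \in gr g z, (ef alpha).1 \in rootspace alpha,
      (ef alpha).2 \in gr g z, (ef alpha).2 \in rootspace (- alpha) &
      form (ef alpha).1 (ef alpha).2 = 1].
Proof.
have key a : exists ef : g * g, forall z, a \in pos_seq z ->
  [/\ ef.1 \in gr g z, ef.1 \in rootspace a,
      ef.2 \in gr g z, ef.2 \in rootspace (- a) & form ef.1 ef.2 = 1].
  have [[z az]|hn] := pselect (exists z, a \in pos_seq z); last first.
    by exists 0 => z az; case: hn; exists z.
  have [Da [a0 hz]] := (pos_seqP z a).1 az.
  have e0 : vpick (gr g z :&: rootspace a) != 0 by rewrite vpick0.
  have := memv_pick (gr g z :&: rootspace a); rewrite memv_cap => /andP[ez ea].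
  have [f [fz fa ef]] := rootspace_partner ez ea e0.
  exists (vpick (gr g z :&: rootspace a), f) => z' az' /=.
  have [_ [_ hz']] := (pos_seqP z' a).1 az'.
  (* A single choice serves both parities: the root space is a line, so it cannot contain nonzero
     vectors of each parity. *)
  suff -> : z' = z by exact: And5 ez ea fz fa ef.
  have e0' : vpick (gr g z' :&: rootspace a) != 0 by rewrite vpick0.
  have := memv_pick (gr g z' :&: rootspace a); rewrite memv_cap => /andP[ez' ea'].
  have := rootspace_homogeneous a0 ez' ea' e0' ea.
  apply: contraTeq => zz; apply/negP => ez2; move/negP: e0; apply.
  by apply/eqP/(@gr_disjoint _ _ z) => //; move: zz ez2; case: (z); case: (z').
have [ef efP] := boolp.choice key.
by exists ef => z a; exact: efP.
Qed.

Definition root_e alpha : g := (sval (cid root_vectors_exist) alpha).1.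
Definition root_f alpha : g := (sval (cid root_vectors_exist) alpha).2.

Lemma root_efP z alpha : alpha \in pos_seq z ->
  [/\ root_e alpha \in gr g z, root_e alpha \in rootspace alpha,
      root_f alpha \in gr g z, root_f alpha \in rootspace (- alpha) &
      form (root_e alpha) (root_f alpha) = 1].
Proof. exact: (svalP (cid root_vectors_exist)). Qed.

Lemma root_e_neq0 z alpha : alpha \in pos_seq z -> root_e alpha != 0.
Proof.
case/root_efP=> _ _ _ _; apply: contra_eq_neq => ->.
by rewrite (bil0l fb) eq_sym oner_eq0.
Qed.

Lemma root_f_neq0 z alpha : alpha \in pos_seq z -> root_f alpha != 0.
Proof.
case/root_efP=> _ _ _ _; apply: contra_eq_neq => ->.
by rewrite (bil0r fb) eq_sym oner_eq0.
Qed.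

Definition root_pairs z := [seq (root_e a, root_f a) | a <- pos_seq z].
(** The parity z parts of n^+ and n^-, spanned by the chosen root vectors; [nplus_oddE] and
    [nminus_oddE] identify the odd ones with sums of root spaces. *)
Definition nilp z : {vspace g} := <<map root_e (pos_seq z)>>%VS.
Definition niln z : {vspace g} := <<map root_f (pos_seq z)>>%VS.

Lemma root_pairs_dual z : dual_pair form (nilp z) (niln z) (root_pairs z).
Proof.
apply: dual_pair_span => // [|a b az bz]; first exact: pos_seq_uniq.
have [_ ea _ _ ef] := root_efP az; have [_ _ _ fb' _] := root_efP bz.
have [<-|ab] := eqVneq a b; first exact: ef.
by apply: (rootspace_form ea fb'); rewrite subr_eq0.
Qed.

Lemma nilp_ind z (P : g -> Prop) : P 0 ->
  (forall a X Y, P X -> P Y -> P (a *: X + Y)) ->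
  (forall alpha X, posroots Dp z alpha -> X \in gr g z ->
     X \in rootspace alpha -> P X) ->
  {in nilp z, forall X, P X}.
Proof.
move=> P0 PD PX; apply: span_ind => // _ /mapP[a az ->].
by have [ez ea _ _ _] := root_efP az; apply: PX ea => //; apply/pos_seqP.
Qed.

Lemma niln_ind z (P : g -> Prop) : P 0 ->
  (forall a X Y, P X -> P Y -> P (a *: X + Y)) ->
  (forall alpha X, posroots Dp z alpha -> X \in gr g z ->
     X \in rootspace (- alpha) -> P X) ->
  {in niln z, forall X, P X}.
Proof.
move=> P0 PD PX; apply: span_ind => // _ /mapP[a az ->].
by have [_ _ fz fa _] := root_efP az; apply: PX fa => //; apply/pos_seqP.
Qed.

(** Triangular decomposition of one parity. The component of weight zero lies in h, hence is zero in
    odd parity; each other component is a multiple of the chosen vector, since root spaces are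
    lines. *)
Lemma gr_decomp z X : X \in gr g z ->
  exists H a b, [/\ H \in (if z then 0%VS else h), a \in nilp z, b \in niln z
    & X = H + a + b].
Proof.
move=> Xz; have [r [Y [ur XY] hY]] := homogeneous_weight_family Xz.
rewrite XY; elim/big_rec: _ => [|a X' _ [H [u [v [hH hu hv ->]]]]].
  by exists 0, 0, 0; rewrite !mem0v !addr0.
have [ya yz] := hY a.
suff [H' [u' [v' [hH' hu' hv' ->]]]] : exists H a' b,
    [/\ H \in (if z then 0%VS else h), a' \in nilp z, b \in niln z & Y a = H + a' + b].
  exists (H' + H), (u' + u), (v' + v); rewrite !rpredD //; split=> //.
  by rewrite addrACA [X in X + _]addrACA.
have [Y0|Y0] := eqVneq (Y a) 0.
  by rewrite Y0; exists 0, 0, 0; rewrite !mem0v !addr0.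
have [a0|a0] := eqVneq a 0.
  rewrite a0 in ya yz *; have yh := rootspace0_cartan ya.
  exists (Y 0), 0, 0; rewrite !mem0v !addr0; split=> //.
  case: (z) yz => // y1; rewrite memv0; apply/eqP.
  by apply: (@gr_disjoint _ _ true) => //; apply: cartan_even.
have ra : roots_of z a.
  split=> //; apply/eqP => e; have : Y a \in (gr g z :&: rootspace a)%VS.
    by rewrite memv_cap yz ya.
  by rewrite e memv0 (negPf Y0).
have [Da|Da] := positive_opp (roots_of_sub ra).
  have az : a \in pos_seq z by apply/pos_seqP.
  have [ez ea _ _ _] := root_efP az.
  exists 0, (Y a), 0; rewrite !mem0v add0r addr0; split=> //.
  have [c ->] := root_line a0 ea ya (root_e_neq0 az).
  by rewrite rpredZ // memv_span // map_f.
have az : - a \in pos_seq z.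
  have na0 : - a != 0 by rewrite oppr_eq0.
  apply/pos_seqP; split; first exact: Da.
  split; first exact: na0.
  have [Z [Zz Za yZ]] := rootspace_partner yz ya Y0.
  apply/eqP => e; have : Z \in (gr g z :&: rootspace (- a))%VS.
    by rewrite memv_cap Zz Za.
  by rewrite e memv0 => /eqP Z0; move/eqP: yZ; rewrite Z0 (bil0r fb) eq_sym oner_eq0.
have [_ _ fz fa _] := root_efP az; rewrite opprK in fa.
exists 0, 0, (Y a); rewrite !mem0v !add0r; split=> //.
have [c ->] := root_line a0 fa ya (root_f_neq0 az).
by rewrite rpredZ // memv_span // map_f.
Qed.

Lemma nilp_gr z : {subset nilp z <= gr g z}.
Proof.
by apply: nilp_ind => [|a X Y hX hY|//]; rewrite ?mem0v // rpredD // rpredZ.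
Qed.

Lemma niln_gr z : {subset niln z <= gr g z}.
Proof.
by apply: niln_ind => [|a X Y hX hY|//]; rewrite ?mem0v // rpredD // rpredZ.
Qed.

Lemma nilp_stable z H : H \in h -> {in nilp z, forall X, br H X \in nilp z}.
Proof.
move=> Hh; apply: span_ind => [|a X Y hX hY|_ /mapP[a az ->]].
- by rewrite (bil0r bb) mem0v.
- by rewrite (bilDr bb) (bilZr bb) rpredD // rpredZ.
have [_ ea _ _ _] := root_efP az.
by rewrite (rootspace_ad ea Hh) rpredZ // memv_span // map_f.
Qed.

Lemma form_nilp_nilp z z' : {in nilp z & nilp z', forall X Y, form X Y = 0}.
Proof.
move=> X Y Xn; move: X Xn Y; apply: nilp_ind => [Y _|c X Y hX hY Z Zn|a X [Da _] _ Xa].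
- exact: (bil0l fb).
- by rewrite (bilDl fb) (bilZl fb) hX // hY // addr0; apply: mulr0.
apply: nilp_ind => [|c Y Z hY hZ|b Y [Db _] _ Yb].
- exact: (bil0r fb).
- by rewrite (bilDr fb) (bilZr fb) hY hZ addr0; apply: mulr0.
- exact: (rootspace_form Xa Yb (positive_add Da Db)).
Qed.

Lemma form_niln_niln z z' : {in niln z & niln z', forall X Y, form X Y = 0}.
Proof.
move=> X Y Xn; move: X Xn Y; apply: niln_ind => [Y _|c X Y hX hY Z Zn|a X [Da _] _ Xa].
- exact: (bil0l fb).
- by rewrite (bilDl fb) (bilZl fb) hX // hY // addr0; apply: mulr0.
apply: niln_ind => [|c Y Z hY hZ|b Y [Db _] _ Yb].
- exact: (bil0r fb).
- by rewrite (bilDr fb) (bilZr fb) hY hZ addr0; apply: mulr0.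
apply: (rootspace_form Xa Yb).
by rewrite -opprD oppr_eq0 (positive_add Da Db).
Qed.

Lemma form_cartan_nilp z H : H \in h -> {in nilp z, forall X, form H X = 0}.
Proof.
move=> Hh; apply: nilp_ind => [|c X Y hX hY|a X [Da _] _ Xa].
- exact: (bil0r fb).
- by rewrite (bilDr fb) (bilZr fb) hX hY addr0; apply: mulr0.
by apply: (rootspace_form (cartan_rootspace0 Hh) Xa); rewrite add0r positive_neq0.
Qed.

Lemma form_cartan_niln z H : H \in h -> {in niln z, forall X, form H X = 0}.
Proof.
move=> Hh; apply: niln_ind => [|c X Y hX hY|a X [Da _] _ Xa].
- exact: (bil0r fb).
- by rewrite (bilDr fb) (bilZr fb) hX hY addr0; apply: mulr0.
apply: (rootspace_form (cartan_rootspace0 Hh) Xa).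
by rewrite add0r oppr_eq0 positive_neq0.
Qed.

(** An element of h is orthogonal to all root vectors anyway, so orthogonality to h puts it in the
    radical of the form. *)
Lemma cartan_nondegenerate H : H \in h -> {in h, forall H', form H H' = 0} -> H = 0.
Proof.
move=> Hh HH; apply: form_nd => X.
have Hn : {in niln false, forall Y, form H Y = 0} by apply: form_cartan_niln.
elim/gr_ind: X => [X Y h1 h2|[] X hX].
- by rewrite (bilDr fb) h1 h2 addr0.
- exact: (form_parity (cartan_even Hh) hX).
have [H' [a [b [hH' ha hb ->]]]] := gr_decomp hX.
rewrite !(bilDr fb) (HH _ hH') (form_cartan_nilp Hh ha) (form_cartan_niln Hh hb).
by rewrite !addr0.
Qed.

(** The dual basis is read off from the inverse of the Gram matrix of a basis of h; a row in the
    kernel of that matrix would be an element of h orthogonal to h. *)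
Lemma cartan_dual_pair : exists hs, dual_pair form h h hs.
Proof.
pose n := \dim h; pose b (i : 'I_n) := (vbasis h)`_i.
pose G := \matrix_(i < n, j < n) form (b i) (b j).
have bh (i : 'I_n) : b i \in h by apply/vbasis_mem/mem_nth; rewrite size_tuple.
have Gu : G \in unitmx.
  rewrite -row_free_unit -kermx_eq0; apply/rowV0P => u /sub_kermxP uG.
  have : \sum_i u 0 i *: b i = 0.
    apply: cartan_nondegenerate; first by rewrite rpred_sum // => i _; rewrite rpredZ.
    move=> H' /coord_vbasis ->; rewrite (bil_sumr fb) big1 // => j _.
    rewrite (bilZr fb) (bil_suml fb).
    have /rowP/(_ j) := uG; rewrite !mxE => /eqP E.
    rewrite (eq_bigr (fun i => u 0 i * G i j)) => [|i _].
      by move/eqP: E => ->; apply: mulr0.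
    by rewrite (bilZl fb) mxE.
  have /freeP hf := basis_free (vbasisP h); move=> /(hf (fun i => u 0 i)) u0.
  by apply/rowP => i; rewrite u0 mxE.
pose f i := \sum_k invmx G k i *: b k.
have bf i j : form (b i) (f j) = (i == j)%:R.
  rewrite (bil_sumr fb).
  have /matrixP/(_ i j) := mulmxV Gu; rewrite !mxE => <-.
  by apply: eq_bigr => k _; rewrite (bilZr fb) mxE mulrC.
have bspan : <<[seq b i | i : 'I_n]>>%VS = h.
  rewrite -[RHS](span_basis (vbasisP h)); congr (<<_>>%VS).
  apply: (@eq_from_nth _ 0); first by rewrite size_map size_enum_ord size_tuple.
  move=> i; rewrite size_map size_enum_ord => ni.
  by rewrite (nth_map (Ordinal ni)) ?size_enum_ord // /b nth_enum_ord.
have fspan : <<[seq f i | i : 'I_n]>>%VS = h.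
  apply/eqP; rewrite eqEsubv; apply/andP; split.
    apply/span_subvP => _ /mapP[i _ ->]; rewrite rpred_sum // => k _.
    by rewrite rpredZ.
  rewrite -{1}bspan; apply/span_subvP => _ /mapP[i _ ->].
  suff -> : b i = \sum_j G j i *: f j.
    by rewrite rpred_sum // => j _; rewrite rpredZ // memv_span // map_f // mem_enum.
  rewrite /f; under eq_bigr do rewrite scaler_sumr.
  rewrite exchange_big /= (bigD1 i) //= [X in _ + X]big1 ?addr0 => [|k ki];
    under eq_bigr do rewrite scalerA;
    rewrite -scaler_suml.
    have /matrixP/(_ i i) := mulVmx Gu; rewrite !mxE eqxx.
    by under eq_bigr do rewrite mulrC; move=> ->; rewrite scale1r.
  have /matrixP/(_ k i) := mulVmx Gu; rewrite !mxE (negPf ki).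
  by under eq_bigr do rewrite mulrC; move=> ->; rewrite scale0r.
exists [seq (b i, f i) | i <- enum 'I_n].
rewrite -{1}bspan -fspan; apply: dual_pair_span => //; first exact: enum_uniq.
Qed.

(** Along the triangular decomposition the pairs (e, f) also occur as (f, e); exchanging the
    arguments of the form costs the sign (-1)^z. *)
Lemma gr_dual_pair z hs ps :
  dual_pair form (if z then 0%VS else h) (if z then 0%VS else h) hs ->
  dual_pair form (nilp z) (niln z) ps ->
  dual_pair form (gr g z) (gr g z)
    (hs ++ ps ++ [seq (p.2, (-1) ^+ z *: p.1) | p <- ps]).
Proof.
move=> [hsS hsL hsR] [psS psL psR].
have ch : {subset (if z then 0%VS else h) <= h}.
  by case: (z) => // H; rewrite memv0 => /eqP->; rewrite mem0v.
have cg : {subset (if z then 0%VS else h) <= gr g z}.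
  by case: (z) => H; [rewrite memv0 => /eqP->; rewrite mem0v|apply: cartan_even].
have ps' q : q \in ps -> q.1 \in nilp z /\ q.2 \in niln z by apply: psS.
have hs' q : q \in hs -> [/\ q.1 \in h, q.2 \in h, q.1 \in gr g false & q.2 \in gr g false].
  by case/hsS => /ch ? /ch ?; split=> //; apply: cartan_even.
split=> [p|X|Y].
- rewrite !mem_cat => /or3P[/hsS[/cg ? /cg ?]//|/psS[/nilp_gr ? /niln_gr ?]//|].
  by case/mapP=> q /psS[/nilp_gr ? /niln_gr ?] -> /=; rewrite rpredZ.
- case/gr_decomp=> H [a [b [hH ha hb E]]].
  rewrite !big_cat big_map /= {1}E -addrA {1}(hsL _ hH) {1}(psL _ ha) {1}(psR _ hb).
  congr (_ + (_ + _)); rewrite !big_seq; apply: eq_bigr => p pp; congr (_ *: _); rewrite E !(bilDl fb).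
  + have [_ p2 _ p2e] := hs' _ pp.
    rewrite -(form_h_sym a p2e) -(form_h_sym b p2e).
    by rewrite (form_cartan_nilp p2 ha) (form_cartan_niln p2 hb) !addr0.
  + have [_ p2] := ps' _ pp.
    by rewrite (form_cartan_niln (ch _ hH) p2) (form_niln_niln hb p2) add0r addr0.
  + have [p1 _] := ps' _ pp.
    rewrite !(bilZr fb) (form_cartan_nilp (ch _ hH) p1) (form_nilp_nilp ha p1).
    by rewrite !scaler0 !add0r; apply: (form_skew (nilp_gr p1) (niln_gr hb)).
- case/gr_decomp=> H [a [b [hH ha hb E]]].
  rewrite !big_cat big_map /= {1}E [LHS]addrAC -addrA {1}(hsR _ hH) {1}(psR _ hb) {1}(psL _ ha).
  congr (_ + (_ + _)); rewrite !big_seq; apply: eq_bigr => p pp; rewrite ?scalerA;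
    congr (_ *: _); rewrite E !(bilDr fb).
  + have [p1 _ _ _] := hs' _ pp.
    by rewrite (form_cartan_nilp p1 ha) (form_cartan_niln p1 hb) !addr0.
  + have [p1 _] := ps' _ pp.
    rewrite -(form_h_sym p.1 (cartan_even (ch _ hH))).
    by rewrite (form_cartan_nilp (ch _ hH) p1) (form_nilp_nilp p1 ha) !add0r.
  + have [_ p2] := ps' _ pp.
    rewrite -(form_h_sym p.2 (cartan_even (ch _ hH))).
    rewrite (form_cartan_niln (ch _ hH) p2) (form_niln_niln p2 hb) add0r addr0.
    by rewrite (form_skew (nilp_gr ha) (niln_gr p2)) mulrC.
Qed.

Lemma root_pairs_trace z H : H \in h ->
  form H (\sum_(p <- root_pairs z) br p.1 p.2)
    = (\sum_(a <- pos_seq z) a) (vsproj h H).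
Proof.
move=> Hh; rewrite (bil_sumr fb) big_map sum_lfunE !big_seq.
apply: eq_bigr => a az; have [_ ea _ _ ef] := root_efP az.
by rewrite -formA (rootspace_ad ea Hh) (bilZl fb) ef; apply: mulr1.
Qed.

(** The sum depends only on the two spaces, so root vectors may be used, for which each bracket has
    weight zero. *)
Lemma dual_pair_bracket_cartan z ps :
  dual_pair form (nilp z) (niln z) ps -> \sum_(p <- ps) br p.1 p.2 \in h.
Proof.
move=> hps; rewrite (dual_pair_indep bb hps (root_pairs_dual z)).
rewrite big_map big_seq rpred_sum // => a az; have [_ ea _ fa _] := root_efP az.
have := rootspace_bracket ea fa; rewrite subrr; exact: rootspace0_cartan.
Qed.

Lemma hsharpP (lambda : hdual h) (H : subvs_of h) :
  form (vsval (hsharp form lambda)) (vsval H) = lambda H.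
Proof.
have [hs [hsS hsL hsR]] := cartan_dual_pair.
rewrite /hsharp; case: xgetP => [t _ ->//|hN].
(* [xget] falls back to 0 only if no representing element exists; the dual family of h provides one,
   sum lambda(f_k) e_k. *)
exfalso; apply: (hN (vsproj h (\sum_(p <- hs) lambda (vsproj h p.2) *: p.1))) => H'.
rewrite vsprojK; last first.
  by rewrite big_seq rpred_sum // => p /hsS[? _]; rewrite rpredZ.
have E := hsR _ (subvsP H').
transitivity (lambda (vsproj h (vsval H'))); last by rewrite vsvalK.
rewrite {2}E linear_sum linear_sum (bil_suml fb); apply: eq_bigr => p _.
by rewrite (bilZl fb) !linearZ /=; apply: mulrC.
Qed.

Lemma hsharp_unique (lambda : hdual h) T : T \in h ->
  {in h, forall H, form T H = lambda (vsproj h H)} ->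
  vsval (hsharp form lambda) = T.
Proof.
move=> Th hT; apply/eqP; rewrite -subr_eq0; apply/eqP/cartan_nondegenerate.
  by rewrite rpredB ?subvsP.
move=> H Hh; rewrite (bilBl fb) hT // -{1}(vsprojK Hh) hsharpP.
by rewrite subrr.
Qed.

Lemma hformE (lambda nu : hdual h) : hform form lambda nu = nu (hsharp form lambda).
Proof. by rewrite /hform form_h_sym ?cartan_even ?subvsP // hsharpP. Qed.

Lemma hsharp_linear a (lambda nu : hdual h) :
  hsharp form (a *: lambda + nu) = a *: hsharp form lambda + hsharp form nu.
Proof.
apply: val_inj; apply: hsharp_unique; first exact: subvsP.
move=> H Hh; have hH l : form (vsval (hsharp form l)) H = l (vsproj h H).
  by rewrite -hsharpP vsprojK.
rewrite linearP /= (bilDl fb) (bilZl fb) !hH.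
by rewrite add_lfunE scale_lfunE.
Qed.

Lemma hformDl (lambda lambda' nu : hdual h) :
  hform form (lambda + lambda') nu = hform form lambda nu + hform form lambda' nu.
Proof. by rewrite !hformE -[lambda]scale1r hsharp_linear !scale1r linearD. Qed.

Lemma hsharp0 : hsharp form (0 : hdual h) = 0.
Proof.
apply: val_inj; apply: hsharp_unique; first by rewrite linear0 mem0v.
by move=> H Hh; rewrite zero_lfunE linear0 (bil0l fb).
Qed.

Lemma hformZl a (lambda nu : hdual h) : hform form (a *: lambda) nu = a * hform form lambda nu.
Proof.
by rewrite !hformE -[a *: lambda]addr0 hsharp_linear hsharp0 addr0 linearZ.
Qed.

Lemma hformC (lambda nu : hdual h) : hform form lambda nu = hform form nu lambda.
Proof. by rewrite /hform form_h_sym // cartan_even ?subvsP. Qed.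

Lemma rho_ofE z : rho_of Dp z = 2%:R^-1 *: \sum_(a <- pos_seq z) a.
Proof.
rewrite /rho_of; congr (_ *: _).
have -> : posroots Dp z = [set` pos_seq z]%classic.
  by apply/seteqP; split=> a /pos_seqP.
by rewrite -fsbig_seq ?pos_seq_uniq.
Qed.

(* t_z = sum_k [p_k, q_k] is the element of h dual to 2 rho_z. *)
Lemma dual_pair_trace z ps H : dual_pair form (nilp z) (niln z) ps -> H \in h ->
  form H (\sum_(p <- ps) br p.1 p.2) = (2%:R *: rho_of Dp z) (vsproj h H).
Proof.
move=> hps Hh; rewrite (dual_pair_indep bb hps (root_pairs_dual z)).
rewrite root_pairs_trace // rho_ofE scalerA mulfV ?scale1r //.
by rewrite pnatr_eq0.
Qed.

Lemma dual_pair_sharp z ps : dual_pair form (nilp z) (niln z) ps ->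
  \sum_(p <- ps) br p.1 p.2 = vsval (hsharp form (2%:R *: rho_of Dp z)).
Proof.
move=> hps; apply/esym/hsharp_unique; first exact: dual_pair_bracket_cartan hps.
move=> H Hh; rewrite -(dual_pair_trace hps Hh) form_h_sym //.
exact/cartan_even/(dual_pair_bracket_cartan hps).
Qed.

Lemma cartan_pair_sum hs (lambda nu : hdual h) : dual_pair form h h hs ->
  \sum_(p <- hs) lambda (vsproj h p.1) * nu (vsproj h p.2) = hform form lambda nu.
Proof.
move=> [hsS hsL hsR]; rewrite hformE.
transitivity (nu (vsproj h (vsval (hsharp form lambda)))); last by rewrite vsvalK.
rewrite (hsR _ (subvsP _)) linear_sum linear_sum !big_seq.
apply: eq_bigr => p /hsS[p1 p2].
have E : form p.1 (vsval (hsharp form lambda)) = lambda (vsproj h p.1).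
  by rewrite form_h_sym ?cartan_even // -(hsharpP lambda) vsprojK.
by rewrite !linearZ /= E.
Qed.

(** * Casimir operator of g_0 on vectors of highest weight modulo a submodule *)

Section EvenRepresentations.
Variables (W : lmodType R[i]) (act : g -> W -> W).
Hypothesis act_bil : bilinear_fun act.
Hypothesis act_bracket : {in gr g false &, forall X Y w,
  act (br X Y) w = act X (act Y w) - act Y (act X w)}.

Definition casimir (ps : seq (g * g)) (w : W) : W :=
  \sum_(p <- ps) act p.1 (act p.2 w).

Lemma act_act_bil w : bilinear_fun (fun X Y => act X (act Y w)).
Proof.
split=> [Y a X X'|X a Y Y']; first by rewrite (bilDl act_bil) (bilZl act_bil).
by rewrite !(bilDl act_bil, bilZl act_bil) (bilDr act_bil) (bilZr act_bil).
Qed.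

(** Moving X past both factors produces sum [X, e] f + e [X, f], which vanishes by invariance of the
    canonical tensor. *)
Lemma casimir_comm ps X w : dual_pair form (gr g false) (gr g false) ps ->
  X \in gr g false -> act X (casimir ps w) = casimir ps (act X w).
Proof.
move=> hps X0; have [psS _ _] := hps.
have st : {in gr g false, forall Y, br X Y \in gr g false}.
  by move=> Y Y0; rewrite -[false]/(addb false false) bracket_gr.
have := dual_pair_inv form_inv (act_act_bil w) hps X0 st st.
move/eqP; rewrite -addr_eq0 -big_split /= => /eqP E.
apply/eqP; rewrite -subr_eq0 -[X in _ == X]E; apply/eqP.
rewrite /casimir (bil_sumr act_bil) -sumrB !big_seq; apply: eq_bigr => p /psS[p1 p2].
rewrite (act_bracket X0 p1) (act_bracket X0 p2) (bilBr act_bil).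
by rewrite addrA subrK.
Qed.

Variables (V : set W) (mu : hdual h) (u : W).
Hypothesis V_sub : is_subspace V.
Hypothesis V_stable : forall X w, X \in gr g false -> V w -> V (act X w).
Hypothesis u_pos : forall alpha X, posroots Dp false alpha ->
  X \in (gr g false :&: rootspace alpha)%VS -> V (act X u).
Hypothesis u_wt : forall H : subvs_of h, V (act (vsval H) u - mu H *: u).

Lemma subspaceD v w : V v -> V w -> V (v + w).
Proof. by move=> hv hw; rewrite -[v]scale1r; apply: V_sub.2. Qed.

Lemma subspaceZ a v : V v -> V (a *: v).
Proof. by move=> hv; rewrite -[_ *: _]addr0; apply: V_sub.2 => //; apply: V_sub.1. Qed.

Lemma subspace_sum (I : eqType) (r : seq I) (F : I -> W) :
  {in r, forall i, V (F i)} -> V (\sum_(i <- r) F i).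
Proof.
move=> hF; rewrite big_seq; elim/big_rec: _ => [|i w ir hw]; first exact: V_sub.1.
by apply: subspaceD => //; apply: hF.
Qed.

Lemma weight_cartan H : H \in h -> V (act H u - mu (vsproj h H) *: u).
Proof. by move=> Hh; have := u_wt (vsproj h H); rewrite vsprojK. Qed.

(** The Cartan pairs give (mu, mu). For root vectors e f = f e + [e, f]; the term f e u lies in V,
    and sum [e, f] is dual to 2 rho_0. Working modulo V covers both genuine highest weight vectors,
    V = 0, and composition factors. *)
Lemma highest_weight_casimir ps : dual_pair form (gr g false) (gr g false) ps ->
  V (casimir ps u - hform form (mu + 2%:R *: rho_of Dp false) mu *: u).
Proof.
move=> hps; have [hs hhs] := cartan_dual_pair; have rp := root_pairs_dual false.
have := dual_pair_indep (act_act_bil u) hps (gr_dual_pair (z := false) hhs rp).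
rewrite /casimir => ->; rewrite !big_cat /=.
rewrite [X in _ + (_ + X)]big_map /= expr0.
have [hsS _ _] := hhs.
rewrite hformDl scalerDl opprD addrACA; apply: subspaceD.
  rewrite -(cartan_pair_sum mu mu hhs) scaler_suml -sumrB.
  apply: subspace_sum => p /hsS[p1 p2].
  have -> : act p.1 (act p.2 u)
      - (mu (vsproj h p.1) * mu (vsproj h p.2)) *: u
    = act p.1 (act p.2 u - mu (vsproj h p.2) *: u)
      + mu (vsproj h p.2) *: (act p.1 u - mu (vsproj h p.1) *: u).
    rewrite (bilBr act_bil) (bilZr act_bil) scalerBr scalerA addrA subrK.
    by rewrite [in RHS]mulrC.
  apply: subspaceD; last by apply/subspaceZ/weight_cartan.
  by apply: V_stable; [apply: cartan_even|apply: weight_cartan].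
have [rpS _ _] := rp.
have tE := dual_pair_sharp rp.
rewrite hformE -big_split /=.
have -> : \sum_(p <- root_pairs false) (act p.1 (act p.2 u) + act p.2 (act (1 *: p.1) u))
   = act (\sum_(p <- root_pairs false) br p.1 p.2) u
     + \sum_(p <- root_pairs false) 2%:R *: act p.2 (act p.1 u).
  rewrite (bil_suml act_bil) -big_split /= !big_seq; apply: eq_bigr => p /rpS[p1 p2].
  rewrite (act_bracket (nilp_gr p1) (niln_gr p2)) scale1r scaler_nat mulr2n.
  by rewrite addrA subrK.
rewrite tE addrAC; apply: subspaceD; first exact: u_wt.
apply: subspace_sum => _ /mapP[a az ->] /=; apply: subspaceZ.
have [e0 ea f0 _ _] := root_efP az.
apply: V_stable => //; apply: (u_pos (alpha := a)); first exact/pos_seqP.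
by rewrite memv_cap e0 ea.
Qed.

End EvenRepresentations.

(** * Oscillator representation of g_0 from canonical commutation relations on g_1 *)

Section Oscillator.
Variables (P : lmodType R[i]) (w : g -> P -> P).
Hypothesis w_bil : bilinear_fun w.
Hypothesis w_comm : {in gr g true &, forall Y Z p,
  w Y (w Z p) = w Z (w Y p) + form Y Z *: p}.
Variable ps : seq (g * g).
Hypothesis ps_dual : dual_pair form (gr g true) (gr g true) ps.

(** The quadratic element of the Weyl algebra attached to X, symmetric in the two odd factors
    instead of normally ordered; [osc_oscw] compares it with [osc]. *)
Definition oscw (X : g) (p : P) : P :=
  2%:R^-1 *: \sum_(a <- ps) \sum_(b <- ps) form X (br a.1 b.1) *: w a.2 (w b.2 p).

Let psO p : p \in ps -> p.1 \in gr g true /\ p.2 \in gr g true.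
Proof. by case: ps_dual => h0 _ _ /h0. Qed.

Lemma odd_bracket_even : {in gr g true &, forall Y Z, br Y Z \in gr g false}.
Proof. by move=> Y Z hY hZ; rewrite -[false]/(addb true true) bracket_gr. Qed.

Lemma even_bracket_odd : {in gr g false & gr g true, forall Y Z, br Y Z \in gr g true}.
Proof. by move=> Y Z hY hZ; rewrite -[true]/(addb false true) bracket_gr. Qed.

Lemma odd_bracketC : {in gr g true &, forall Y Z, br Y Z = br Z Y}.
Proof. by move=> Y Z hY hZ; rewrite (bracket_skew hY hZ) /= expr1 scaleN1r opprK. Qed.

Lemma odd_form_anti : {in gr g true &, forall Y Z, form Y Z = - form Z Y}.
Proof. by move=> Y Z hY hZ; rewrite (form_skew hY hZ) expr1 mulN1r. Qed.

Lemma formDr X Y Z : form X (Y + Z) = form X Y + form X Z.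
Proof. exact: (bilDr fb). Qed.
Lemma formDl X Y Z : form (X + Y) Z = form X Z + form Y Z.
Proof. exact: (bilDl fb). Qed.
Lemma formNr X Y : form X (- Y) = - form X Y.
Proof. exact: (bilNr fb). Qed.
Lemma formNl X Y : form (- X) Y = - form X Y.
Proof. exact: (bilNl fb). Qed.
Lemma formZr a X Y : form X (a *: Y) = a * form X Y.
Proof. exact: (bilZr fb). Qed.
Lemma formZl a X Y : form (a *: X) Y = a * form X Y.
Proof. exact: (bilZl fb). Qed.

Lemma oscw_linear X : linear (oscw X).
Proof.
move=> c p q; rewrite /oscw scalerA mulrC -scalerA -scalerDr; congr (_ *: _).
rewrite scaler_sumr -big_split; apply: eq_bigr => a _ /=.
rewrite scaler_sumr -big_split; apply: eq_bigr => b _ /=.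
by rewrite !(bilDr w_bil, bilZr w_bil) scalerDr !scalerA mulrC.
Qed.

Lemma oscwD X p q : oscw X (p + q) = oscw X p + oscw X q.
Proof. by have := oscw_linear X 1 p q; rewrite !scale1r. Qed.

Lemma oscw0 X : oscw X 0 = 0.
Proof. by apply: (addrI (oscw X 0)); rewrite -oscwD !addr0. Qed.

Lemma oscwZ X c p : oscw X (c *: p) = c *: oscw X p.
Proof. by have := oscw_linear X c p 0; rewrite oscw0 !addr0. Qed.

Lemma oscw_bil : bilinear_fun oscw.
Proof.
split=> [p a X Y|X]; last exact: oscw_linear.
rewrite /oscw scalerA mulrC -scalerA -scalerDr; congr (_ *: _).
rewrite scaler_sumr -big_split; apply: eq_bigr => c _ /=.
rewrite scaler_sumr -big_split; apply: eq_bigr => b _ /=.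
by rewrite formDl formZl scalerDl scalerA.
Qed.

Let sum2D (V : zmodType) (F G : g * g -> g * g -> V) :
  \sum_(a <- ps) \sum_(b <- ps) (F a b + G a b)
    = \sum_(a <- ps) \sum_(b <- ps) F a b + \sum_(a <- ps) \sum_(b <- ps) G a b.
Proof. by rewrite -big_split; apply: eq_bigr => a _; rewrite -big_split. Qed.

(** Commuting [w Y] past the two factors leaves two sums, equal by symmetry of the odd bracket,
    which cancel the factor 1/2; what remains is the expansion of [X, Y] in the dual family. *)
Lemma oscw_w X Y p : X \in gr g false -> Y \in gr g true ->
  oscw X (w Y p) = w Y (oscw X p) + w (br X Y) p.
Proof.
move=> X0 Y1; have [_ psL psR] := ps_dual.
rewrite /oscw (bilZr w_bil) (bil_sumr w_bil).
under [in RHS]eq_bigr do rewrite (bil_sumr w_bil).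
transitivity (2%:R^-1 *: (\sum_(a <- ps) \sum_(b <- ps)
   (w Y (form X (br a.1 b.1) *: w a.2 (w b.2 p))
    + (form X (br a.1 b.1) * form b.2 Y *: w a.2 p
       + form X (br a.1 b.1) * form a.2 Y *: w b.2 p)))).
  congr (_ *: _); rewrite !big_seq; apply: eq_bigr => a /psO[a1 a2].
  rewrite !big_seq; apply: eq_bigr => b /psO[b1 b2].
  rewrite (w_comm b2 Y1) (bilDr w_bil) (w_comm a2 Y1) !(bilZr w_bil) !scalerDr !scalerA.
  by rewrite addrAC -addrA.
rewrite !sum2D scalerDr; congr (_ + _).
set A := \sum_(a <- ps) _; set B := \sum_(a <- ps) _.
have E : A = B.
  rewrite /B exchange_big /=; rewrite /A !big_seq; apply: eq_bigr => a /psO[a1 a2].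
  rewrite !big_seq; apply: eq_bigr => b /psO[b1 b2].
  by rewrite (odd_bracketC a1 b1).
rewrite -E -mulr2n -[A *+ 2]scaler_nat scalerA mulVf ?scale1r ?pnatr_eq0 //.
have XY1 := even_bracket_odd X0 Y1.
rewrite {1}(psR _ XY1) (bil_suml w_bil) /A !big_seq; apply: eq_bigr => a /psO[a1 a2].
rewrite -scaler_suml (bilZl w_bil); congr (_ *: _).
have -> : form a.1 (br X Y) = - form X (br a.1 Y) 
  by rewrite -[form X _]formA (form_ad form_inv _ _ X0) opprK.
rewrite [in RHS](psL _ Y1) (bil_sumr bb) (bil_sumr fb) -sumrN !big_seq.
apply: eq_bigr => b /psO[b1 b2].
by rewrite (bilZr bb) formZr (odd_form_anti b2 Y1) mulrN mulrC.
Qed.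

(** By [oscw_w], [oscw X] acts on the factors of [oscw Z] through ad X. Invariance of the canonical
    tensor moves ad X onto the coefficients, where Jacobi and invariance of the form turn them into
    those of [X, Z]. *)
Lemma oscw_bracket : {in gr g false &, forall X Z p,
  oscw (br X Z) p = oscw X (oscw Z p) - oscw Z (oscw X p)}.
Proof.
move=> X Z X0 Z0 p.
have st : {in gr g true, forall Y, br X Y \in gr g true}.
  by move=> Y Y1; apply: even_bracket_odd.
apply/eqP; rewrite eq_sym subr_eq eq_sym; apply/eqP.
have -> : oscw X (oscw Z p) = 2%:R^-1 *: \sum_(a <- ps) \sum_(b <- ps)
    form Z (br a.1 b.1) *: oscw X (w a.2 (w b.2 p)).
  rewrite {2}/oscw oscwZ (big_morph _ (oscwD X) (oscw0 X)); congr (_ *: _).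
  apply: eq_bigr => a _; rewrite (big_morph _ (oscwD X) (oscw0 X)).
  by apply: eq_bigr => b _; rewrite oscwZ.
transitivity (oscw Z (oscw X p) + 2%:R^-1 *: (\sum_(a <- ps) \sum_(b <- ps)
   (form Z (br a.1 b.1) *: w (br X a.2) (w b.2 p)
    + form Z (br a.1 b.1) *: w a.2 (w (br X b.2) p)))); last first.
  rewrite {1}/oscw -scalerDr; congr (_ *: _); rewrite -big_split !big_seq.
  apply: eq_bigr => a /psO[a1 a2]; rewrite -big_split !big_seq /=.
  apply: eq_bigr => b /psO[b1 b2].
  rewrite (oscw_w _ X0 a2) (oscw_w _ X0 b2) (bilDr w_bil) !scalerDr.
  by rewrite -!addrA; congr (_ + _); rewrite addrC.
rewrite [LHS]addrC; congr (_ + _); rewrite /oscw; congr (_ *: _).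
rewrite sum2D.
have B1 : \sum_(a <- ps) \sum_(b <- ps) form Z (br a.1 b.1) *: w (br X a.2) (w b.2 p)
  = - \sum_(a <- ps) \sum_(b <- ps) form Z (br (br X a.1) b.1) *: w a.2 (w b.2 p).
  rewrite exchange_big [in RHS]exchange_big -sumrN /=; apply: eq_bigr => b _.
  pose B Y Y' := form Z (br Y b.1) *: w Y' (w b.2 p).
  have Bb : bilinear_fun B.
    split=> [Y' c Y Y''|Y c Y' Y'']; rewrite /B.
      by rewrite (bilDl bb) (bilZl bb) formDr formZr scalerDl scalerA.
    by rewrite (bilDl w_bil) (bilZl w_bil) scalerDr !scalerA mulrC.
  by have := dual_pair_inv form_inv Bb ps_dual X0 st st; rewrite /B => ->; rewrite opprK.
have B2 : \sum_(a <- ps) \sum_(b <- ps) form Z (br a.1 b.1) *: w a.2 (w (br X b.2) p)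
  = - \sum_(a <- ps) \sum_(b <- ps) form Z (br a.1 (br X b.1)) *: w a.2 (w b.2 p).
  rewrite -sumrN; apply: eq_bigr => a _.
  pose B Y Y' := form Z (br a.1 Y) *: w a.2 (w Y' p).
  have Bb : bilinear_fun B.
    split=> [Y' c Y Y''|Y c Y' Y'']; rewrite /B.
      by rewrite (bilDr bb) (bilZr bb) formDr formZr scalerDl scalerA.
    rewrite (bilDl w_bil) (bilZl w_bil) (bilDr w_bil) (bilZr w_bil) scalerDr !scalerA.
    by rewrite mulrC.
  by have := dual_pair_inv form_inv Bb ps_dual X0 st st; rewrite /B => ->; rewrite opprK.
rewrite B1 B2 -opprD -big_split -sumrN; apply: eq_bigr => a _ /=.
rewrite -big_split -sumrN; apply: eq_bigr => b _ /=.
rewrite -scalerDl -formDr -jacobi_even // -scaleNr; congr (_ *: _).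
exact: form_ad.
Qed.

(** Sums over four indices; the transpositions of neighbours below generate every relabelling. *)
Let sum4 (V : zmodType) (G : g * g -> g * g -> g * g -> g * g -> V) :=
  \sum_(a <- ps) \sum_(b <- ps) \sum_(c <- ps) \sum_(d <- ps) G a b c d.

Let sum4_12 (V : zmodType) G : @sum4 V G = sum4 (fun a b c d => G b a c d).
Proof. by rewrite /sum4 exchange_big. Qed.

Let sum4_23 (V : zmodType) G : @sum4 V G = sum4 (fun a b c d => G a c b d).
Proof. by rewrite /sum4; apply: eq_bigr => a _; rewrite exchange_big. Qed.

Let sum4_34 (V : zmodType) G : @sum4 V G = sum4 (fun a b c d => G a b d c).
Proof.
by rewrite /sum4; apply: eq_bigr => a _; apply: eq_bigr => b _; rewrite exchange_big.
Qed.

Let eq_sum4 (V : zmodType) G G' : (forall a b c d, a \in ps -> b \in ps ->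
  c \in ps -> d \in ps -> G a b c d = G' a b c d) -> @sum4 V G = sum4 G'.
Proof.
move=> E; rewrite /sum4 !big_seq; apply: eq_bigr => a ha.
rewrite !big_seq; apply: eq_bigr => b hb; rewrite !big_seq; apply: eq_bigr => c hc.
by rewrite !big_seq; apply: eq_bigr => d hd; apply: E.
Qed.

Let sum4D (V : zmodType) G G' :
  @sum4 V (fun a b c d => G a b c d + G' a b c d) = sum4 G + sum4 G'.
Proof.
rewrite /sum4 -big_split; apply: eq_bigr => a _; rewrite -big_split.
by apply: eq_bigr => b _; rewrite -big_split; apply: eq_bigr => c _; rewrite -big_split.
Qed.

(** The coefficient tensor of the quartic part: symmetric inside each pair and under exchange of the
    pairs, with [S4_jacobi] as its cyclic identity of Bianchi type. *)
Let S4 (a b c d : g * g) := form (br a.1 b.1) (br c.1 d.1).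

Let S4_pair a b c d : a \in ps -> b \in ps -> c \in ps -> d \in ps ->
  S4 c d a b = S4 a b c d.
Proof.
move=> /psO[a1 _] /psO[b1 _] /psO[c1 _] /psO[d1 _].
by rewrite /S4 form_h_sym // odd_bracket_even.
Qed.

Let S4_34 a b c d : c \in ps -> d \in ps -> S4 a b d c = S4 a b c d.
Proof. by move=> /psO[c1 _] /psO[d1 _]; rewrite /S4 (odd_bracketC d1 c1). Qed.

Let S4_jacobi a b c d : b \in ps -> c \in ps -> d \in ps ->
  S4 a b c d + S4 a c d b + S4 a d b c = 0.
Proof.
move=> /psO[b1 _] /psO[c1 _] /psO[d1 _].
rewrite /S4 !formA -!formDr (bracket_jacobi d.1 b1 c1) /= expr1 scaleN1r.
rewrite (odd_bracketC d1 b1) subrK.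
have e := odd_bracket_even b1 c1.
rewrite -[br (br _ _) _]opprK -(bracket_even_skew' _ e) addNr.
exact: (bil0r fb).
Qed.

Let sum4N (V : zmodType) G : @sum4 V (fun a b c d => - G a b c d) = - sum4 G.
Proof.
rewrite /sum4 -sumrN; apply: eq_bigr => a _; rewrite -sumrN; apply: eq_bigr => b _.
by rewrite -sumrN; apply: eq_bigr => c _; rewrite -sumrN.
Qed.

Let half (v : P) : v = - v -> v = 0.
Proof.
move=> vN; have : 2%:R *: v = 0 by rewrite scaler_nat mulr2n {1}vN addNr.
by move/eqP; rewrite scaler_eq0 pnatr_eq0 => /eqP.
Qed.

(* The quartic part cancels by the Jacobi identity for three odd elements, the *)
(* remaining quadratic part is antisymmetric, hence a constant.                *)
Lemma oscw_casimir es : dual_pair form (gr g false) (gr g false) es ->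
  exists k, forall p, casimir oscw es p = k *: p.
Proof.
move=> [esS esL esR].
pose J (a b : g * g) := form a.2 b.2.
pose K := sum4 (fun a b c d => S4 a b c d * (J d b * J c a) : R[i]^o).
(* The quarter comes from the factor 1/2 in each [oscw], the half from X4 = - T1 and 2 T1 = - K p,
   both shown below. *)
exists (4%:R^-1 * (2%:R^-1 * K)) => p.
have Janti a b : a \in ps -> b \in ps -> J b a = - J a b.
  by move=> /psO[_ a2] /psO[_ b2]; apply: odd_form_anti.
have Wc a b q : a \in ps -> b \in ps -> w a.2 (w b.2 q) = w b.2 (w a.2 q) + J a b *: q.
  by move=> /psO[_ a2] /psO[_ b2]; apply: w_comm.
pose Q (a b c d : g * g) := w a.2 (w b.2 (w c.2 (w d.2 p))).
pose X4 := sum4 (fun a b c d => S4 a b c d *: Q a b c d).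
have -> : casimir oscw es p = 4%:R^-1 *: X4.
  have -> : 4%:R^-1 = 2%:R^-1 * 2%:R^-1 :> R[i] by rewrite -invfM -natrM.
  rewrite -scalerA /casimir /X4 /sum4.
  transitivity (\sum_(e <- es) 2%:R^-1 *: (2%:R^-1 *:
    \sum_(a <- ps) \sum_(b <- ps) \sum_(c <- ps) \sum_(d <- ps)
      (form e.1 (br a.1 b.1) * form e.2 (br c.1 d.1)) *: Q a b c d)).
    apply: eq_bigr => e _; rewrite {1}/oscw; congr (_ *: _).
    rewrite scaler_sumr; apply: eq_bigr => a _; rewrite scaler_sumr.
    apply: eq_bigr => b _; rewrite /oscw !(bilZr w_bil) scalerA mulrC -scalerA.
    congr (_ *: _); rewrite 2!(bil_sumr w_bil) scaler_sumr; apply: eq_bigr => c _.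
    rewrite 2!(bil_sumr w_bil) scaler_sumr; apply: eq_bigr => d _.
    by rewrite !(bilZr w_bil) scalerA.
  rewrite -!scaler_sumr; congr (_ *: (_ *: _)).
  rewrite exchange_big !big_seq; apply: eq_bigr => a /psO[a1 a2].
  rewrite exchange_big !big_seq; apply: eq_bigr => b /psO[b1 b2].
  rewrite exchange_big !big_seq; apply: eq_bigr => c /psO[c1 c2].
  rewrite exchange_big !big_seq; apply: eq_bigr => d /psO[d1 d2].
  rewrite -scaler_suml; congr (_ *: _); rewrite /S4.
  have e1 := odd_bracket_even a1 b1; have e2 := odd_bracket_even c1 d1.
  by rewrite [in RHS](esR _ e1) (bil_suml fb); apply: eq_bigr => e _; rewrite formZl.
rewrite -!scalerA; congr (_ *: _).
(* The quadratic remainders of reordering. T2 vanishes, [S4] being symmetric and [J] skew in c, d;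
   the same symmetry identifies T3 with T1. *)
pose T1 := sum4 (fun a b c d => S4 a b c d *: (J d b *: w a.2 (w c.2 p))).
pose T2 := sum4 (fun a b c d => S4 a b c d *: (J d c *: w a.2 (w b.2 p))).
pose T3 := sum4 (fun a b c d => S4 a b c d *: (J c b *: w a.2 (w d.2 p))).
have T20 : T2 = 0.
  apply: half; rewrite -sum4N {1}/T2 sum4_34; apply: eq_sum4 => a b c d ha hb hc hd.
  by rewrite S4_34 // (Janti d c) // scaleNr scalerN.
have T31 : T3 = T1.
  rewrite /T3 sum4_34; apply: eq_sum4 => a b c d ha hb hc hd.
  by rewrite S4_34.
(* The other two cyclic permutations of b, c, d in the coefficient: after relabelling, the product
   of operators is brought back to the order a, b, c, d. The cyclic identity then reads 3 (X4 + T1)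
   = 0. *)
have R1 : sum4 (fun a b c d => S4 a c d b *: Q a b c d) = X4 + T1 + T2.
  rewrite sum4_23 sum4_34 -!sum4D; apply: eq_sum4 => a b c d ha hb hc hd.
  rewrite /Q (Wc d b) // (Wc d c) // !(bilDr w_bil) !(bilZr w_bil) !scalerDr.
  by rewrite addrAC.
have R2 : sum4 (fun a b c d => S4 a d b c *: Q a b c d) = X4 + T3 + T1.
  rewrite sum4_34 sum4_23 -!sum4D; apply: eq_sum4 => a b c d ha hb hc hd.
  rewrite /Q (Wc d b) // (bilDr w_bil) (Wc c b) // !(bilDr w_bil) !(bilZr w_bil).
  by rewrite !scalerDr.
have XT : X4 = - T1.
  have : X4 + (X4 + T1 + T2) + (X4 + T3 + T1) = 0.
    rewrite -R1 -R2 -!sum4D /sum4 !big_seq big1 // => a ha.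
    rewrite big_seq big1 // => b hb; rewrite big_seq big1 // => c hc.
    rewrite big_seq big1 // => d hd.
    by rewrite -!scalerDl S4_jacobi // scale0r.
  rewrite T20 T31 addr0 [X4 + T1 + T1]addrC addrACA => E.
  have : 3%:R *: (X4 + T1) = 0 by rewrite scaler_nat -[RHS]E !mulrS mulr0n addr0.
  by move/eqP; rewrite scaler_eq0 pnatr_eq0 /= addr_eq0 => /eqP.
have T1E : T1 = - T1 - K *: p.
  (* Exchanging a with c and b with d preserves [S4], changes the sign of [J d b] and reverses the
     two operators; the commutator that restores their order produces K. *)
  have -> : K *: p = sum4 (fun a b c d => (S4 a b c d * (J d b * J c a)) *: p).
    rewrite /K /sum4 !scaler_suml; apply: eq_bigr => a _; rewrite scaler_suml.
    apply: eq_bigr => b _; rewrite scaler_suml; apply: eq_bigr => c _.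
    by rewrite scaler_suml.
  rewrite -!sum4N -sum4D {1}/T1 sum4_23 sum4_12 sum4_34 sum4_23.
  apply: eq_sum4 => a b c d ha hb hc hd.
  rewrite S4_pair // (Janti d b) // (Wc c a) // !scaleNr !scalerN !scalerDr.
  by rewrite opprD !scalerA mulrA.
apply: (@scalerI _ _ 2%:R); first by rewrite pnatr_eq0.
rewrite [RHS]scalerA mulfV ?pnatr_eq0 // scale1r XT scaler_nat mulr2n.
by rewrite [X in _ - X]T1E opprD !opprK addKr.
Qed.

End Oscillator.

(** * The polynomial model for the dual bases of n_1^+ and n_1^- *)

Section DualBases.
Variables (N : nat) (d x : N.-tuple g).
Local Notation P := {mpoly R[i][N]}.
Local Notation "'d_ i" := (tnth d i) (at level 8, i at level 2).
Local Notation "'x_ i" := (tnth x i) (at level 8, i at level 2).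
Hypothesis d_basis : basis_of (nplus_odd Dp) d.
Hypothesis x_basis : basis_of (nminus_odd Dp) x.
Hypothesis dx_dual : forall i j : 'I_N,
  Bform form (tnth d i) (tnth x j) = 2%:R^-1 * (i == j)%:R.

Lemma rootspace_line (alpha : hdual h) X : alpha != 0 -> X \in rootspace alpha ->
  X != 0 -> rootspace alpha = <[X]>%VS.
Proof.
move=> a0 Xa X0; apply/eqP; rewrite eqEsubv; apply/andP; split.
  apply/subvP => Y Ya; have [c ->] := root_line a0 Xa Ya X0.
  by rewrite memvZ // memv_line.
by apply/subvP => Y /vlineP[c ->]; rewrite memvZ.
Qed.

(** Multiplicity one is essential here: [nplus_odd] adds up whole root spaces, [nilp] takes one
    vector from each. *)
Lemma nplus_oddE : nplus_odd Dp = nilp true.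
Proof.
rewrite /nplus_odd /nilp span_def big_map.
have -> : posroots Dp true = [set` pos_seq true]%classic.
  by apply/seteqP; split=> a /pos_seqP.
rewrite -fsbig_seq ?pos_seq_uniq // !big_seq; apply: eq_bigr => a az.
have [_ ea _ _ _] := root_efP az.
have [/positive_neq0 a0 _] := (pos_seqP true a).1 az.
exact: (rootspace_line a0 ea (root_e_neq0 az)).
Qed.

Lemma nminus_oddE : nminus_odd Dp = niln true.
Proof.
rewrite /nminus_odd /niln span_def big_map.
have -> : posroots Dp true = [set` pos_seq true]%classic.
  by apply/seteqP; split=> a /pos_seqP.
rewrite -fsbig_seq ?pos_seq_uniq // !big_seq; apply: eq_bigr => a az.
have [_ _ _ fa _] := root_efP az.
have [/positive_neq0 a0 _] := (pos_seqP true a).1 az.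
have na0 : - a != 0 by rewrite oppr_eq0.
exact: (rootspace_line na0 fa (root_f_neq0 az)).
Qed.

Lemma d_nilp i : 'd_ i \in nilp true.
Proof. by rewrite -nplus_oddE (basis_mem d_basis) // mem_tnth. Qed.

Lemma x_niln i : 'x_ i \in niln true.
Proof. by rewrite -nminus_oddE (basis_mem x_basis) // mem_tnth. Qed.

Lemma d_odd i : 'd_ i \in gr g true.
Proof. exact: nilp_gr (d_nilp i). Qed.

Lemma x_odd i : 'x_ i \in gr g true.
Proof. exact: niln_gr (x_niln i). Qed.

Lemma form_dx i j : form 'd_ i 'x_ j = (i == j)%:R.
Proof.
have n2 : (2%:R^-1 : R[i]) != 0 by rewrite invr_eq0 pnatr_eq0.
by apply: (mulfI n2); apply: dx_dual.
Qed.

Lemma form_xd i j : form 'x_ i 'd_ j = - (i == j)%:R.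
Proof. by rewrite (odd_form_anti (x_odd i) (d_odd j)) form_dx eq_sym. Qed.

Lemma form_dd i j : form 'd_ i 'd_ j = 0.
Proof. exact: form_nilp_nilp (d_nilp i) (d_nilp j). Qed.

Lemma form_xx i j : form 'x_ i 'x_ j = 0.
Proof. exact: form_niln_niln (x_niln i) (x_niln j). Qed.

Definition dx_pairs := [seq ('d_ i, 'x_ i) | i <- enum 'I_N].

Lemma dx_pairs_dual : dual_pair form (nilp true) (niln true) dx_pairs.
Proof.
rewrite -nplus_oddE -nminus_oddE -(span_basis d_basis) -(span_basis x_basis).
rewrite -[X in <<X>>%VS](map_tnth_enum d) -[X in dual_pair _ _ <<X>>%VS](map_tnth_enum x).
apply: dual_pair_span => //; first exact: enum_uniq.
by move=> i j _ _; apply: form_dx.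
Qed.

(** The sign in (x_i, - d_i) normalises the second half, since form x_i d_i = -1. *)
Definition odd_pairs := dx_pairs ++ [seq (p.2, - p.1) | p <- dx_pairs].

Lemma odd_pairs_dual : dual_pair form (gr g true) (gr g true) odd_pairs.
Proof.
have nil_dual : dual_pair form 0%VS 0%VS [::].
  by split=> // X; rewrite memv0 big_nil => /eqP.
have := gr_dual_pair (z := true) nil_dual dx_pairs_dual.
rewrite /odd_pairs /= expr1; congr dual_pair; congr (_ ++ _).
by apply: eq_map => p; rewrite scaleN1r.
Qed.

Lemma sum_dx_pairs (V : zmodType) (F : g * g -> V) :
  \sum_(p <- dx_pairs) F p = \sum_i F ('d_ i, 'x_ i).
Proof. by rewrite big_map big_enum. Qed.

Lemma sum_odd_pairs (V : zmodType) (F : g * g -> V) :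
  \sum_(p <- odd_pairs) F p
    = \sum_i F ('d_ i, 'x_ i) + \sum_i F ('x_ i, - 'd_ i).
Proof. by rewrite big_cat [X in _ + X = _]big_map !sum_dx_pairs. Qed.

(** The linear map from g_1 to the Weyl algebra that sends x_i to multiplication by x_i and d_i to
    its partial derivative, with coordinates expressed by the form. *)
Definition weyl (Y : g) (p : P) : P :=
  \sum_i (form 'd_ i Y *: mulX i p - form 'x_ i Y *: mderiv i p).

Lemma weyl_bil : bilinear_fun weyl.
Proof.
split=> [p a X Y|X a p q]; rewrite /weyl scaler_sumr -big_split;
    apply: eq_bigr => i _ /=.
  rewrite !formDr !formZr !scalerDl opprD addrACA scalerBr !scalerA.
  by [].
rewrite mulX_linear mderivD mderivZ !scalerDr scalerN opprD addrACA !scalerA.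
by rewrite ![a * _]mulrC.
Qed.

Lemma mderiv_mulX i j (p : P) :
  mderiv i (mulX j p) = mulX j (mderiv i p) + (i == j)%:R *: p.
Proof.
rewrite /mulX mderivM mderivX mnm1E addrC eq_sym; congr (_ + _).
case: eqP => [->|_]; last by rewrite !scale0r mul0r.
have -> : (U_(j) - U_(j))%MM = 0%MM by apply/mnmP => k; rewrite mnmBE subnn mnm0E.
by rewrite mpolyX0 !scale1r mul1r.
Qed.

Lemma form_dx_expand : {in gr g true &, forall Y Z,
  form Y Z = \sum_i (form 'd_ i Y * form 'x_ i Z - form 'x_ i Y * form 'd_ i Z)}.
Proof.
move=> Y Z Y1 Z1; have [_ _ psR] := odd_pairs_dual.
rewrite {1}(psR _ Z1) (bil_sumr fb) sum_odd_pairs /= -big_split.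
apply: eq_bigr => i _ /=; rewrite !formZr formNr (odd_form_anti Y1 (x_odd i)).
by rewrite (odd_form_anti Y1 (d_odd i)) opprK addrC mulrN mulrC [_ * form 'd_ i Z]mulrC mulrC
  [form 'd_ i Z * _]mulrC.
Qed.

Lemma weyl_comm : {in gr g true &, forall Y Z p,
  weyl Y (weyl Z p) = weyl Z (weyl Y p) + form Y Z *: p}.
Proof.
move=> Y Z Y1 Z1 p; rewrite (form_dx_expand Y1 Z1) scaler_suml.
pose T U V i j := form 'd_ i U *: mulX i (form 'd_ j V *: mulX j p - form 'x_ j V *: mderiv j p)
  - form 'x_ i U *: mderiv i (form 'd_ j V *: mulX j p - form 'x_ j V *: mderiv j p).
have wE U V : weyl U (weyl V p) = \sum_i \sum_j T U V i j.
  rewrite /weyl; apply: eq_bigr => i _; rewrite (linear_sum (mulX i)) (linear_sum (mderiv i)) !scaler_sumr -sumrB.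
  by [].
rewrite !wE [X in _ = X + _]exchange_big -big_split; apply: eq_bigr => i _ /=.
(* A Kronecker delta spreads the scalar over the double sum, so that the identity holds term by
   term. *)
have -> : (form 'd_ i Y * form 'x_ i Z - form 'x_ i Y * form 'd_ i Z) *: p
   = \sum_j (i == j)%:R *: ((form 'd_ i Y * form 'x_ j Z - form 'x_ i Y * form 'd_ j Z) *: p).
  rewrite (bigD1 i) //= eqxx scale1r big1 ?addr0 // => j ji.
  by rewrite eq_sym (negPf ji) scale0r.
rewrite -big_split; apply: eq_bigr => j _ /=.
rewrite /T !mderivB !mderivZ !mderiv_mulX (mderiv_comm j i) [j == i]eq_sym.
rewrite scalerBl -!scalerA /mulX -!mul_mpolyC.
set e := (_ == _)%:R%:MP; ring.
Qed.

Lemma weyl_x i (p : P) : weyl 'x_ i p = mulX i p.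
Proof.
rewrite /weyl (bigD1 i) //= big1 ?addr0 => [|j ji].
  by rewrite form_dx form_xx eqxx scale1r scale0r subr0.
by rewrite form_dx form_xx (negPf ji) !scale0r subr0.
Qed.

Lemma weyl_Nd i (p : P) : weyl (- 'd_ i) p = - mderiv i p.
Proof.
rewrite (bilNl weyl_bil) /weyl (bigD1 i) //= big1 ?addr0 => [|j ji].
  by rewrite form_xd form_dd eqxx scaleN1r scale0r add0r opprK.
by rewrite form_xd form_dd (negPf ji) oppr0 !scale0r subr0.
Qed.

(** In the symmetric expression the mixed terms occur in both orders. Moving the derivatives to the
    right doubles x_j d/dx_i and leaves the constant sum over [d_l, x_l]; the overall 1/2 is the one
    in [Bform]. *)
Lemma osc_oscw X (p : P) : osc form d x X p = oscw weyl odd_pairs X p.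
Proof.
pose f Y Z := form X (br Y Z).
pose S (F : 'I_N -> 'I_N -> P) := \sum_i \sum_j F i j.
have SD F G : S (fun i j => F i j + G i j) = S F + S G.
  by rewrite /S -big_split; apply: eq_bigr => i _; rewrite -big_split.
have SZ c F : S (fun i j => c *: F i j) = c *: S F.
  by rewrite /S scaler_sumr; apply: eq_bigr => i _; rewrite scaler_sumr.
have SC F : S (fun i j => F j i) = S F by rewrite /S exchange_big.
have eqS F G : (forall i j, F i j = G i j) -> S F = S G.
  by move=> FG; apply: eq_bigr => i _; apply: eq_bigr => j _.
pose A i j := f 'd_ i 'd_ j *: mulX i (mulX j p).
pose B i j := f 'x_ i 'd_ j *: mulX j (mderiv i p).
pose D i j := f 'x_ i 'x_ j *: mderiv i (mderiv j p).
pose E i j := (i == j)%:R *: (f 'd_ i 'x_ j *: p).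
have oE : oscw weyl odd_pairs X p = 2%:R^-1 *: (S A + S D - 2%:R *: S B - S E).
  rewrite /oscw; congr (_ *: _); rewrite sum_odd_pairs.
  transitivity (S A + S (fun i j => -1 *: B j i) + (S (fun i j => -1 *: (B i j + E i j)) + S D)).
    congr (_ + _); rewrite -SD; apply: eq_bigr => i _; rewrite sum_odd_pairs -big_split;
      apply: eq_bigr => j _ /=.
      rewrite !weyl_x !weyl_Nd /A /B /f (linearN (mulX i)) scalerN scaleN1r.
      by rewrite (odd_bracketC (x_odd j) (d_odd i)).
    rewrite !weyl_x !weyl_Nd mderivN opprK mderiv_mulX scalerN scaleN1r /B /E /D /f.
    rewrite !scalerDr (odd_bracketC (x_odd i) (d_odd j)).
    case: (eqVneq i j) => [->|ij]; first by rewrite !scale1r.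
    by rewrite !scale0r scaler0.
  rewrite (SZ (-1) (fun i j => B j i)) (SC B) (SZ (-1) (fun i j => B i j + E i j)) (SD B E).
  rewrite !scaleN1r scaler_nat.
  move: (S A) (S B) (S D) (S E) => a b c e; ring.
rewrite oE /osc.
have -> : \sum_i \sum_j (Bform form X (br 'd_ i 'd_ j) *: mulX i (mulX j p)
      + Bform form X (br 'x_ i 'x_ j) *: mderiv i (mderiv j p)) = 2%:R^-1 *: (S A + S D).
  by rewrite -SD -SZ; apply: eqS => i j; rewrite scalerDr !scalerA.
have -> : \sum_i \sum_j Bform form X (br 'x_ i 'd_ j) *: mulX j (mderiv i p)
    = 2%:R^-1 *: S B.
  by rewrite -SZ; apply: eqS => i j; rewrite scalerA.
have -> : (\sum_l Bform form X (br 'd_ l 'x_ l)) *: p = 2%:R^-1 *: S E.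
  rewrite -SZ scaler_suml; apply: eq_bigr => i _; rewrite (bigD1 i) //= big1 ?addr0.
    by rewrite /E eqxx scale1r scalerA.
  by move=> j ji; rewrite /E eq_sym (negPf ji) scale0r scaler0.
by rewrite !scalerBr !scalerDr !scalerA mulrC.
Qed.

Lemma osc_vacuum X : (forall i j, form X (br 'd_ i 'd_ j) = 0) ->
  osc form d x X 1
    = - (2%:R^-1 * form X (\sum_(p <- dx_pairs) br p.1 p.2)) *: 1.
Proof.
move=> hX; have d1 i : mderiv i (1 : P) = 0 by rewrite -mpolyC1 mderivC.
rewrite /osc big1 => [|i _]; last first.
  by rewrite big1 // => j _; rewrite /Bform hX mulr0 scale0r add0r d1 mderiv0 scaler0.
rewrite [X in _ - 2%:R *: X]big1 => [|i _]; last first.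
  by rewrite big1 // => j _; rewrite d1 /mulX mulr0 scaler0.
rewrite scaler0 subr0 add0r scaleNr; congr (- (_ *: _)).
by rewrite sum_dx_pairs (bil_sumr fb) mulr_sumr.
Qed.

(** The weight of the vacuum is minus half of 2 rho_1, the functional represented by sum
    [d_i, x_i]. *)
Lemma osc_vacuum_cartan H : H \in h ->
  osc form d x H 1 = - rho_of Dp true (vsproj h H) *: 1.
Proof.
move=> Hh; rewrite osc_vacuum => [|i j].
  rewrite (dual_pair_trace dx_pairs_dual Hh) scale_lfunE.
  rewrite [_ *: _ : R[i]]/(_ * _) mulrA mulVf ?pnatr_eq0 // mul1r.
  by [].
by rewrite -formA (form_nilp_nilp (nilp_stable Hh (d_nilp i)) (d_nilp j)).
Qed.

(** The coefficients pair weights that add up to a sum of three positive roots, which is nonzero;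
    the constant pairs a root vector with an element of h. *)
Lemma osc_vacuum_positive alpha X : Dp alpha -> X \in rootspace alpha ->
  osc form d x X 1 = 0.
Proof.
move=> Da Xa; rewrite osc_vacuum => [|i j].
  have th := dual_pair_bracket_cartan dx_pairs_dual.
  have a0 : alpha + 0 != 0 by rewrite addr0; apply: positive_neq0.
  by rewrite (rootspace_form Xa (cartan_rootspace0 th) a0) mulr0 oppr0 scale0r.
rewrite -formA; move: 'd_ i (d_nilp i).
apply: nilp_ind => [|c Y Z hY hZ|b Y [Db _] _ Yb].
- by rewrite (bil0r bb) (bil0l fb).
- by rewrite (bilDr bb) (bilZr bb) formDl formZl hY hZ mulr0 addr0.
have XY := rootspace_bracket Xa Yb.
move: 'd_ j (d_nilp j); apply: nilp_ind => [|c Z Z' hZ hZ'|e Z [De _] _ Ze].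
- by rewrite (bil0r fb).
- by rewrite formDr formZr hZ hZ' mulr0 addr0.
exact: (rootspace_form XY Ze (positive_add3 Da Db De)).
Qed.

(* The Casimir of g_0 acts on the oscillator module by the scalar it has on the *)
(* highest weight vector 1, of weight - rho_1.                                  *)
Lemma osc_casimir es p : dual_pair form (gr g false) (gr g false) es ->
  casimir (osc form d x) es p
    = hform form (- rho_of Dp true + 2%:R *: rho_of Dp false) (- rho_of Dp true) *: p.
Proof.
move=> hes.
have E : osc form d x = oscw weyl odd_pairs.
  by apply/funext => X; apply/funext => q; apply: osc_oscw.
rewrite E; have [k kE] := oscw_casimir weyl_bil weyl_comm odd_pairs_dual hes.
rewrite kE; congr (_ *: _).
pose V : set P := [set q | q = 0].
have Vs : is_subspace V.
  by split=> // a u v; rewrite /V /= => -> ->; rewrite scaler0 addr0.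
have V1 X w : X \in gr g false -> V w -> V (oscw weyl odd_pairs X w).
  by move=> _; rewrite /V /= => ->; apply: (oscw0 weyl_bil).
have V2 a X : posroots Dp false a -> X \in (gr g false :&: rootspace a)%VS ->
    V (oscw weyl odd_pairs X 1).
  move=> [Da _]; rewrite memv_cap => /andP[_ Xa].
  by rewrite /V /= -osc_oscw (osc_vacuum_positive Da Xa).
have V3 H : V (oscw weyl odd_pairs (vsval H) 1 - (- rho_of Dp true) H *: 1).
  rewrite /V /= -osc_oscw osc_vacuum_cartan ?subvsP // vsvalK.
  by rewrite opp_lfunE subrr.
have := highest_weight_casimir (oscw_bil weyl_bil odd_pairs)
  (oscw_bracket weyl_bil weyl_comm odd_pairs_dual) Vs V1 V2 V3 hes.
rewrite /V /= kE => /eqP; rewrite subr_eq0 => /eqP.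
(* Constant coefficients turn the equality of multiples of the vacuum into an equality of
   scalars. *)
move/(congr1 (mcoeff 0%MM)); rewrite !mcoeffZ mcoeff1 eqxx.
by rewrite !mulr1.
Qed.

(** * Casimir element of g on a highest weight supermodule *)

Section HighestWeightModule.
Variables (M : supermodule g).
Local Notation act := (fun X (v : M) => sm_act M X v).

Lemma sm_act_bil : bilinear_fun act.
Proof. by split=> [v|X]; [apply: sm_act_linear|apply: linearP]. Qed.

Lemma sm_act_even : {in gr g false &, forall X Y v,
  act (br X Y) v = act X (act Y v) - act Y (act X v)}.
Proof. by move=> X Y X0 Y0 v; rewrite (sm_act_bracket v X0 Y0) /= expr0 scale1r. Qed.

Lemma sm_act_even_odd : {in gr g false & gr g true, forall X Y v,
  act (br X Y) v = act X (act Y v) - act Y (act X v)}.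
Proof. by move=> X Y X0 Y0 v; rewrite (sm_act_bracket v X0 Y0) /= expr0 scale1r. Qed.

Lemma sm_act_odd : {in gr g true &, forall X Y v,
  act (br X Y) v = act X (act Y v) + act Y (act X v)}.
Proof.
by move=> X Y X1 Y1 v; rewrite (sm_act_bracket v X1 Y1) /= expr1 scaleN1r opprK.
Qed.

Variable es : seq (g * g).
Hypothesis es_dual : dual_pair form (gr g false) (gr g false) es.

(** The odd part carries a minus sign because its pairs are multiplied in the order e f; exchanging
    the factors of all pairs in [odd_pairs] would reverse that sign. *)
Definition super_casimir (v : M) : M :=
  casimir act es v - casimir act odd_pairs v.

Lemma act_act_bilinear v : bilinear_fun (fun X Y => act X (act Y v)).
Proof. exact: act_act_bil sm_act_bil v. Qed.

Lemma super_casimir_even X v : X \in gr g false ->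
  act X (super_casimir v) = super_casimir (act X v).
Proof.
move=> X0; rewrite /super_casimir (bilBr sm_act_bil); congr (_ - _).
  exact: (casimir_comm sm_act_bil sm_act_even v es_dual X0).
have st : {in gr g true, forall Y, br X Y \in gr g true}.
  by move=> Y Y1; apply: even_bracket_odd.
have := dual_pair_inv form_inv (act_act_bilinear v) odd_pairs_dual X0 st st.
move/eqP; rewrite -addr_eq0 -big_split /= => /eqP E.
apply/eqP; rewrite -subr_eq0 -[X in _ == X]E; apply/eqP.
have [psS _ _] := odd_pairs_dual.
rewrite /casimir (bil_sumr sm_act_bil) -sumrB !big_seq; apply: eq_bigr => p /psS[p1 p2].
rewrite (sm_act_even_odd X0 p1) (sm_act_even_odd X0 p2) (bilBr sm_act_bil).
by rewrite addrA subrK.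
Qed.

(** An odd X carries the canonical tensor of g_0 to that of g_1: both sides are expanded in the same
    products, with coefficients that agree by invariance. *)
Lemma odd_even_exchange X v : X \in gr g true ->
  \sum_(e <- es) act e.1 (act (br X e.2) v)
    = \sum_(p <- odd_pairs) act (br X p.1) (act p.2 v).
Proof.
move=> X1; have [esS esL esR] := es_dual; have [psS psL psR] := odd_pairs_dual.
transitivity (\sum_(p <- odd_pairs) \sum_(e <- es)
    form (br X p.1) e.2 *: act e.1 (act p.2 v)); last first.
  rewrite !big_seq; apply: eq_bigr => p /psS[p1 p2].
  have XE := odd_bracket_even X1 p1.
  rewrite [in RHS](esL _ XE) (bil_suml sm_act_bil).
  by apply: eq_bigr => e _; rewrite (bilZl sm_act_bil).
rewrite exchange_big !big_seq; apply: eq_bigr => e /esS[e1 e2] /=.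
have Xe : br X e.2 \in gr g true by rewrite -[true]/(addb true false) bracket_gr.
rewrite [in LHS](psR _ Xe) (bil_suml sm_act_bil) (bil_sumr sm_act_bil) !big_seq.
apply: eq_bigr => p /psS[p1 p2]; rewrite (bilZl sm_act_bil) (bilZr sm_act_bil).
congr (_ *: _).
by rewrite -formA (odd_bracketC p1 X1).
Qed.

Lemma even_odd_exchange X v : X \in gr g true ->
  \sum_(e <- es) act (br X e.1) (act e.2 v)
    = - \sum_(p <- odd_pairs) act p.1 (act (br X p.2) v).
Proof.
move=> X1; have [esS esL esR] := es_dual; have [psS psL psR] := odd_pairs_dual.
transitivity (\sum_(e <- es) \sum_(p <- odd_pairs)
    form (br X e.1) p.2 *: act p.1 (act e.2 v)).
  rewrite !big_seq; apply: eq_bigr => e /esS[e1 e2].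
  have Xe : br X e.1 \in gr g true by rewrite -[true]/(addb true false) bracket_gr.
  rewrite [in LHS](psL _ Xe) (bil_suml sm_act_bil).
  by apply: eq_bigr => p _; rewrite (bilZl sm_act_bil).
rewrite exchange_big -sumrN !big_seq; apply: eq_bigr => p /psS[p1 p2] /=.
have XE := odd_bracket_even X1 p2.
rewrite [in RHS](esR _ XE) (bil_suml sm_act_bil) (bil_sumr sm_act_bil) -sumrN !big_seq.
apply: eq_bigr => e /esS[e1 e2]; rewrite (bilZl sm_act_bil) (bilZr sm_act_bil) -scaleNr.
congr (_ *: _).
by rewrite (bracket_even_skew' _ e1) formNl formA.
Qed.

(** The commutator of X with either Casimir part consists of two sums; by the two exchange lemmas
    those of the even part equal those of the odd part, so the difference commutes with X. *)
Lemma super_casimir_odd X v : X \in gr g true ->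
  act X (super_casimir v) = super_casimir (act X v).
Proof.
move=> X1.
have [esS _ _] := es_dual; have [psS _ _] := odd_pairs_dual.
have Ee : act X (casimir act es v) - casimir act es (act X v)
  = \sum_(e <- es) act (br X e.1) (act e.2 v) + \sum_(e <- es) act e.1 (act (br X e.2) v).
  rewrite /casimir (bil_sumr sm_act_bil) -sumrB -big_split !big_seq.
  apply: eq_bigr => e /esS[e1 e2] /=.
  rewrite (sm_act_bracket _ X1 e1) (sm_act_bracket _ X1 e2) /= !expr0 !scale1r.
  by rewrite (bilBr sm_act_bil) addrA subrK.
have Eo : act X (casimir act odd_pairs v) - casimir act odd_pairs (act X v)
  = \sum_(p <- odd_pairs) act (br X p.1) (act p.2 v)
    - \sum_(p <- odd_pairs) act p.1 (act (br X p.2) v).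
  rewrite /casimir (bil_sumr sm_act_bil) -!sumrB !big_seq.
  apply: eq_bigr => p /psS[p1 p2] /=.
  rewrite (sm_act_odd X1 p1) (sm_act_odd X1 p2).
  by rewrite (bilDr sm_act_bil) opprD addrA addrK.
apply/eqP; rewrite -subr_eq0 /super_casimir (bilBr sm_act_bil).
have swap (a b a' b' : M) : a - b - (a' - b') = a - a' - (b - b').
  by rewrite !opprB addrACA [RHS]addrACA; congr (_ + _); rewrite addrC.
rewrite swap Ee Eo odd_even_exchange // even_odd_exchange //.
by rewrite [- _ + _]addrC subrr.
Qed.

Variables (Lambda : hdual h) (v0 : M).
Hypothesis v0_pos : forall alpha X, Dp alpha -> X \in rootspace alpha -> sm_act M X v0 = 0.
Hypothesis v0_wt : forall H : subvs_of h, sm_act M (vsval H) v0 = Lambda H *: v0.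
Hypothesis v0_gen : forall W : set M, is_submodule W -> W v0 -> forall w, W w.

(** As d_i kills v0, d_i x_i v0 = [d_i, x_i] v0 and the odd part contributes (2 rho_1, Lambda).
    Subtracting it from (Lambda + 2 rho_0, Lambda) replaces rho_0 by rho. *)
Lemma super_casimir_vector :
  super_casimir v0 = hform form (Lambda + 2%:R *: rho Dp) Lambda *: v0.
Proof.
pose V : set M := [set q | q = 0].
have Vs : is_subspace V.
  by split=> // a u v; rewrite /V /= => -> ->; rewrite scaler0 addr0.
have V1 X w : X \in gr g false -> V w -> V (act X w).
  by move=> _; rewrite /V /= => ->; rewrite linear0.
have V2 a X : posroots Dp false a -> X \in (gr g false :&: rootspace a)%VS ->
    V (act X v0).
  by move=> [Da _]; rewrite memv_cap => /andP[_ Xa]; apply: (v0_pos Da Xa).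
have V3 H : V (act (vsval H) v0 - Lambda H *: v0).
  by rewrite /V /= v0_wt subrr.
have := highest_weight_casimir sm_act_bil sm_act_even Vs V1 V2 V3 es_dual.
rewrite /V /= => /eqP; rewrite subr_eq0 => /eqP E.
rewrite /super_casimir E.
have -> : casimir act odd_pairs v0 = hform form (2%:R *: rho_of Dp true) Lambda *: v0.
  have dv i : act 'd_ i v0 = 0.
    move: 'd_ i (d_nilp i); apply: nilp_ind => [|c X Y hX hY|a X [Da _] _ Xa].
    - exact: (bil0l sm_act_bil).
    - by rewrite (bilDl sm_act_bil) (bilZl sm_act_bil) hX hY scaler0 addr0.
    - exact: (v0_pos Da Xa).
  have tE := dual_pair_sharp dx_pairs_dual.
  rewrite hformE -v0_wt -tE sum_dx_pairs (bil_suml sm_act_bil).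
  rewrite /casimir sum_odd_pairs /= [X in _ + X]big1 ?addr0 => [|i _]; last first.
    by rewrite (bilNl sm_act_bil) dv oppr0 linear0.
  apply: eq_bigr => i _; rewrite (sm_act_odd (d_odd i) (x_odd i)) dv linear0 addr0.
  by [].
rewrite -scalerBl; congr (_ *: _).
rewrite /rho scalerBr addrA -[X in _ = hform form (_ + X) _]scaleN1r.
by rewrite [in RHS]hformDl (hformZl (-1)) mulN1r.
Qed.

(** The eigenspace for this scalar is a submodule, since the operator commutes with even and odd
    elements, and it contains the generator [v0]. *)
Lemma super_casimir_scalar v :
  super_casimir v = hform form (Lambda + 2%:R *: rho Dp) Lambda *: v.
Proof.
pose c := hform form (Lambda + 2%:R *: rho Dp) Lambda.
have scD a u w : super_casimir (a *: u + w) = a *: super_casimir u + super_casimir w.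
  rewrite /super_casimir /casimir scalerBr addrACA -opprD !scaler_sumr -!big_split.
  by congr (_ - _); apply: eq_bigr => p _; rewrite !linearP.
apply: (v0_gen (W := [set v | super_casimir v = c *: v])); last exact: super_casimir_vector.
split; first split.
- rewrite /= scaler0 /super_casimir /casimir !big1 ?subr0 // => p _; rewrite !linear0 //.
- by move=> a u w /= hu hw; rewrite scD hu hw scalerDr !scalerA mulrC.
move=> X w /= hw; have [X0 [X1 [h0 h1 ->]]] := gr_split X.
rewrite (bilDl sm_act_bil) -[act X0 w]scale1r scD !scale1r.
rewrite -(super_casimir_even _ h0) -(super_casimir_odd _ h1) hw.
by rewrite !linearZ /= scalerDr.
Qed.

End HighestWeightModule.

Lemma leibniz_cancel (V : zmodType) (t1 t2 t3 t4 t5 t6 : V) :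
  t1 - t2 + (t5 - t6) = t1 + t3 + (t4 + t5) - (t2 + t4 + (t3 + t6)).
Proof.
rewrite [t4 + t5]addrC [t1 + t3 + _]addrACA [t3 + t6]addrC [t2 + t4 + _]addrACA.
by rewrite [t4 + t3]addrC opprD [RHS]addrACA subrr addr0 opprD addrACA.
Qed.

(** With r0 and r1 standing for rho_0 and rho_1, both sides are (m, m) + 2 (r0, m) + 2 (r0, r1) -
    (r1, r1). This converts the difference of two Casimir values of g_0 into the expression of the
    theorem. *)
Lemma symmetric_form_shift (K : comNzRingType) (E : lmodType K) (B : E -> E -> K) :
  (forall u v w, B (u + v) w = B u w + B v w) ->
  (forall a u w, B (a *: u) w = a * B u w) -> (forall u v, B u v = B v u) ->
  forall m r0 r1, B (m + r1 + 2%:R *: (r0 - r1)) (m + r1)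
    = B (m + 2%:R *: r0) m - B (- r1 + 2%:R *: r0) (- r1).
Proof.
move=> BD BZ BC m r0 r1.
have BDr u v w : B u (v + w) = B u v + B u w by rewrite BC BD !(BC u).
have BN u w : B (- u) w = - B u w by rewrite -scaleN1r BZ mulN1r.
have BNr u w : B u (- w) = - B u w by rewrite BC BN (BC u).
rewrite !(BD, BDr, BZ, BN, BNr) (BC r1 m); ring.
Qed.

Lemma big2_split (V : zmodType) (I J : Type) (r : seq I) (s : seq J)
    (F G : I -> J -> V) :
  \sum_(a <- r) \sum_(b <- s) (F a b + G a b)
    = \sum_(a <- r) \sum_(b <- s) F a b + \sum_(a <- r) \sum_(b <- s) G a b.
Proof. by rewrite -big_split; apply: eq_bigr => a _; rewrite -big_split. Qed.

(** * The square of the Dirac operator on the tensor product *)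

Section Tensor.
Variables (M : supermodule g) (T : tensor_product M P).
Local Notation act := (fun X (v : M) => sm_act M X v).
Local Notation osc := (osc form d x).
Local Notation diag := (fun X (w : T) => diag_act form d x X w).
Local Notation dir := (fun w : T => dirac d x w).
Let tb : bilinear_fun (tens T) := tens_bilinear T.

Lemma tens_ext (W : lmodType R[i]) (F G : T -> W) : linear F -> linear G ->
  (forall u p, F (tens T u p) = G (tens T u p)) -> F =1 G.
Proof.
move=> lF lG FG.
pose F' : {linear T -> W} := HB.pack F (GRing.isLinear.Build _ _ _ _ F lF).
pose G' : {linear T -> W} := HB.pack G (GRing.isLinear.Build _ _ _ _ G lG).
exact: (@tens_unique _ _ _ T W F' G').
Qed.

Lemma diag_linear X : linear (diag X).
Proof. by move=> a u v; rewrite /diag_act !linearP scalerDr addrACA. Qed.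

Lemma diagP X a (u v : T) : diag X (a *: u + v) = a *: diag X u + diag X v.
Proof. exact: diag_linear. Qed.

Lemma diag_tens X u p :
  diag X (tens T u p) = tens T (act X u) p + tens T u (osc X p).
Proof. by rewrite /diag_act !tens_opE. Qed.

Lemma osc_bil : bilinear_fun osc.
Proof.
split=> [p|X]; last exact: osc_linear.
by move=> a X Y; rewrite !osc_oscw; apply: (oscw_bil weyl_bil odd_pairs).1.
Qed.

Lemma osc_bracket : {in gr g false &, forall X Z p,
  osc (br X Z) p = osc X (osc Z p) - osc Z (osc X p)}.
Proof.
move=> X Z X0 Z0 p; rewrite !osc_oscw.
exact: (oscw_bracket weyl_bil weyl_comm odd_pairs_dual X0 Z0 p).
Qed.

Lemma diag_bil : bilinear_fun diag.
Proof.
split=> [w a X Y|X]; last exact: diag_linear.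
move: w; apply: tens_ext => [|b u v|u p]; first exact: diag_linear.
  rewrite !diagP; move: (diag_act _ _ _ X u) (diag_act _ _ _ X v) => t1 t2.
  move: (diag_act _ _ _ Y u) (diag_act _ _ _ Y v) => t3 t4.
  by rewrite !scalerDr !scalerA [a * b]mulrC addrACA.
rewrite !diag_tens (bilDl (sm_act_bil M)) (bilZl (sm_act_bil M)) (bilDl osc_bil) (bilZl osc_bil).
by rewrite (bilDl tb) (bilZl tb) (bilDr tb) (bilZr tb) scalerDr addrACA.
Qed.

Lemma diagD X u v : diag X (u + v) = diag X u + diag X v.
Proof. exact: (bilDr diag_bil). Qed.

Lemma diag_bracket : {in gr g false &, forall X Y w,
  diag (br X Y) w = diag X (diag Y w) - diag Y (diag X w)}.
Proof.
move=> X Y X0 Y0; apply: tens_ext => [|a u v|u p]; first exact: diag_linear.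
  by rewrite !diagP scalerBr opprD addrACA.
rewrite !diag_tens !diagD !diag_tens (sm_act_even X0 Y0) (osc_bracket X0 Y0).
rewrite (bilBl tb) (bilBr tb).
exact: leibniz_cancel.
Qed.


Lemma tens_op_linear (f : {linear M -> M}) (k : {linear P -> P}) a (u v : T) :
  tens_op T f k (a *: u + v) = a *: tens_op T f k u + tens_op T f k v.
Proof. exact: linearP. Qed.

Lemma dirac_linear a (u v : T) :
  dirac d x (a *: u + v) = a *: dirac d x u + dirac d x v.
Proof.
rewrite /dirac scalerA [a * _]mulrC -scalerA -scalerDr; congr (_ *: _).
rewrite scaler_sumr -big_split; apply: eq_bigr => i _ /=.
by rewrite !tens_op_linear scalerBr opprD addrACA.
Qed.

Lemma diracD (u v : T) : dirac d x (u + v) = dirac d x u + dirac d x v.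
Proof. by have := dirac_linear 1 u v; rewrite !scale1r. Qed.

Lemma dirac0 : dirac d x (0 : T) = 0.
Proof. by apply: (addrI (dirac d x (0 : T))); rewrite -diracD !addr0. Qed.

Lemma diracZ a (u : T) : dirac d x (a *: u) = a *: dirac d x u.
Proof. by have := dirac_linear a u 0; rewrite dirac0 !addr0. Qed.

Lemma dirac_sum (I : Type) (r : seq I) (F : I -> T) :
  dirac d x (\sum_(i <- r) F i) = \sum_(i <- r) dirac d x (F i).
Proof. exact: (big_morph (fun w : T => dirac d x w) diracD dirac0). Qed.

(** The two families of terms of D are the two halves of [odd_pairs]: D is twice the canonical
    tensor of g_1. *)
Lemma dirac_tens u p : dirac d x (tens T u p)
  = 2%:R *: \sum_(a <- odd_pairs) tens T (act a.1 u) (weyl a.2 p).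
Proof.
rewrite /dirac sum_odd_pairs -big_split; congr (_ *: _).
apply: eq_bigr => i _ /=; rewrite !tens_opE weyl_x weyl_Nd.
by rewrite (bilNr tb).
Qed.

Lemma dirac_sq_tens u p : dirac d x (dirac d x (tens T u p))
  = 4%:R *: \sum_(a <- odd_pairs) \sum_(b <- odd_pairs)
      tens T (act a.1 (act b.1 u)) (weyl a.2 (weyl b.2 p)).
Proof.
rewrite dirac_tens diracZ dirac_sum (natrM _ 2 2) -scalerA; congr (_ *: _); rewrite exchange_big scaler_sumr.
by apply: eq_bigr => b _; rewrite dirac_tens.
Qed.

Lemma dual_pair_swap es : dual_pair form (gr g false) (gr g false) es ->
  dual_pair form (gr g false) (gr g false) [seq (p.2, p.1) | p <- es].
Proof.
move=> [esS esL esR]; split=> [_ /mapP[p /esS[p1 p2] ->]//|X X0|X X0].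
  rewrite [LHS](esR _ X0) big_map; apply: eq_bigr => p _.
  by rewrite [in RHS]form_h_sym.
rewrite [LHS](esL _ X0) big_map; apply: eq_bigr => p _.
by rewrite [in LHS]form_h_sym.
Qed.

Variable es : seq (g * g).
Hypothesis es_dual : dual_pair form (gr g false) (gr g false) es.

Lemma cross_sym u p :
  \sum_(e <- es) tens T (act e.2 u) (osc e.1 p)
    = \sum_(e <- es) tens T (act e.1 u) (osc e.2 p).
Proof.
have Bb : bilinear_fun (fun X Y => tens T (act X u) (osc Y p)).
  split=> [Y a X X'|X a Y Y'].
    by rewrite (bilDl (sm_act_bil M)) (bilZl (sm_act_bil M)) (bilDl tb) (bilZl tb).
  by rewrite (bilDl osc_bil) (bilZl osc_bil) (bilDr tb) (bilZr tb).
have := dual_pair_indep Bb es_dual (dual_pair_swap es_dual).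
by rewrite big_map => ->.
Qed.

(** Twice the sum is its symmetrisation in a and b. Reordering the Weyl factors leaves
    anticommutators [a, b] on M, in g_0, whose expansion reassembles [osc], and scalar commutators,
    which collapse to the odd part of the Casimir of g. *)
Lemma dirac_sq_even u p :
  2%:R *: (\sum_(a <- odd_pairs) \sum_(b <- odd_pairs)
      tens T (act a.1 (act b.1 u)) (weyl a.2 (weyl b.2 p)))
  = 2%:R *: (\sum_(e <- es) tens T (act e.1 u) (osc e.2 p))
    + tens T (casimir act odd_pairs u) p.
Proof.
have [psS psL psR] := odd_pairs_dual; have [esS esL esR] := es_dual.
pose G a b := tens T (act a.1 (act b.1 u)) (weyl a.2 (weyl b.2 p)).
rewrite -/(G _ _) [LHS]scaler_nat mulr2n {2}exchange_big -big_split /=.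
transitivity (\sum_(a <- odd_pairs) \sum_(b <- odd_pairs)
   (tens T (act (br a.1 b.1) u) (weyl a.2 (weyl b.2 p))
    + form b.2 a.2 *: tens T (act b.1 (act a.1 u)) p)).
  rewrite !big_seq; apply: eq_bigr => a /psS[a1 a2]; rewrite -big_split !big_seq.
  apply: eq_bigr => b /psS[b1 b2] /=; rewrite /G.
  rewrite (weyl_comm b2 a2) (bilDr tb) (bilZr tb) addrA -(bilDl tb).
  by rewrite (sm_act_odd a1 b1).
rewrite big2_split; congr (_ + _).
  transitivity (\sum_(e <- es) \sum_(a <- odd_pairs) \sum_(b <- odd_pairs)
      tens T (act e.1 u) (form e.2 (br a.1 b.1) *: weyl a.2 (weyl b.2 p))).
    rewrite [RHS]exchange_big !big_seq; apply: eq_bigr => a /psS[a1 a2].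
    rewrite [RHS]exchange_big !big_seq; apply: eq_bigr => b /psS[b1 b2] /=.
    have abE := odd_bracket_even a1 b1.
    rewrite [in LHS](esL _ abE) (bil_suml (sm_act_bil M)) (bil_suml tb).
    apply: eq_bigr => e _; rewrite (bilZl (sm_act_bil M)) (bilZl tb) (bilZr tb).
    by rewrite [in LHS]form_h_sym.
  rewrite scaler_sumr; apply: eq_bigr => e _; rewrite osc_oscw /oscw (bilZr tb) scalerA.
  rewrite mulfV ?pnatr_eq0 // scale1r (bil_sumr tb); apply: eq_bigr => a _.
  by rewrite (bil_sumr tb).
rewrite exchange_big /casimir (bil_suml tb) !big_seq; apply: eq_bigr => b /psS[b1 b2] /=.
rewrite [in RHS](psL _ b2) (bil_suml (sm_act_bil M)) (bil_sumr (sm_act_bil M)) (bil_suml tb).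
apply: eq_bigr => a _.
by rewrite (bilZl (sm_act_bil M)) (bilZr (sm_act_bil M)) (bilZl tb).
Qed.

Variables (Lambda : hdual h) (v0 : M).
Hypothesis v0_pos : forall alpha X, Dp alpha -> X \in rootspace alpha -> sm_act M X v0 = 0.
Hypothesis v0_wt : forall H : subvs_of h, sm_act M (vsval H) v0 = Lambda H *: v0.
Hypothesis v0_gen : forall W : set M, is_submodule W -> W v0 -> forall w, W w.

Lemma casimir_diag_tens u p : casimir diag es (tens T u p)
  = tens T (casimir act es u) p + 2%:R *: (\sum_(e <- es) tens T (act e.1 u) (osc e.2 p))
    + tens T u (casimir osc es p).
Proof.
rewrite /casimir (bil_suml tb) (bil_sumr tb) scaler_nat mulr2n -{1}cross_sym.
rewrite -!big_split; apply: eq_bigr => e _ /=.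
by rewrite diag_tens diagD !diag_tens !addrA.
Qed.

Lemma casimir_diag_linear a (u v : T) :
  casimir diag es (a *: u + v) = a *: casimir diag es u + casimir diag es v.
Proof.
rewrite /casimir scaler_sumr -big_split; apply: eq_bigr => e _ /=.
by rewrite !diagP.
Qed.

Let cM := hform form (Lambda + 2%:R *: rho Dp) Lambda.
Let cO := hform form (- rho_of Dp true + 2%:R *: rho_of Dp false) (- rho_of Dp true).

(** The cross term of the diagonal Casimir equals that of D^2. Eliminating it leaves the even
    Casimir on M, which combines with the odd Casimir part to [super_casimir], and the Casimir on
    the oscillator module; both are scalars. *)
Lemma dirac_sq w :
  dirac d x (dirac d x w) = 2%:R *: (casimir diag es w - (cM + cO) *: w).
Proof.
move: w; apply: tens_ext => [a u v|a u v|u p].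
- by rewrite !dirac_linear.
- rewrite casimir_diag_linear; move: (casimir _ es u) (casimir _ es v) => t1 t2.
  rewrite scalerA [a * _]mulrC -scalerA -scalerDr; congr (_ *: _).
  by rewrite scalerDr scalerBr !scalerA [a * _]mulrC opprD addrACA.
rewrite dirac_sq_tens casimir_diag_tens (natrM _ 2 2) -scalerA; congr (_ *: _).
rewrite dirac_sq_even osc_casimir // -/cO [(cM + cO) *: _]scalerDl opprD (bilZr tb).
have := super_casimir_scalar es_dual v0_pos v0_wt v0_gen u.
rewrite /super_casimir -/cM => /eqP; rewrite subr_eq => /eqP ->.
rewrite (bilDl tb) (bilZl tb).
move: (cM *: _) (cO *: _) (tens T (casimir _ _ _) _) (2%:R *: _) => t1 t2 t3 t4.
by rewrite addrACA subrr addr0 [t1 + t3]addrC addrAC addrK addrC.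
Qed.

Variables (mu : hdual h) (U V : set T).
Hypothesis UV_factor : composition_factor form d x Dp mu U V.

(** The vectors of U on which the Casimir is the scalar modulo V form a submodule between V and U.
    It contains the highest weight vector, which is not in V, so simplicity makes it U. *)
Lemma casimir_factor u : U u ->
  V (casimir diag es u - hform form (mu + 2%:R *: rho_of Dp false) mu *: u).
Proof.
have [[Us Ust] [Vs Vst] VU UVs [u0 [Uu0 Vu0 u0p u0w]]] := UV_factor.
set c := hform _ _ _; pose W := [set w | U w /\ V (casimir diag es w - c *: w)].
have [esS _ _] := es_dual.
have Vcas w : V w -> V (casimir diag es w).
  move=> hw; apply: (subspace_sum Vs) => e /esS[e1 e2].
  by apply: (Vst) => //; apply: (Vst).
have Wu0 : W u0.
  split=> //; exact: (highest_weight_casimir diag_bil diag_bracket Vs Vst u0p u0w es_dual).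
have Wsub : is_g0_submodule form d x W.
  split; first split.
  - split; first exact: Us.1.
    have -> : casimir diag es 0 - c *: 0 = 0.
      rewrite scaler0 subr0 /casimir big1 // => e _.
      by rewrite !(bil0r diag_bil).
    exact: Vs.1.
  - move=> a w1 w2 [Uu Vu] [Uv Vv]; split; first exact: Us.2.
    rewrite casimir_diag_linear; have := Vs.2 a _ _ Vu Vv; congr V.
    move: (casimir _ es w1) (casimir _ es w2) => t1 t2.
    by rewrite scalerBr scalerDr opprD addrACA !scalerA mulrC.
  - move=> X w X0 [Uw Vw]; split; first exact: (Ust).
    rewrite -(casimir_comm diag_bil diag_bracket w es_dual X0).
    by rewrite -(bilZr diag_bil) -(bilBr diag_bil); apply: (Vst).
have VW : V `<=` W.
  move=> w Vw; split; first exact: VU.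
  apply: (subspaceD Vs); first exact: Vcas.
  by rewrite -scaleNr; apply: (subspaceZ Vs).
case: (UVs W Wsub VW); first by move=> w [].
- by move=> h1; case: Vu0; apply: h1.
- by move=> h1 Uu; case: (h1 _ Uu).
Qed.

Theorem dirac_sq_factor u : U u ->
  V (dirac d x (dirac d x u)
     - (2%:R * (hform form (mu + rho_of Dp true + 2%:R *: rho Dp) (mu + rho_of Dp true)
                - hform form (Lambda + 2%:R *: rho Dp) Lambda)) *: u).
Proof.
move=> Uu; have [_ [Vs _] _ _ _] := UV_factor.
have -> : hform form (mu + rho_of Dp true + 2%:R *: rho Dp) (mu + rho_of Dp true)
    = hform form (mu + 2%:R *: rho_of Dp false) mu - cO.
  exact: (symmetric_form_shift hformDl hformZl hformC).
rewrite dirac_sq -scalerA -scalerBr; apply: (subspaceZ Vs).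
have := casimir_factor Uu; congr V.
by rewrite -addrA -opprD -scalerDl -/cM; congr (_ - _ *: _); ring.
Qed.

End Tensor.
End DualBases.
End RootTheory.

Definition root_multiplicity_free (R : realType) (g : lieSuperalgebra R[i])
    (h : {vspace g}) : Prop :=
  (forall (alpha : hdual h) X Y, alpha != 0 -> X \in rootspace alpha ->
     Y \in rootspace alpha -> X != 0 -> exists c, Y = c *: X) /\
  (forall X, X \in gr g true -> {in h, forall H, bracket H X = 0} -> X = 0).

Lemma dirac_sq_composition_factor (R : realType) (g : lieSuperalgebra R[i])
    (form : g -> g -> R[i]) (h : {vspace g}) (h_cartan : cartan_subalgebra h)
    (form_inv : invariant_form form) (form_nd : nondegenerate form)
    (h_mult : root_multiplicity_free h)
    (Dp : set (hdual h)) (Dp_positive : positive_system Dp)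
    (N : nat) (d x : N.-tuple g)
    (d_basis : basis_of (nplus_odd Dp) d)
    (x_basis : basis_of (nminus_odd Dp) x)
    (dx_dual : forall i j : 'I_N,
       Bform form (tnth d i) (tnth x j) = 2%:R^-1 * (i == j)%:R)
    (M : supermodule g) (Lambda : hdual h)
    (M_hw : highest_weight_module Dp M Lambda)
    (T : tensor_product M {mpoly R[i][N]})
    (mu : hdual h) (U V : set T)
    (UV_factor : composition_factor form d x Dp mu U V) :
  forall u, U u ->
    V (dirac d x (dirac d x u)
       - (2%:R * (hform form (mu + rho_of Dp true + 2%:R *: rho Dp)
                             (mu + rho_of Dp true)
                  - hform form (Lambda + 2%:R *: rho Dp) Lambda)) *: u).
Proof.
have [line zero] := h_mult; have [v0 [_ v0_pos v0_wt v0_gen]] := M_hw.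
have [hs hhs] := cartan_dual_pair h_cartan form_inv form_nd line zero Dp_positive.
have rp := root_pairs_dual h_cartan form_inv form_nd line Dp false.
have es_dual := gr_dual_pair zero Dp_positive (z := false) hhs rp.
move=> u Uu.
exact: (dirac_sq_factor h_cartan form_inv form_nd line zero Dp_positive
  d_basis x_basis dx_dual es_dual v0_pos v0_wt v0_gen UV_factor Uu).
Qed.

(** * Supermatrices *)

Section Supertrace.
Variables (K : fieldType) (p q : nat).
Implicit Types A B C : 'M[K]_(p + q).

Lemma strace_linear : linear (@strace K p q : 'M[K]_(p + q) -> K^o).
Proof.
by move=> a A B; rewrite /strace /ulsubmx /drsubmx !linearP /= opprD addrACA scalerBr.
Qed.

Lemma straceD A B : strace (A + B) = strace A + strace B.
Proof. by have := strace_linear 1 A B; rewrite !scale1r. Qed.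

Lemma strace0 : strace (0 : 'M[K]_(p + q)) = 0.
Proof. by apply: (addrI (strace (0 : 'M[K]_(p + q)))); rewrite -straceD !addr0. Qed.

Lemma straceZ a A : strace (a *: A) = a * strace A.
Proof. by have := strace_linear a A 0; rewrite strace0 !addr0. Qed.

Lemma straceN A : strace (- A) = - strace A.
Proof. by rewrite -scaleN1r straceZ mulN1r. Qed.

Lemma strace_mul A B : strace (A *m B) =
  \tr (ulsubmx A *m ulsubmx B) + \tr (ursubmx A *m dlsubmx B)
  - (\tr (dlsubmx A *m ursubmx B) + \tr (drsubmx A *m drsubmx B)).
Proof.
rewrite -{1}(submxK A) -{1}(submxK B) mulmx_block /strace.
by rewrite block_mxKul block_mxKdr !mxtraceD.
Qed.

Lemma strace_comm i j A B : mx_parity i A -> mx_parity j B ->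
  strace (A *m B) = (-1) ^+ (i && j) * strace (B *m A).
Proof.
rewrite !strace_mul; case: i; case: j => /= -[-> ->] [-> ->];
  rewrite ?mul0mx ?mulmx0 ?linear0 ?addr0 ?add0r ?expr0 ?expr1 ?mul1r ?subr0 ?mulr0 ?mulN1r //.
- by rewrite opprB mxtrace_mulC [X in _ - X]mxtrace_mulC.
- by rewrite mxtrace_mulC [X in _ - X]mxtrace_mulC.
Qed.

Lemma strace_parity i j A B : mx_parity i A -> mx_parity j B -> i != j ->
  strace (A *m B) = 0.
Proof.
rewrite !strace_mul; case: i; case: j => //= -[-> ->] [-> ->] _;
  by rewrite ?mul0mx ?mulmx0 ?linear0 !addr0 subr0.
Qed.

Lemma mx_parityM i j A B : mx_parity i A -> mx_parity j B ->
  mx_parity (i (+) j) (A *m B).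
Proof.
rewrite -{2}(submxK A) -{2}(submxK B) mulmx_block.
by case: i; case: j => /= -[-> ->] [-> ->];
  rewrite ?block_mxKul ?block_mxKur ?block_mxKdl ?block_mxKdr
    ?mul0mx ?mulmx0 ?addr0.
Qed.

Lemma strace_invariant (g : lieSuperalgebra K) (phi : g -> 'M[K]_(p + q))
    (form : g -> g -> K) (c : K) :
  linear phi -> (forall i X, X \in gr g i -> mx_parity i (phi X)) ->
  (forall i j X Y, X \in gr g i -> Y \in gr g j -> phi (bracket X Y) =
     phi X *m phi Y - (-1) ^+ (i && j) *: (phi Y *m phi X)) ->
  (forall X Y, form X Y = c * strace (phi X *m phi Y)) ->
  invariant_form form.
Proof.
move=> lphi par brk formE.
have bb := bracket_bil g.
have fb : bilinear_fun (form : g -> g -> K^o).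
  split=> [Z a X Y|X a Y Z]; rewrite !formE lphi.
    by rewrite mulmxDl -scalemxAl straceD straceZ mulrDr mulrCA.
  by rewrite mulmxDr -scalemxAr straceD straceZ mulrDr mulrCA.
split=> // [i j X Y hX hY ij|i j X Y hX hY|X Y Z].
- by rewrite formE (strace_parity (par _ _ hX) (par _ _ hY) ij) mulr0.
- by rewrite !formE (strace_comm (par _ _ hX) (par _ _ hY)) mulrCA.
elim/gr_ind: X => [X X' h1 h2|i X hX].
  by rewrite (bilDl bb) !(bilDl fb) h1 h2.
elim/gr_ind: Y => [Y Y' h1 h2|j Y hY].
  by rewrite (bilDl bb) (bilDr bb) (bilDl fb) (bilDr fb) h1 h2.
elim/gr_ind: Z => [Z Z' h1 h2|k Z hZ].
  by rewrite (bilDr bb) !(bilDr fb) h1 h2.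
rewrite !formE (brk _ _ _ _ hX hY) (brk _ _ _ _ hY hZ); congr (_ * _).
rewrite mulmxBl mulmxBr -scalemxAl -scalemxAr !straceD !straceN !straceZ !mulmxA.
congr (_ - _).
have hXZ := mx_parityM (par _ _ hX) (par _ _ hZ).
rewrite -[in LHS]mulmxA (strace_comm (par _ _ hY) hXZ) mulrA; congr (_ * _).
(* The signs agree because ij + j(i + k) = jk modulo 2. *)
by case: i {hX hXZ}; case: j {hY}; case: k {hZ} => /=; rewrite ?expr0 ?expr1 ?mulrN1 ?opprK ?mulr1.
Qed.

End Supertrace.

(** Splitting the standard rows gives a finite spanning list of common eigenrows; [fullrankfun]
    extracts a basis from it, whose vectors are the rows of P. *)
Lemma eigenrow_basis (K : fieldType) (n : nat) (J : Type) (A : J -> 'M[K]_n) :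
  (forall v : 'rV_n, sum_of (fun u => forall j, exists c, u *m A j = c *: u) v) ->
  exists2 P : 'M_n, P \in unitmx &
    forall j i k, i != k -> (P *m A j *m invmx P) i k = 0.
Proof.
move=> hA; have : forall i : 'I_n, exists s : seq 'rV[K]_n,
    delta_mx 0 i = \sum_(u <- s) u /\
    {in s, forall u, forall j, exists c, u *m A j = c *: u}.
  by move=> i; case: (hA (delta_mx 0 i)) => s; exists s.
move=> /boolp.choice[s sP].
pose S := flatten [seq s i | i <- enum 'I_n].
have SP u : u \in S -> forall j, exists c, u *m A j = c *: u.
  by move=> /flattenP[_ /mapP[i _ ->] us]; have [_] := sP i; apply.
pose B := \matrix_(k < size S) S`_k.
have Bfull : row_full B.
  rewrite -sub1mx; apply/row_subP => i; rewrite rowE mulmx1.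
  have [-> _] := sP i; rewrite big_seq summx_sub // => u us.
  have uS : u \in S.
    by apply/flattenP; exists (s i) => //; apply/map_f; rewrite mem_enum.
  have := row_sub (Ordinal (etrans (index_mem u S) uS)) B.
  by rewrite rowK nth_index.
pose P := rowsub (fullrankfun Bfull) B.
have Pu : P \in unitmx by apply: fullrowsub_unit.
exists P => // j i k ik.
have rowP i' : row i' P = S`_(fullrankfun Bfull i') by rewrite row_rowsub rowK.
have [c hc] : exists c, row i P *m A j = c *: row i P.
  by rewrite rowP; apply: SP; apply: mem_nth.
have -> : (P *m A j *m invmx P) i k = row i (P *m A j *m invmx P) 0 k by rewrite [RHS]mxE.
rewrite !row_mul hc -scalemxAl -row_mul mulmxV // row1 !mxE eq_sym (negPf ik) /=.
exact: mulr0.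
Qed.

(** * Simultaneous diagonalisation of a Cartan subalgebra on row vectors *)

Section WeightRows.
Variables (R : realType) (g : lieSuperalgebra R[i]) (h : {vspace g}).
Hypothesis h_cartan : cartan_subalgebra h.
Variables (n : nat) (psi : g -> 'M[R[i]]_n) (S : {vspace g}).
Hypothesis psi_linear : linear psi.
Hypothesis hS : (h <= S)%VS.
Hypothesis S_wt : {in S, forall X, sum_of (fun Y => Y \in S /\ weight_vector h Y) X}.
Hypothesis psi_bracket : {in h & S, forall H X,
  psi (bracket H X) = psi H *m psi X - psi X *m psi H}.

Definition weight_row (v : 'rV[R[i]]_n) : Prop :=
  forall H : subvs_of h, exists c, v *m psi (vsval H) = c *: v.

Let psiD X Y : psi (X + Y) = psi X + psi Y.
Proof. by have := psi_linear 1 X Y; rewrite !scale1r. Qed.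

Let psi0 : psi 0 = 0.
Proof. by apply: (addrI (psi 0)); rewrite -psiD !addr0. Qed.

Let psiZ a X : psi (a *: X) = a *: psi X.
Proof. by have := psi_linear a X 0; rewrite psi0 !addr0. Qed.

Lemma weight_rowZ a v : weight_row v -> weight_row (a *: v).
Proof.
move=> hv H; have [c hc] := hv H; exists c.
by rewrite -scalemxAl hc !scalerA mulrC.
Qed.

(** Because matrices act on rows from the right, a vector of weight alpha shifts the eigenvalue c to
    c - alpha(H). *)
Lemma weight_row_mul v X : X \in S -> weight_vector h X -> weight_row v ->
  weight_row (v *m psi X).
Proof.
move=> XS [alpha /rootspaceP Xa] hv H; have [c hc] := hv H; exists (c - alpha H).
have := psi_bracket (subvsP H) XS; rewrite Xa psiZ => E.
have -> : v *m psi X *m psi (vsval H)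
    = v *m (psi (vsval H) *m psi X - alpha H *: psi X).
  by rewrite E opprB addrC subrK mulmxA.
by rewrite mulmxBr mulmxA hc -scalemxAl -scalemxAr scalerBl.
Qed.

Lemma weight_row_exists : (0 < n)%N -> exists2 v : 'rV_n, v != 0 & weight_row v.
Proof.
move=> n0.
have [|v v0 /allP vP] := @common_eigenvector R[i] n [seq psi H | H <- vbasis h] n0.
  move=> _ _ /mapP[H /vbasis_mem Hh ->] /mapP[H' /vbasis_mem Hh' ->].
  have := psi_bracket Hh (subvP hS _ Hh').
  case: h_cartan => _ hc _ _; rewrite (hc H H') // psi0 => /esym/eqP.
  by rewrite subr_eq0 => /eqP.
exists v => // H; rewrite (coord_vbasis (subvsP H)).
have : forall i : 'I_(\dim h), exists c, v *m psi (vbasis h)`_i = c *: v.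
  move=> i; apply/sub_rVP/vP/map_f/mem_nth; by rewrite size_tuple.
move=> /boolp.choice[c hc].
exists (\sum_i coord (vbasis h) i (vsval H) * c i).
rewrite (big_morph psi psiD psi0) mulmx_sumr scaler_suml; apply: eq_bigr => i _.
by rewrite psiZ -scalemxAr hc scalerA.
Qed.

(** The long hypothesis is an irreducibility condition: a nonzero space of rows stable under S and
    under all matrices commuting with h is everything. The span of the weight rows is such a space:
    commuting complex matrices share an eigenvector, and weight vectors of S permute weight rows up
    to shifts. *)
Lemma weight_rows : (0 < n)%N ->
  (forall E : 'rV[R[i]]_n -> Prop, (exists2 w, w != 0 & E w) ->
    (forall u v, E u -> E v -> E (u + v)) -> (forall a u, E u -> E (a *: u)) ->
    (forall X v, X \in S -> E v -> E (v *m psi X)) ->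
    (forall D v, {in h, forall H, D *m psi H = psi H *m D} -> E v -> E (v *m D)) ->
    forall v, E v) ->
  forall v, sum_of weight_row v.
Proof.
move=> n0; apply=> [|u v|a u|X v XS|D v hD].
- by have [w w0 hw] := weight_row_exists n0; exists w => //; apply: sum_of1.
- exact: sum_ofD.
- move: u; apply: sum_of_ind => [|u v|u hu].
  + by rewrite scaler0; apply: sum_of0.
  + by rewrite scalerDr; apply: sum_ofD.
  + by apply: sum_of1; apply: weight_rowZ.
- move: v; apply: sum_of_ind => [|u v|u hu].
  + by rewrite mul0mx; apply: sum_of0.
  + by rewrite mulmxDl; apply: sum_ofD.
  elim/sum_of_ind: {XS}(S_wt XS) => [|Y Z hY hZ|Y [YS Yw]].
  + by rewrite psi0 mulmx0; apply: sum_of0.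
  + by rewrite psiD mulmxDr; apply: sum_ofD.
  + by apply: sum_of1; apply: weight_row_mul.
- move: v; apply: sum_of_ind => [|u v|u hu].
  + by rewrite mul0mx; apply: sum_of0.
  + by rewrite mulmxDl; apply: sum_ofD.
  apply: sum_of1 => H; have [c hc] := hu H; exists c.
  by rewrite -mulmxA hD ?subvsP // mulmxA hc scalemxAl.
Qed.

End WeightRows.

Lemma row_transitive (K : fieldType) (m n : nat) (w : 'rV[K]_m) (v : 'rV[K]_n) :
  w != 0 -> exists B, w *m B = v.
Proof.
move=> /rV0Pn[i wi].
exists ((w 0 i)^-1 *: (delta_mx i 0 *m v)).
rewrite -scalemxAr mulmxA -colE; apply/rowP => j.
by rewrite !mxE big_ord1 !mxE mulKf.
Qed.

Lemma const_row_neq0 (K : fieldType) n : (0 < n)%N -> exists v : 'rV[K]_n, v != 0.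
Proof.
case: n => // n _; exists (const_mx 1); apply/eqP => /rowP/(_ 0)/eqP.
by rewrite !mxE oner_eq0.
Qed.

Definition diag2_mx (K : fieldType) p q (P0 : 'M[K]_p) (P1 : 'M[K]_q) : 'M[K]_(p + q) :=
  block_mx P0 0 0 P1.

Lemma diag2_mxM (K : fieldType) p q (A0 B0 : 'M[K]_p) (A1 B1 : 'M[K]_q) :
  diag2_mx A0 A1 *m diag2_mx B0 B1 = diag2_mx (A0 *m B0) (A1 *m B1).
Proof. by rewrite /diag2_mx mulmx_block !mulmx0 !mul0mx !addr0 !add0r. Qed.

Lemma diag2_mx_even (K : fieldType) p q (P0 : 'M[K]_p) (P1 : 'M[K]_q) :
  mx_parity false (diag2_mx P0 P1).
Proof. by rewrite /= block_mxKur block_mxKdl. Qed.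

Lemma mx_even_diag2 (K : fieldType) p q (A : 'M[K]_(p + q)) :
  mx_parity false A -> A = diag2_mx (ulsubmx A) (drsubmx A).
Proof. by case=> h1 h2; rewrite -{1}(submxK A) h1 h2. Qed.

Lemma diag2_mx_offdiag (K : fieldType) p q (P0 : 'M[K]_p) (P1 : 'M[K]_q) :
  (forall i j, i != j -> P0 i j = 0) -> (forall i j, i != j -> P1 i j = 0) ->
  forall i j, i != j -> diag2_mx P0 P1 i j = 0.
Proof.
move=> h0 h1 i j; rewrite /diag2_mx.
case: (split_ordP i) => k ->; case: (split_ordP j) => l ->;
  rewrite ?(block_mxEul, block_mxEur, block_mxEdl, block_mxEdr) ?mxE // => kl.
- by apply: h0; apply: contraNneq kl => ->.
- by apply: h1; apply: contraNneq kl => ->.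
Qed.

Section SuperDiagonalization.
Variables (R : realType) (g : lieSuperalgebra R[i]) (h : {vspace g}).
Hypothesis h_cartan : cartan_subalgebra h.
Variables (p q : nat) (phi : g -> 'M[R[i]]_(p + q)).
Hypotheses (p_gt0 : (0 < p)%N) (q_gt0 : (0 < q)%N).
Hypothesis phi_linear : linear phi.
Hypothesis phi_even : forall X, X \in gr g false -> mx_parity false (phi X).
Hypothesis phi_odd : forall X, X \in gr g true -> mx_parity true (phi X).
Hypothesis phi_bracket : forall H X, H \in gr g false ->
  phi (bracket H X) = phi H *m phi X - phi X *m phi H.
Hypothesis odd_ur : forall B, exists2 X, X \in gr g true & ursubmx (phi X) = B.
Hypothesis odd_dl : forall B, exists2 X, X \in gr g true & dlsubmx (phi X) = B.

Let h0 H : H \in h -> H \in gr g false. Proof. exact: h_even h_cartan H. Qed.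

(** The projections to the two parities commute with h, so a stable space contains a nonzero row of
    pure parity; odd elements with an arbitrary off-diagonal block carry it to all rows of the other
    parity, and from there back. *)
Lemma super_weight_rows v : sum_of (weight_row h phi) v.
Proof.
apply: (@weight_rows R g h h_cartan _ phi fullv phi_linear (subvf _)) => //.
- move=> X _; have := weight_span h_cartan X; apply: sum_of_sub => Y hY.
  by apply: sum_of1; rewrite memvf.
- by move=> H X Hh _; apply: phi_bracket; apply: h0.
- by rewrite addn_gt0 p_gt0.
move=> E [w w0 Ew] ED EZ EX EC.
have proj0 (u : 'rV_p) (u' : 'rV_q) : E (row_mx u u') -> E (row_mx u 0).
  move=> hE; have cD : {in h, forall H, (diag2_mx 1%:M 0) *m phi H = phi H *m (diag2_mx 1%:M 0)}.
    move=> H /h0/phi_even/mx_even_diag2->.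
    by rewrite !diag2_mxM mul1mx mulmx1 mul0mx mulmx0.
  have := EC _ _ cD hE.
  by rewrite mul_row_block !mulmx0 !mulmx1 !addr0.
have proj1 (u : 'rV_p) (u' : 'rV_q) : E (row_mx u u') -> E (row_mx 0 u').
  move=> hE; have cD : {in h, forall H, (diag2_mx 0 1%:M) *m phi H = phi H *m (diag2_mx 0 1%:M)}.
    move=> H /h0/phi_even/mx_even_diag2->.
    by rewrite !diag2_mxM mul1mx mulmx1 mul0mx mulmx0.
  have := EC _ _ cD hE.
  by rewrite mul_row_block !mulmx0 !mulmx1 !add0r.
have up (u : 'rV_p) (v1 : 'rV_q) : u != 0 -> E (row_mx u 0) -> E (row_mx 0 v1).
  move=> u0 Eu; have [B <-] := row_transitive v1 u0; have [X X1 <-] := odd_ur B.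
  have := EX X _ (memvf _) Eu; have [e1 e2] := phi_odd X1.
  by rewrite -{1}(submxK (phi X)) mul_row_block e1 e2 !mulmx0 !mul0mx !addr0.
have down (u : 'rV_q) (v1 : 'rV_p) : u != 0 -> E (row_mx 0 u) -> E (row_mx v1 0).
  move=> u0 Eu; have [B <-] := row_transitive v1 u0; have [X X1 <-] := odd_dl B.
  have := EX X _ (memvf _) Eu; have [e1 e2] := phi_odd X1.
  by rewrite -{1}(submxK (phi X)) mul_row_block e1 e2 !mulmx0 !mul0mx !add0r.
have [u0 u0n] := const_row_neq0 R[i] p_gt0; have [u1 u1n] := const_row_neq0 R[i] q_gt0.
have E01 : (forall v, E (row_mx v 0)) /\ (forall v, E (row_mx 0 v)).
  rewrite -(hsubmxK w) in w0 Ew.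
  have [l0|l0] := eqVneq (lsubmx w) 0.
    have r0 : rsubmx w != 0.
      by apply: contraNneq w0 => ->; rewrite l0 row_mx0.
    have E0 y : E (row_mx y 0) by apply: (down _ y r0); apply: proj1 Ew.
    by split=> // y; apply: (up _ y u0n).
  have E1 y : E (row_mx 0 y) by apply: (up _ y l0); apply: proj0 Ew.
  by split=> // y; apply: (down _ y u1n).
move=> y; rewrite -(hsubmxK y) -[lsubmx y]addr0 -[rsubmx y]add0r -add_row_mx.
by apply: ED; [apply: E01.1|apply: E01.2].
Qed.

(** h acts by block diagonal matrices, so the two halves of a weight row are weight rows of the
    blocks, and each block is diagonalised separately by an even change of basis. *)
Lemma super_diagonalization : exists (P0 : 'M[R[i]]_p) (P1 : 'M[R[i]]_q),
  [/\ P0 \in unitmx, P1 \in unitmx & {in h, forall H i j, i != j ->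
    (diag2_mx P0 P1 *m phi H *m diag2_mx (invmx P0) (invmx P1)) i j = 0}].
Proof.
have hl (v : 'rV_p) : sum_of (fun u => forall H : subvs_of h,
    exists c, u *m ulsubmx (phi (vsval H)) = c *: u) v.
  rewrite -[v](row_mxKl v (0 : 'rV_q)).
  elim/sum_of_ind: {v}(row_mx v 0) / (super_weight_rows (row_mx v 0)) => [|u v|u hu].
  - by rewrite linear0; apply: sum_of0.
  - by rewrite linearD; apply: sum_ofD.
  apply: sum_of1 => H; have [c hc] := hu H; exists c.
  have := hc; rewrite {1}(mx_even_diag2 (phi_even (h0 (subvsP H)))) -{1}(hsubmxK u).
  rewrite mul_row_block !mulmx0 addr0 add0r -[u in RHS]hsubmxK scale_row_mx.
  by case/eq_row_mx.
have hr (v : 'rV_q) : sum_of (fun u => forall H : subvs_of h,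
    exists c, u *m drsubmx (phi (vsval H)) = c *: u) v.
  rewrite -[v](row_mxKr (0 : 'rV_p) v).
  elim/sum_of_ind: {v}(row_mx 0 v) / (super_weight_rows (row_mx 0 v)) => [|u v|u hu].
  - by rewrite linear0; apply: sum_of0.
  - by rewrite linearD; apply: sum_ofD.
  apply: sum_of1 => H; have [c hc] := hu H; exists c.
  have := hc; rewrite {1}(mx_even_diag2 (phi_even (h0 (subvsP H)))) -{1}(hsubmxK u).
  rewrite mul_row_block !mulmx0 addr0 add0r -[u in RHS]hsubmxK scale_row_mx.
  by case/eq_row_mx.
have [P0 P0u D0] := eigenrow_basis hl; have [P1 P1u D1] := eigenrow_basis hr.
exists P0, P1; split=> // H Hh.
rewrite (mx_even_diag2 (phi_even (h0 Hh))) !diag2_mxM.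
apply: diag2_mx_offdiag => i j ij.
  by have := D0 (vsproj h H) _ _ ij; rewrite vsprojK.
by have := D1 (vsproj h H) _ _ ij; rewrite vsprojK.
Qed.

End SuperDiagonalization.

(** * Special and general linear superalgebras *)

Lemma offdiag_mull (K : comNzRingType) n (D X : 'M[K]_n) i j :
  (forall i j, i != j -> D i j = 0) -> (D *m X) i j = D i i * X i j.
Proof.
move=> hD; rewrite mxE (bigD1 i) //= big1 ?addr0 // => k ki.
by rewrite hD ?mul0r // eq_sym.
Qed.

Lemma offdiag_mulr (K : comNzRingType) n (D X : 'M[K]_n) i j :
  (forall i j, i != j -> D i j = 0) -> (X *m D) i j = D j j * X i j.
Proof.
move=> hD; rewrite mxE (bigD1 j) //= big1 ?addr0 1?mulrC // => k ki.
by rewrite hD ?mulr0.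
Qed.

Lemma odd_diag (K : fieldType) p q (A : 'M[K]_(p + q)) i :
  mx_parity true A -> A i i = 0.
Proof.
case=> h1 h2; rewrite -(submxK A) h1 h2.
by case: (split_ordP i) => k ->; rewrite ?block_mxEul ?block_mxEdr mxE.
Qed.

Lemma mx_parityZD (K : fieldType) p q z a (A B : 'M[K]_(p + q)) :
  mx_parity z A -> mx_parity z B -> mx_parity z (a *: A + B).
Proof.
by case: z => -[h1 h2] [h3 h4]; rewrite /mx_parity /ulsubmx /ursubmx /dlsubmx /drsubmx
  !linearP /= -?/(ulsubmx _) -?/(ursubmx _) -?/(dlsubmx _) -?/(drsubmx _) h1 h2 h3 h4
  !scaler0 !addr0.
Qed.

Lemma mx_parity_disjoint (K : fieldType) p q z (A : 'M[K]_(p + q)) :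
  mx_parity z A -> mx_parity (~~ z) A -> A = 0.
Proof.
by case: z => -[h1 h2] [h3 h4]; rewrite -(submxK A) h1 h2 h3 h4; apply: block_mx0.
Qed.

(** If X has nonzero coordinate j, subtracting a multiple of X from Y kills that coordinate. Any
    other coordinate of the difference that were nonzero would be proportional to the j-th one,
    hence zero. The space V allows the criterion to be applied to one parity only. *)
Lemma root_line_coords (R : realType) (g : lieSuperalgebra R[i]) (h V : {vspace g})
    (J : Type) (c : J -> g -> R[i]) :
  (forall j a X Y, c j (a *: X + Y) = a * c j X + c j Y) ->
  {in V, forall X, (forall j, c j X = 0) -> X = 0} ->
  (forall (alpha : hdual h) j k X Y, alpha != 0 -> X \in V -> Y \in V ->
     X \in rootspace alpha -> Y \in rootspace alpha -> c j X != 0 -> c k Y != 0 ->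
     exists s, {in V, forall Z, c k Z = s * c j Z}) ->
  forall (alpha : hdual h) X Y, alpha != 0 -> X \in V -> Y \in V ->
    X \in rootspace alpha -> Y \in rootspace alpha -> X != 0 -> exists s, Y = s *: X.
Proof.
move=> cL c0 cP alpha X Y a0 XV YV Xa Ya X0.
have nz Z : Z \in V -> Z != 0 -> exists j, c j Z != 0.
  move=> ZV Z0; apply: contrapT => /forallNP hN; move/negP: Z0; apply; apply/eqP/c0 => // j.
  by apply/eqP; have /negP := hN j; rewrite negbK.
have [j jX] := nz _ XV X0; exists (c j Y / c j X); apply/eqP; rewrite -subr_eq0.
have ZV : Y - c j Y / c j X *: X \in V by rewrite rpredB // rpredZ.
apply/negPn/negP => Z0; have [k kZ] := nz _ ZV Z0.
have Za : Y - c j Y / c j X *: X \in rootspace alpha by rewrite rpredB // rpredZ.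
have [s hs] := cP _ j k _ _ a0 XV ZV Xa Za jX kZ.
move/negP: kZ; apply; rewrite hs // addrC -scaleNr cL mulNr mulrAC -mulrA divff //.
by rewrite mulr1 addNr mulr0.
Qed.

Section LinearFamily.
Variables (R : realType) (g : lieSuperalgebra R[i]) (h : {vspace g}).
Hypothesis h_cartan : cartan_subalgebra h.
Variables (p q : nat) (L : set 'M[R[i]]_(p + q)) (phi : {linear g -> 'M[R[i]]_(p + q)}).
Hypotheses (p_gt0 : (0 < p)%N) (q_gt0 : (0 < q)%N).
Hypothesis phi_iso : mx_iso L phi.

Let bb := bracket_bil g.

Lemma iso_inj : injective phi. Proof. by case: phi_iso. Qed.

Lemma iso_eq0 X : phi X = 0 -> X = 0.
Proof. by move=> h0; apply: iso_inj; rewrite linear0. Qed.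

Lemma iso_parity z X : X \in gr g z -> mx_parity z (phi X).
Proof. by case: phi_iso => _ _ + _; apply. Qed.

Lemma iso_even_bracket H X : H \in gr g false ->
  phi (bracket H X) = phi H *m phi X - phi X *m phi H.
Proof.
move=> H0; elim/gr_ind: X => [X Y hX hY|z X hX].
  by rewrite (bilDr bb) !(linearD phi) /= hX hY mulmxDr mulmxDl opprD addrACA.
by case: phi_iso => _ _ _ /(_ _ _ _ _ H0 hX) -> /=; rewrite expr0 scale1r.
Qed.

Lemma iso_gr z X : mx_parity z (phi X) -> X \in gr g z.
Proof.
have [X0 [X1 [h0 h1 ->]]] := gr_split X; rewrite linearD /=.
have q0 := iso_parity h0; have q1 := iso_parity h1.
case: z => hX.
  suff -> : X0 = 0 by rewrite add0r.
  apply: iso_eq0; apply: (@mx_parity_disjoint _ _ _ true) => //.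
  have -> : phi X0 = (-1) *: phi X1 + (phi X0 + phi X1).
    by rewrite scaleN1r addrCA addNr addr0.
  exact: mx_parityZD.
suff -> : X1 = 0 by rewrite addr0.
apply: iso_eq0; apply: (@mx_parity_disjoint _ _ _ false) => //.
have -> : phi X1 = (-1) *: phi X0 + (phi X0 + phi X1).
  by rewrite scaleN1r addrA addNr add0r.
exact: mx_parityZD.
Qed.

Lemma iso_onto z A : L A -> mx_parity z A -> exists2 X, X \in gr g z & phi X = A.
Proof.
case: phi_iso => _ /(_ A)[_ hL] _ _ /hL[X XA] hA; exists X => //.
by apply: iso_gr; rewrite XA.
Qed.

Section Conjugate.
Variables (P0 : 'M[R[i]]_p) (P1 : 'M[R[i]]_q).
Hypotheses (P0u : P0 \in unitmx) (P1u : P1 \in unitmx).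
Local Notation P := (diag2_mx P0 P1).
Local Notation Q := (diag2_mx (invmx P0) (invmx P1)).
Hypothesis hP : {in h, forall H i j, i != j -> (P *m phi H *m Q) i j = 0}.

Definition conj_mx X := P *m phi X *m Q.

Lemma diag2_mxV : P *m Q = 1%:M.
Proof. by rewrite diag2_mxM !mulmxV // scalar_mx_block. Qed.

Lemma diag2_Vmx : Q *m P = 1%:M.
Proof. by rewrite diag2_mxM !mulVmx // scalar_mx_block. Qed.

Lemma conj_mxK X : Q *m conj_mx X *m P = phi X.
Proof. by rewrite /conj_mx !mulmxA diag2_Vmx mul1mx -mulmxA diag2_Vmx mulmx1. Qed.

Lemma conj_mx_eq0 X : conj_mx X = 0 -> X = 0.
Proof. by move=> h0; apply: iso_eq0; rewrite -conj_mxK h0 mulmx0 mul0mx. Qed.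

Lemma conj_mxP a X Y : conj_mx (a *: X + Y) = a *: conj_mx X + conj_mx Y.
Proof. by rewrite /conj_mx linearP mulmxDr mulmxDl -scalemxAr -scalemxAl. Qed.

Lemma conj_mxZ a X : conj_mx (a *: X) = a *: conj_mx X.
Proof. by rewrite /conj_mx linearZ /= -scalemxAr -scalemxAl. Qed.

Lemma conj_mx_bracket H X : H \in gr g false ->
  conj_mx (bracket H X) = conj_mx H *m conj_mx X - conj_mx X *m conj_mx H.
Proof.
move=> H0; rewrite /conj_mx iso_even_bracket //; move: (phi H) (phi X) => A B.
move: P Q diag2_Vmx => P' Q' PQ; rewrite mulmxBr mulmxBl.
by congr (_ - _); rewrite !mulmxA -(mulmxA _ Q' P') PQ mulmx1.
Qed.

Lemma conj_mx_entry H X i j : H \in h ->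
  conj_mx (bracket H X) i j = (conj_mx H i i - conj_mx H j j) * conj_mx X i j.
Proof.
move=> Hh; rewrite conj_mx_bracket ?(h_even h_cartan) //.
have hA : forall i j, i != j -> conj_mx H i j = 0 := hP Hh.
move: (conj_mx H) hA (conj_mx X) => A hA B; rewrite mulrBl mxE [X in _ + X]mxE.
by rewrite (offdiag_mull B i j hA) (offdiag_mulr B i j hA).
Qed.

Lemma conj_mx_parity z X : X \in gr g z -> mx_parity z (conj_mx X).
Proof.
move=> hX; have := mx_parityM (diag2_mx_even P0 P1) (iso_parity hX).
by move/mx_parityM/(_ (diag2_mx_even (invmx P0) (invmx P1))); rewrite addbF.
Qed.

(** Diagonal matrices commute with the diagonal image of h, and h is its own centraliser in g_0. *)
Lemma conj_mx_diag_cartan X : X \in gr g false ->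
  (forall i j, i != j -> conj_mx X i j = 0) -> X \in h.
Proof.
move=> X0 od; case: h_cartan => _ _ hc _; apply: hc => // H Hh; apply: conj_mx_eq0.
apply/matrixP => a b; rewrite conj_mx_entry // [RHS]mxE.
move: (conj_mx H) (conj_mx X) od => A B od.
by have [->|ab] := eqVneq a b; [rewrite subrr mul0r|rewrite od ?mulr0].
Qed.

Lemma conj_mx_root (alpha : hdual h) X i j (H : subvs_of h) : X \in rootspace alpha ->
  conj_mx X i j != 0 ->
  alpha H = conj_mx (vsval H) i i - conj_mx (vsval H) j j.
Proof.
move=> /rootspaceP Xa Xij; have := conj_mx_entry X i j (subvsP H).
by rewrite Xa conj_mxZ mxE => /(mulIf Xij).
Qed.

End Conjugate.

Hypothesis L_strace0 : forall A, strace A = 0 -> L A.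
Hypothesis L_shift : forall A, exists t, L (A + t%:M).

(** Up to scalars, which do not affect brackets, h contains all conjugated units E_ii. Their values
    [a = i] - [b = i] on the entry (a, b) determine an off-diagonal position, and odd matrices have
    no diagonal entries. *)
Lemma linear_family_mult : root_multiplicity_free h.
Proof.
have str_odd (A : 'M[R[i]]_(p + q)) : mx_parity true A -> strace A = 0.
  by rewrite /strace => -[-> ->]; rewrite !mxtrace0 subr0.
have [P0 [P1 [P0u P1u hP]]] : exists (P0 : 'M[R[i]]_p) (P1 : 'M[R[i]]_q),
  [/\ P0 \in unitmx, P1 \in unitmx & {in h, forall H i j, i != j ->
    (diag2_mx P0 P1 *m phi H *m diag2_mx (invmx P0) (invmx P1)) i j = 0}].
  apply: super_diagonalization => //; first exact: linearP.
  - by move=> X; apply: iso_parity.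
  - by move=> X; apply: iso_parity.
  - exact: iso_even_bracket.
  - move=> B; have hB : mx_parity true (block_mx 0 B 0 0 : 'M[R[i]]_(p + q)).
      by rewrite /= block_mxKul block_mxKdr.
    have [X X1 XB] := iso_onto (L_strace0 (str_odd _ hB)) hB; exists X => //.
    by rewrite XB block_mxKur.
  - move=> B; have hB : mx_parity true (block_mx 0 0 B 0 : 'M[R[i]]_(p + q)).
      by rewrite /= block_mxKul block_mxKdr.
    have [X X1 XB] := iso_onto (L_strace0 (str_odd _ hB)) hB; exists X => //.
    by rewrite XB block_mxKdl.
pose f := conj_mx P0 P1.
have Dex i : exists D, D \in h /\ exists t, f D = delta_mx i i + t%:M.
  have [t Lt] := L_shift (diag2_mx (invmx P0) (invmx P1) *m delta_mx i i *m diag2_mx P0 P1).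
  have dpar : mx_parity false (delta_mx i i : 'M[R[i]]_(p + q)).
    split; apply/matrixP => k l; rewrite !mxE;
      case: eqP => [e1|//]; case: eqP => [e2|//];
      by move/eqP: (etrans e1 (esym e2)); rewrite ?eq_lrshift ?eq_rlshift.
  have par : mx_parity false
      (diag2_mx (invmx P0) (invmx P1) *m delta_mx i i *m diag2_mx P0 P1 + t%:M).
    rewrite -[_ *m diag2_mx P0 P1]scale1r; apply: mx_parityZD.
      have h1 := mx_parityM (diag2_mx_even (invmx P0) (invmx P1)) dpar.
      exact: (mx_parityM h1 (diag2_mx_even P0 P1)).
    by rewrite scalar_mx_block; apply: diag2_mx_even.
  have [D D0 DE] := iso_onto Lt par.
  have PQ := diag2_mxV P0u P1u.
  have fD : f D = delta_mx i i + t%:M.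
    rewrite /f /conj_mx DE mulmxDr mulmxDl !mulmxA PQ mul1mx -mulmxA PQ mulmx1.
    by rewrite mul_mx_scalar -scalemxAl PQ scalemx1.
  exists D; split; last by exists t.
  apply: (conj_mx_diag_cartan P0u P1u hP) => // a b ab.
  rewrite -/f fD !mxE (negPf ab) mulr0n addr0.
  by case: eqP => [<-|//]; rewrite eq_sym (negPf ab).
have Dwt i D t X a b lam : f D = delta_mx i i + t%:M -> D \in h ->
    bracket D X = lam *: X -> f X a b != 0 -> lam = (a == i)%:R - (b == i)%:R.
  move=> fD Dh DX Xab; have := conj_mx_entry P0u P1u hP X a b Dh.
  rewrite DX conj_mxZ mxE -/f => /(mulIf Xab) ->.
  by rewrite fD !mxE !eqxx !mulr1n !andbb opprD addrACA subrr addr0.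
split.
  move=> alpha X Y a0; apply: (@root_line_coords _ _ _ fullv ('I_(p + q) * 'I_(p + q))%type
    (fun ij X => f X ij.1 ij.2) _ _ _ alpha X Y a0 (memvf _) (memvf _)).
  - move=> [i j] a {}X {}Y /=; rewrite /f conj_mxP.
    by move: (conj_mx _ _ X) (conj_mx _ _ Y) => A B; rewrite !mxE.
  - move=> {}X _ hX; apply: (conj_mx_eq0 P0u P1u); apply/matrixP => i j.
    by rewrite -/f (hX (i, j)) mxE.
  move=> {}alpha [a b] [a' b'] {}X {}Y {}a0 _ _ Xa Ya /= fX fY.
  have ab : a != b.
    apply: contraNneq a0 => ab; rewrite ab in fX; apply/eqP/lfunP => H.
    by rewrite zero_lfunE (conj_mx_root P0u P1u hP H Xa fX) subrr.
  have key i : ((a == i)%:R - (b == i)%:R = (a' == i)%:R - (b' == i)%:R :> R[i]).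
    have [D [Dh [t fD]]] := Dex i.
    rewrite -(Dwt _ _ _ _ _ _ _ fD Dh (rootspace_ad Xa Dh) fX).
    by rewrite -(Dwt _ _ _ _ _ _ _ fD Dh (rootspace_ad Ya Dh) fY).
  suff [-> ->] : a' = a /\ b' = b by exists 1 => Z _; rewrite mul1r.
  (* A difference of two bits equals 1 only if the first is 1; the case -1 is excluded in
     characteristic zero. *)
  have b2 (c e : bool) : 1 = c%:R - e%:R :> R[i] -> c.
    case: c e => [] [] //= /eqP.
      by rewrite sub0r -addr_eq0 -(natrD _ 1 1) pnatr_eq0.
    by rewrite subr0 oner_eq0.
  split; apply/eqP.
    by have := key a; rewrite eqxx eq_sym (negPf ab) subr0 => /b2.
  have := key b; rewrite eqxx (negPf ab) sub0r => /(congr1 -%R).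
  by rewrite opprK opprB => /b2.
move=> X X1 hX; apply: (conj_mx_eq0 P0u P1u); apply/matrixP => a b; rewrite [RHS]mxE.
apply/eqP/negPn/negP => fX.
have ab : a = b.
  apply/eqP; have [D [Dh [t fD]]] := Dex b.
  have D0 : bracket D X = 0 *: X by rewrite scale0r hX.
  have := Dwt _ _ _ _ _ _ _ fD Dh D0 fX; rewrite eqxx => /esym/eqP.
  by rewrite subr_eq0; case: (a == b) => //; rewrite eq_sym oner_eq0.
by move/negP: fX; apply; rewrite ab (odd_diag _ (conj_mx_parity P0 P1 X1)).
Qed.

End LinearFamily.

Lemma strace_trace (K : fieldType) p q (B : 'M[K]_(p + q)) :
  strace B = \tr (diag2_mx 1%:M (- 1%:M) *m B).
Proof.
rewrite -(submxK B) /diag2_mx mulmx_block !mul0mx !mulNmx !mul1mx !addr0 !add0r.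
by rewrite mxtrace_block /strace block_mxKul block_mxKdr linearN.
Qed.

Lemma strace_nondegenerate (K : fieldType) p q (A : 'M[K]_(p + q)) :
  (forall B, strace (A *m B) = 0) -> A = 0.
Proof.
move=> hA.
pose s : 'M[K]_(p + q) := diag2_mx 1%:M (- 1%:M).
have trE : forall B, strace B = \tr (s *m B) := @strace_trace K p q.
have sA : s *m A = 0.
  apply/matrixP => i j; rewrite [RHS]mxE -(hA (delta_mx j i)) trE mulmxA.
  move: (s *m A) => B; rewrite /mxtrace (bigD1 i) //= big1 => [|k ki].
    rewrite addr0 mxE (bigD1 j) //= big1 => [|k kj].
      by rewrite mxE !eqxx mulr1 addr0.
    by rewrite mxE (negPf kj) mulr0.
  by rewrite mxE big1 // => l _; rewrite mxE (negPf ki) andbF mulr0.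
have ss : s *m s = 1%:M.
  by rewrite diag2_mxM mulmx1 mulNmx mulmxN opprK mulmx1 scalar_mx_block.
by rewrite -[A]mul1mx -ss -mulmxA sA mulmx0.
Qed.

Lemma strace_scalar (K : fieldType) p q t :
  strace (t%:M : 'M[K]_(p + q)) = t * (p%:R - q%:R).
Proof.
by rewrite /strace scalar_mx_block block_mxKul block_mxKdr !mxtrace_scalar mulrBr
  !mulr_natr.
Qed.

(** The supertrace form is nondegenerate on all matrices, and a test matrix B may be moved into L by
    a scalar t: this changes the pairing with A by t strace A, which is zero. *)
Lemma linear_family_nondegenerate (K : fieldType) (g : lieSuperalgebra K)
    (form : g -> g -> K) p q (L : set 'M[K]_(p + q)) (phi : {linear g -> 'M[K]_(p + q)}) :
  mx_iso L phi -> (forall X Y, form X Y = strace (phi X *m phi Y)) ->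
  (forall B, exists t, L (B + t%:M) /\ forall A, L A -> t * strace A = 0) ->
  nondegenerate form.
Proof.
move=> [inj onto _ _] formE hL X hX; apply: inj; rewrite linear0.
apply: strace_nondegenerate => B; have [t [/onto[Y YB] ht]] := hL B.
have /ht tX : L (phi X) by apply/onto; exists X.
have := hX Y; rewrite formE YB mulmxDr straceD mul_mx_scalar straceZ tX addr0.
by [].
Qed.

Lemma mx_iso_form_invariant (K : fieldType) (g : lieSuperalgebra K)
    (form : g -> g -> K) c p q (L : set 'M[K]_(p + q))
    (phi : {linear g -> 'M[K]_(p + q)}) :
  mx_iso L phi -> (forall X Y, form X Y = c * strace (phi X *m phi Y)) ->
  invariant_form form.
Proof.
by move=> [_ _ par brk] formE; apply: (strace_invariant (linearP phi) par brk formE).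
Qed.

Definition dirac_admissible (R : realType) (g : lieSuperalgebra R[i])
    (h : {vspace g}) (form : g -> g -> R[i]) : Prop :=
  [/\ invariant_form form, nondegenerate form & root_multiplicity_free h].

Lemma sl_admissible (R : realType) (g : lieSuperalgebra R[i]) (h : {vspace g})
    (form : g -> g -> R[i]) (m n : nat) (phi : {linear g -> 'M[R[i]]_(m + n)}) :
  cartan_subalgebra h -> (0 < m)%N -> (0 < n)%N -> m != n ->
  mx_iso (@sl_mx R[i] m n) phi ->
  (forall X Y, form X Y = strace (phi X *m phi Y)) -> dirac_admissible h form.
Proof.
move=> hc m0 n0 mn iso formE.
have mnz : m%:R - n%:R != 0 :> R[i] by rewrite subr_eq0 eqr_nat.
(* The identity has supertrace m - n, so subtracting strace A / (m - n) times it makes the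
   supertrace vanish. *)
have shift A : @sl_mx R[i] m n (A + (- (strace A / (m%:R - n%:R)))%:M).
  by rewrite /sl_mx /= straceD strace_scalar mulNr divfK ?subrr.
split.
- apply: (mx_iso_form_invariant (c := 1) iso) => X Y.
  by rewrite formE mul1r.
- apply: (linear_family_nondegenerate iso formE) => B.
  by eexists; split=> [|A /= ->]; [exact: shift|rewrite mulr0].
- apply: (linear_family_mult hc m0 n0 iso) => [//|A].
  by eexists; apply: shift.
Qed.

Lemma gl_admissible (R : realType) (g : lieSuperalgebra R[i]) (h : {vspace g})
    (form : g -> g -> R[i]) (n : nat) (phi : {linear g -> 'M[R[i]]_(n + n)}) :
  cartan_subalgebra h -> (0 < n)%N -> mx_iso setT phi ->
  (forall X Y, form X Y = strace (phi X *m phi Y)) -> dirac_admissible h form.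
Proof.
move=> hc n0 iso formE; split.
- apply: (mx_iso_form_invariant (c := 1) iso) => X Y.
  by rewrite formE mul1r.
- apply: (linear_family_nondegenerate iso formE) => B.
  by exists 0; split=> // A _; rewrite mul0r.
- by apply: (linear_family_mult hc n0 n0 iso) => // A; exists 0.
Qed.

(** * Orthosymplectic superalgebras *)

(* For a Cartan subalgebra acting diagonally on a space with an even bilinear    *)
(* form G (symmetric on the even part, alternating on the odd one), T collects   *)
(* the diagonals (lam_i).  The elements (E_ij -+ E_ji) G of the orthosymplectic  *)
(* algebra have weight lam_i + lam_j, so those of weight 0 are diagonal.         *)
Section Pairing.
Variables (K : numFieldType) (n : nat) (par : 'I_n -> bool) (G : 'M[K]_n).
Variable T : set ('I_n -> K).
Hypothesis T_scale : forall a lam, T lam -> T (fun i => a * lam i).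
Hypothesis G_weight : forall lam i j, T lam -> G i j != 0 -> lam i + lam j = 0.
Hypothesis G_even : forall i j, G i j != 0 -> par i = par j.
Hypothesis G_sym : forall i j, G i j = (-1) ^+ par i * G j i.
Hypothesis G_row : forall i, exists j, G i j != 0.
Hypothesis T_zero : forall i j, par i = par j -> i != j ->
  (forall lam, T lam -> lam i + lam j = 0) ->
  exists2 lam, T lam & forall k l,
    (k == i)%:R * G j l - (-1) ^+ par i * (k == j)%:R * G i l = (k == l)%:R * lam k.

Definition fixed_weight i := forall lam, T lam -> lam i = 0.

(** [s i] is any j with [G i j] nonzero, so the weights of i and [s i] are opposite. If they differ
    as indices, the diagonal from [T_zero] is a multiple of the difference of indicators of i and
    [s i]. If [s i] = i, then i is even of weight zero; two such i, j would give a diagonal matrix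
    with the nonzero entry [G j j] at (i, j). *)
Lemma pairing_exists : exists s : 'I_n -> 'I_n,
  (forall i, if s i == i then ~~ par i /\ fixed_weight i else
     [/\ par (s i) = par i, T (fun k => (k == i)%:R - (k == s i)%:R) &
         forall lam, T lam -> lam i + lam (s i) = 0]) /\
  (forall i j, s i = i -> s j = j -> i = j).
Proof.
have [s sP] := boolp.choice G_row; exists s; split=> [i|i j si sj].
  case: eqP => [si|/eqP si].
    have Gii : G i i != 0 by rewrite -{2}si.
    split.
      apply/negP => pi; move: (G_sym i i); rewrite pi expr1 mulN1r => /eqP.
      by rewrite -addr_eq0 -mulr2n mulrn_eq0 (negPf Gii).
    move=> lam Tl; have /eqP := G_weight Tl Gii.
    by rewrite -mulr2n mulrn_eq0 => /eqP.
  have pij := G_even (sP i).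
  have si' : i != s i by rewrite eq_sym.
  have zero lam : T lam -> lam i + lam (s i) = 0 by move=> Tl; apply: G_weight (sP i).
  split=> //; have [lam Tl hl] := T_zero pij si' zero.
  have Gji : G (s i) i != 0.
    have := sP i; rewrite G_sym mulf_eq0 negb_or => /andP[]//.
  have -> : (fun k => (k == i)%:R - (k == s i)%:R)
      = (fun k => (G (s i) i)^-1 * lam k) :> ('I_n -> K).
    apply/funext => k; have := hl k k; rewrite eqxx mul1r => <-.
    have [->|ki] := eqVneq k i.
      by rewrite (negPf si') mulr0 mul0r mul1r !subr0 mulVf.
    have [->|ks] := eqVneq k (s i); last by rewrite !mulr0 !mul0r !subrr mulr0.
    have Gij : (-1) ^+ par i * G i (s i) = G (s i) i by rewrite pij -G_sym.
    by rewrite mul0r !sub0r mulr1 Gij mulrN mulVf.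
  exact: T_scale.
apply/eqP/negPn/negP => ij.
have fx k : s k = k -> ~~ par k /\ forall lam, T lam -> lam k = 0.
  move=> sk; have Gkk : G k k != 0 by rewrite -{2}sk.
  split.
    apply/negP => pk; move: (G_sym k k); rewrite pk expr1 mulN1r => /eqP.
    by rewrite -addr_eq0 -mulr2n mulrn_eq0 (negPf Gkk).
  move=> lam Tl; have /eqP := G_weight Tl Gkk.
  by rewrite -mulr2n mulrn_eq0 => /eqP.
have [pi wi] := fx _ si; have [pj wj] := fx _ sj.
have pij : par i = par j by rewrite (negPf pi) (negPf pj).
have zero lam : T lam -> lam i + lam j = 0 by move=> Tl; rewrite wi // wj // addr0.
have [lam Tl hl] := T_zero pij ij zero.
have := hl i j; rewrite eqxx (negPf ij) mulr0 mul0r mul0r mul1r subr0 => /eqP.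
by have := sP j; rewrite sj => /negPf->.
Qed.

(** Unless both are fixed by s, evaluation on the diagonal with entries 1 at a and -1 at [s a]
    distinguishes the indices; s has at most one fixed index. *)
Lemma weight_separates i j : (forall lam, T lam -> lam i = lam j) -> i = j.
Proof.
have [s [sP su]] := pairing_exists.
have key a b : s a != a -> (forall lam, T lam -> lam a = lam b) -> a = b.
  move=> sa ab; have := sP a; rewrite (negPf sa) => -[_ Ta _].
  have := ab _ Ta; rewrite eqxx eq_sym (negPf sa) subr0 => /eqP.
  rewrite -subr_eq0 opprB addrA -natrD.
  rewrite subr_eq0 eqr_nat; case: (eqVneq b a) => [->//|_].
  by case: (b == s a).
move=> ij; have [si|si] := eqVneq (s i) i; last exact: key.
have [sj|sj] := eqVneq (s j) j; first exact: su.
by apply/esym/key => // lam Tl; rewrite ij.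
Qed.

(** Roots are sums of two weights. On the diagonal with 1 at a and -1 at [s a] the left side is at
    least 1, as b = [s a] would make the sum zero; hence a is one of c, d, and the other index is
    recovered by cancellation. *)
Lemma weight_sum_separates i j k l :
  (exists2 lam, T lam & lam i + lam j != 0) ->
  (forall lam, T lam -> lam i + lam j = lam k + lam l) ->
  i = k /\ j = l \/ i = l /\ j = k.
Proof.
have [s [sP su]] := pairing_exists.
have key a b c d : s a != a -> (exists2 lam, T lam & lam a + lam b != 0) ->
    (forall lam, T lam -> lam a + lam b = lam c + lam d) ->
    a = c /\ b = d \/ a = d /\ b = c.
  move=> sa [lam0 T0 nz] abcd; have := sP a; rewrite (negPf sa) => -[_ Ta Za].
  have bsa : b != s a by apply: contraNneq nz => ->; rewrite Za.
  have : (a == c) || (a == d).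
    have := abcd _ Ta; rewrite eqxx [a == s a]eq_sym (negPf sa) (negPf bsa) !subr0.
    move/eqP; rewrite -subr_eq0 opprD !opprB.
    set x1 := (b == a); set x2 := (c == a); set x3 := (c == s a).
    set x4 := (d == a); set x5 := (d == s a).
    have -> : 1 + x1%:R + (x3%:R - x2%:R + (x5%:R - x4%:R))
        = (1 + x1 + x3 + x5)%:R - (x2 + x4)%:R :> K by rewrite !natrD; ring.
    rewrite subr_eq0 eqr_nat [a == c]eq_sym [a == d]eq_sym -/x2 -/x4.
    by case: x1; case: x2; case: x3; case: x4; case: x5.
  case/orP => /eqP e; [left|right]; split=> //; apply: weight_separates => lam Tl;
    have := abcd _ Tl; rewrite e; first exact: addrI.
  by rewrite [RHS]addrC => /addrI.
move=> nz ijkl; have [si|si] := eqVneq (s i) i; last exact: key.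
have sj : s j != j.
  case: nz => lam Tl; apply: contraNneq => sj.
  have := sP i; have := sP j; rewrite si sj !eqxx => -[_ wj] [_ wi].
  by rewrite wi // wj // addr0.
have [|lam Tl|[-> ->]|[-> ->]] := key j i k l sj; [|by rewrite addrC ijkl|by right|by left].
by case: nz => lam Tl h0; exists lam; rewrite 1?addrC.
Qed.

(** An odd index a is not fixed by s, and [s a] is again odd; so the diagonal with 1 at a and -1 at
    [s a] vanishes at every even index. *)
Lemma odd_weight_nonzero i j : par i != par j ->
  exists2 lam, T lam & lam i + lam j != 0.
Proof.
have [s [sP _]] := pairing_exists.
have key a b : par a -> ~~ par b -> exists2 lam, T lam & lam a + lam b != 0.
  move=> pa pb; have := sP a; case: eqP => [_ [] /negP//|_ [psa Ta _]].
  exists (fun k => (k == a)%:R - (k == s a)%:R) => //; rewrite eqxx.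
  have [e|_] := eqVneq a (s a); first by move: (sP a); rewrite -e eqxx pa => -[].
  have [e|_] := eqVneq b a; first by move: pb; rewrite e pa.
  have [e|_] := eqVneq b (s a); first by move: pb; rewrite e psa pa.
  by rewrite !subr0 addr0 oner_eq0.
case pi : (par i); case pj : (par j) => // _; first by apply: key; rewrite ?pj.
have [|lam Tl hl] := key j i pj; first by rewrite pi.
by exists lam; rewrite 1?addrC.
Qed.

End Pairing.

(** * Superskew matrices as coordinates on the orthosymplectic algebra *)

Section SuperSkew.
Variables (K : fieldType) (p q : nat).
Implicit Types A S Z : 'M[K]_(p + q).

Definition par (i : 'I_(p + q)) : bool := (p <= i)%N.

Lemma par_lshift (i : 'I_p) : par (lshift q i) = false.
Proof. by rewrite /par leqNgt /= ltn_ord. Qed.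

Lemma par_rshift (i : 'I_q) : par (rshift p i) = true.
Proof. by rewrite /par /= leq_addr. Qed.

Lemma mx_parity_entry z A :
  mx_parity z A <-> forall i j, par i (+) par j != z -> A i j = 0.
Proof.
split=> [hA i j|hA].
  rewrite -(submxK A); case: z hA => -[h1 h2]; rewrite h1 h2;
  by case: (split_ordP i) => k ->; case: (split_ordP j) => l ->;
    rewrite ?par_lshift ?par_rshift ?block_mxEul ?block_mxEur ?block_mxEdl ?block_mxEdr //= mxE.
by case: z hA => hA; split; apply/matrixP => i j; rewrite !mxE; apply: hA;
  rewrite ?par_lshift ?par_rshift.
Qed.

Definition psgn i j : K := (-1) ^+ (par i && par j).

Lemma psgnC i j : psgn i j = psgn j i. Proof. by rewrite /psgn andbC. Qed.

Lemma psgnK i j : psgn i j * psgn i j = 1.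
Proof. by rewrite /psgn -signr_addb addbb. Qed.

(** These are the products A G^-1 of orthosymplectic A with the inverse Gram matrix: skew on the
    even block, symmetric on the odd one. In these coordinates the weights take the symmetric form
    lam_i + lam_j. *)
Definition superskew S : Prop := forall i j, S i j = - psgn i j * S j i.

Lemma superskew_block a b c d : superskew (block_mx a b c d) <->
  [/\ a^T = - a, d^T = d & b = - c^T].
Proof.
rewrite /superskew /psgn; split=> [hS|[ha hd hb] i j].
  split; apply/matrixP => i j; rewrite !mxE.
  - have := hS (lshift q j) (lshift q i).
    by rewrite par_lshift !block_mxEul expr0 mulN1r.
  - have := hS (rshift p j) (rshift p i).
    by rewrite !par_rshift !block_mxEdr expr1 opprK mul1r.
  - have := hS (lshift q i) (rshift p j).
    by rewrite par_lshift block_mxEur block_mxEdl expr0 mulN1r.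
case: (split_ordP i) => k ->; case: (split_ordP j) => l ->;
  rewrite ?par_lshift ?par_rshift ?block_mxEul ?block_mxEur ?block_mxEdl ?block_mxEdr
    ?expr0 ?expr1 ?opprK ?mulN1r ?mul1r /=.
- by move/matrixP/(_ l k): ha; rewrite !mxE.
- by rewrite hb !mxE.
- by rewrite hb !mxE opprK.
- by move/matrixP/(_ l k): hd; rewrite !mxE.
Qed.

Lemma superskew_conj Z S : mx_parity false Z -> superskew S ->
  superskew (Z *m S *m Z^T).
Proof.
move=> /mx_parity_entry Z0 hS i j.
have E i' j' : (Z *m S *m Z^T) i' j' = \sum_k \sum_l Z i' k * S k l * Z j' l.
  rewrite mxE exchange_big; apply: eq_bigr => l _; rewrite !mxE mulr_suml.
  by apply: eq_bigr => k _.
rewrite !E [in RHS]exchange_big mulr_sumr; apply: eq_bigr => k _.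
rewrite mulr_sumr; apply: eq_bigr => l _; rewrite [S k l]hS /psgn.
have [ik|ik] := eqVneq (par i) (par k); last first.
  have -> : Z i k = 0 by apply: Z0; move: ik; case: (par i); case: (par k).
  by rewrite !mul0r !mulr0.
have [jl|jl] := eqVneq (par j) (par l); last first.
  have -> : Z j l = 0 by apply: Z0; move: jl; case: (par j); case: (par l).
  by rewrite !mul0r !mulr0.
by rewrite ik jl; ring.
Qed.

Definition skew_unit i j : 'M[K]_(p + q) := delta_mx i j - psgn i j *: delta_mx j i.

Lemma skew_unit_superskew i j : superskew (skew_unit i j).
Proof.
move=> k l; rewrite !mxE.
have hu : psgn k l * (psgn i j * ((k == i) && (l == j))%:R) = ((k == i) && (l == j))%:R.
  by have [/andP[/eqP-> /eqP->]|] := boolP (_ && _); rewrite ?mulr0 // mulr1 psgnK.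
have hv : psgn k l * ((k == j) && (l == i))%:R = psgn i j * ((k == j) && (l == i))%:R.
  by have [/andP[/eqP-> /eqP->]|] := boolP (_ && _); rewrite ?mulr0 // psgnC.
rewrite [(l == i) && _]andbC [(l == j) && _]andbC mulrBr !mulNr hu hv opprK.
by rewrite addrC.
Qed.

Lemma trace_skew_unit (Y : 'M[K]_(p + q)) i j :
  \tr (Y *m skew_unit i j) = Y j i - psgn i j * Y i j.
Proof.
have tr_delta k l : \tr (Y *m delta_mx k l) = Y l k.
  rewrite /mxtrace (bigD1 l) //= big1 => [|m ml].
    rewrite addr0 mxE (bigD1 k) //= big1 => [|m mk].
      by rewrite mxE !eqxx mulr1 addr0.
    by rewrite mxE (negPf mk) mulr0.
  by rewrite mxE big1 // => m' _; rewrite mxE (negPf ml) andbF mulr0.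
by rewrite mulmxBr -scalemxAr linearB linearZ /= !tr_delta.
Qed.

End SuperSkew.

Lemma diag2_mx1 (K : fieldType) k l : diag2_mx 1%:M 1%:M = 1%:M :> 'M[K]_(k + l).
Proof. by rewrite /diag2_mx -scalar_mx_block. Qed.

Lemma trmxN (V : zmodType) k l (A : 'M[V]_(k, l)) : (- A)^T = - A^T.
Proof. by apply/matrixP => i j; rewrite !mxE. Qed.

Section Orthosymplectic.
Variables (R : realType) (m n : nat).
Local Notation C := R[i].
Local Notation MX := 'M[C]_(m + (n + n)).

Definition sympl_mx : 'M[C]_(n + n) := block_mx 0 1%:M (- 1%:M) 0.
Local Notation Jm := sympl_mx.

Lemma sympl_mx_sq : Jm *m Jm = - 1%:M.
Proof.
rewrite /sympl_mx mulmx_block !mulmx0 !mul0mx !addr0 !add0r mul1mx mulmx1.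
by rewrite [in RHS]scalar_mx_block opp_block_mx oppr0.
Qed.

Lemma sympl_mx_tr : Jm^T = - Jm.
Proof.
by rewrite /sympl_mx tr_block_mx opp_block_mx !trmx0 trmxN !trmx1 oppr0 opprK.
Qed.

Definition osp_gram_inv : MX := diag2_mx 1%:M (- Jm).

Lemma osp_gramE : osp_gram C m n = diag2_mx 1%:M Jm.
Proof. by []. Qed.

Lemma osp_gramV : osp_gram C m n *m osp_gram_inv = 1%:M.
Proof.
by rewrite osp_gramE diag2_mxM mulmx1 mulmxN sympl_mx_sq opprK diag2_mx1.
Qed.

Lemma osp_Vgram : osp_gram_inv *m osp_gram C m n = 1%:M.
Proof.
by rewrite osp_gramE diag2_mxM mulmx1 mulNmx sympl_mx_sq opprK diag2_mx1.
Qed.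

Lemma osp_mx_superskew (S : MX) :
  superskew S -> osp_mx (S *m osp_gram C m n).
Proof.
rewrite -{1}(submxK S) => /superskew_block[ha hd hb].
rewrite /osp_mx /= osp_gramE /diag2_mx -{1 2}(submxK S).
move: (ulsubmx S) (ursubmx S) (dlsubmx S) (drsubmx S) ha hd hb => a b c d ha hd hb.
rewrite ![block_mx a b c d *m _]mulmx_block !mulmx0 !mulmx1 !addr0 !add0r.
rewrite /strmx block_mxKul block_mxKur block_mxKdl block_mxKdr !mulmx_block.
rewrite !mulmx0 !mul0mx !mulmx1 !mul1mx !addr0 !add0r add_block_mx.
have -> : a^T + a = 0 by rewrite ha addNr.
have -> : c^T *m Jm + b *m Jm = 0 by rewrite hb mulNmx subrr.
have -> : - (b *m Jm)^T + Jm *m c = 0.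
  by rewrite hb mulNmx trmxN trmx_mul trmxK sympl_mx_tr mulNmx !opprK addNr.
have -> : (d *m Jm)^T *m Jm + Jm *m (d *m Jm) = 0.
  by rewrite trmx_mul hd sympl_mx_tr !mulNmx mulmxA addNr.
exact: block_mx0.
Qed.

Lemma superskew_osp_mx (A : MX) : osp_mx A -> superskew (A *m osp_gram_inv).
Proof.
rewrite /osp_mx /= osp_gramE /osp_gram_inv /diag2_mx -{2 3}(submxK A) /strmx.
move: (ulsubmx A) (ursubmx A) (dlsubmx A) (drsubmx A) => a b c d.
rewrite !mulmx_block !mulmx0 !mul0mx !mulmx1 !mul1mx !addr0 !add0r add_block_mx.
rewrite -[0 in X in X -> _](block_mx0 C m (n + n) m (n + n)).
case/eq_block_mx => ha hb hc hd; apply/superskew_block; split.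
- by apply/eqP; rewrite -addr_eq0 ha.
- rewrite trmx_mul trmxN sympl_mx_tr opprK mulmxN.
  have e : Jm *m (d^T *m Jm + Jm *m d) *m Jm = 0 by rewrite hd mulmx0 mul0mx.
  move: e; rewrite mulmxDr mulmxDl !mulmxA sympl_mx_sq mulNmx mul1mx -!mulmxA sympl_mx_sq.
  by rewrite !mulmxN !mulmx1 => /eqP; rewrite ?mulNmx -opprD oppr_eq0 addr_eq0 => /eqP.
- have e : (c^T *m Jm + b) *m Jm = 0 by rewrite hb mul0mx.
  move: e; rewrite mulmxDl -mulmxA sympl_mx_sq mulmxN mulmx1 => /eqP.
  by rewrite addr_eq0 eqr_opp mulmxN => /eqP ->.
Qed.

End Orthosymplectic.

Lemma diag2_sym_entry (K : fieldType) p q (A : 'M[K]_p) (B : 'M[K]_q) i j :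
  A^T = A -> B^T = - B -> diag2_mx A B i j = (-1) ^+ par i * diag2_mx A B j i.
Proof.
move=> hA hB; rewrite /diag2_mx.
case: (split_ordP i) => k ->; case: (split_ordP j) => l ->;
  rewrite ?par_lshift ?par_rshift ?expr0 ?expr1 ?mul1r ?mulN1r
    ?block_mxEul ?block_mxEur ?block_mxEdl ?block_mxEdr ?mxE ?oppr0 //.
- by rewrite -{1}hA mxE.
- by move/matrixP/(_ l k): hB; rewrite !mxE.
Qed.

Lemma anticomm_inv (K : fieldType) n (A B D : 'M[K]_n) : A *m B = 1%:M ->
  B *m A = 1%:M -> D *m A = - (A *m D) -> B *m D = - (D *m B).
Proof.
move=> AB BA DA; have <- : B *m (D *m A) *m B = B *m D by rewrite -!mulmxA AB mulmx1.
by rewrite DA mulmxN mulNmx !mulmxA BA mul1mx.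
Qed.

(** * Weights of a Cartan subalgebra acting diagonally and preserving an even form *)

Section DiagonalCartan.
Variables (R : realType) (g : lieSuperalgebra R[i]) (h : {vspace g}).
Hypothesis h_cartan : cartan_subalgebra h.
Variables (p q : nat) (f : g -> 'M[R[i]]_(p + q)) (K G : 'M[R[i]]_(p + q)).
Hypotheses (KG : K *m G = 1%:M) (GK : G *m K = 1%:M).
Hypothesis K_par : forall i j, par i != par j -> K i j = 0.
Hypothesis G_par : forall i j, G i j != 0 -> par i = par j.
Hypothesis K_sym : forall i j, K i j = (-1) ^+ par i * K j i.
Hypothesis G_sym : forall i j, G i j = (-1) ^+ par i * G j i.
Hypothesis fZ : forall a X, f (a *: X) = a *: f X.
Hypothesis f_diag : {in h, forall H i j, i != j -> f H i j = 0}.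
Hypothesis fbr : {in h & gr g false, forall H X,
  f (bracket H X) = f H *m f X - f X *m f H}.
Hypothesis f_inj : {in gr g false, forall X, f X = 0 -> X = 0}.
Hypothesis s_skew : {in gr g false, forall X, superskew (f X *m K)}.
Hypothesis s_onto : forall S, superskew S -> mx_parity false S ->
  exists2 X, X \in gr g false & f X *m K = S.
Local Notation s := (fun X => f X *m K).

(** For diagonal [f H], superskewness of [f H *m K] together with the symmetry of K says that the
    i-th and j-th eigenvalues are opposite wherever [K i j] is nonzero. *)
Lemma diag_anticomm H : H \in h -> f H *m K = - (K *m f H).
Proof.
move=> Hh; have fd := f_diag Hh; apply/matrixP => i j.
have E1 := offdiag_mull K i j fd; have E2 := offdiag_mulr K i j fd.
have E3 := offdiag_mull K j i fd.
rewrite E1 [RHS]mxE E2; have := s_skew (h_even h_cartan Hh) i j; rewrite E1 E3 => ->.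
have [ij|ij] := eqVneq (par i) (par j); last first.
  by rewrite (K_par ij) (@K_par j i) 1?eq_sym // !mulr0 oppr0.
by rewrite [K i j]K_sym /psgn ij andbb mulNr mulrCA.
Qed.

Lemma diag_weight H X i j : H \in h ->
  f (bracket H X) = f H *m f X - f X *m f H ->
  s (bracket H X) i j = (f H i i + f H j j) * s X i j.
Proof.
move=> Hh hX; have fd := f_diag Hh.
have -> : s (bracket H X) = f H *m s X + s X *m f H.
  by rewrite hX mulmxBl -!mulmxA (diag_anticomm Hh) mulmxN opprK.
move: (s X) => A; have E1 := offdiag_mull A i j fd; have E2 := offdiag_mulr A i j fd.
by rewrite mxE E1 E2 mulrDl.
Qed.

Definition diag_weights : set ('I_(p + q) -> R[i]) :=
  [set lam | exists2 H, H \in h & forall i, f H i i = lam i].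

Lemma diag_weights_scale a lam : diag_weights lam -> diag_weights (fun i => a * lam i).
Proof.
move=> [H Hh HE]; exists (a *: H); first by rewrite rpredZ.
by move=> i; rewrite fZ mxE HE.
Qed.

Lemma gram_weight lam i j : diag_weights lam -> G i j != 0 -> lam i + lam j = 0.
Proof.
move=> [H Hh HE] Gij; have fd := f_diag Hh.
have E1 := offdiag_mull G i j fd; have E2 := offdiag_mulr G i j fd.
have fG : G *m f H = - (f H *m G) by apply: (anticomm_inv KG GK); apply: diag_anticomm.
have := congr1 (fun A : 'M_(p + q) => A i j) fG.
rewrite /= [RHS]mxE E1 E2 -mulNr => /(mulIf Gij) e.
by rewrite -!HE e subrr.
Qed.

Lemma gram_row i : exists j, G i j != 0.
Proof.
apply: contrapT => /forallNP hN; have := congr1 (fun A : 'M_(p + q) => A i i) GK.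
rewrite /= [RHS]mxE mxE eqxx big1 => [/eqP|k _]; first by rewrite eq_sym oner_eq0.
have -> : G i k = 0 by apply/eqP; have /negP := hN k; rewrite negbK.
exact: mul0r.
Qed.

(** If the weights of i and j cancel on h, the element with superskew coordinates [skew_unit i j]
    commutes with h and so lies in h; its matrix [skew_unit i j] times G is then diagonal. *)
Lemma zero_weight_diag i j : par i = par j -> i != j ->
  (forall lam, diag_weights lam -> lam i + lam j = 0) ->
  exists2 lam, diag_weights lam & forall k l,
    (k == i)%:R * G j l - (-1) ^+ par i * (k == j)%:R * G i l = (k == l)%:R * lam k.
Proof.
move=> pij ij zero; have hS := @skew_unit_superskew R[i] p q i j.
have Sz : mx_parity false (skew_unit R[i] i j).
  apply/mx_parity_entry => k l kl; rewrite !mxE.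
  have z a b : par a = par b -> (k == a) && (l == b) = false.
    by move=> ab; apply/negP => /andP[/eqP ka /eqP lb]; move: kl; rewrite ka lb ab addbb.
  by rewrite !z // mulr0 subr0.
have [X X0 XS] := s_onto hS Sz.
have fE Y : f Y = s Y *m G by rewrite -mulmxA KG mulmx1.
have Xh : X \in h.
  case: h_cartan => _ _ hc _; apply: hc => // H Hh; apply: f_inj.
    by rewrite -[false]/(addb false false) bracket_gr // (h_even h_cartan).
  rewrite fE; suff -> : s (bracket H X) = 0 by rewrite mul0mx.
  apply/matrixP => k l; rewrite (diag_weight k l Hh (fbr Hh X0)) XS [RHS]mxE !mxE.
  have zij : f H i i + f H j j = 0 by apply: (zero (fun i => f H i i)); exists H.
  have z1 : (f H k k + f H l l) * ((k == i) && (l == j))%:R = 0.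
    by have [/andP[/eqP-> /eqP->]|] := boolP (_ && _); rewrite ?zij ?mul0r ?mulr0.
  have z2 : (f H k k + f H l l) * ((k == j) && (l == i))%:R = 0.
    have [/andP[/eqP-> /eqP->]|] := boolP (_ && _); last by rewrite mulr0.
    by rewrite [f H j j + _]addrC zij mul0r.
  by rewrite mulrBr z1 mulrCA z2 mulr0 subr0.
exists (fun k => f X k k) => [|k l]; first by exists X.
have -> : (k == l)%:R * f X k k = f X k l.
  have [->|kl] := eqVneq k l; first by rewrite mul1r.
  by rewrite mul0r (f_diag Xh).
have -> : f X k l = (delta_mx i j *m G) k l - psgn R[i] i j * (delta_mx j i *m G) k l.
  rewrite fE XS /skew_unit mulmxBl -scalemxAl.
  by move: (delta_mx i j *m G) (delta_mx j i *m G) => A B; rewrite !mxE.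
have dE a b : (delta_mx a b *m G) k l = (k == a)%:R * G b l.
  rewrite mxE (bigD1 b) //= big1 ?addr0 => [|c cb]; first by rewrite mxE eqxx andbT.
  by rewrite mxE (negPf cb) andbF mul0r.
by rewrite !dE /psgn -pij andbb mulrA.
Qed.

Lemma diag_weight_pairing : exists t : 'I_(p + q) -> 'I_(p + q),
  (forall i, if t i == i then ~~ par i /\ fixed_weight diag_weights i else
     [/\ par (t i) = par i, diag_weights (fun k => (k == i)%:R - (k == t i)%:R) &
         forall lam, diag_weights lam -> lam i + lam (t i) = 0]) /\
  (forall i j, t i = i -> t j = j -> i = j).
Proof.
exact: (pairing_exists diag_weights_scale gram_weight G_par G_sym gram_row zero_weight_diag).
Qed.

Lemma diag_weight_separates i j :
  (forall lam, diag_weights lam -> lam i = lam j) -> i = j.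
Proof.
exact: (weight_separates diag_weights_scale gram_weight G_par G_sym gram_row
  zero_weight_diag).
Qed.

Lemma diag_odd_weight_nonzero i j : par i != par j ->
  exists2 lam, diag_weights lam & lam i + lam j != 0.
Proof.
exact: (odd_weight_nonzero diag_weights_scale gram_weight G_par G_sym gram_row
  zero_weight_diag).
Qed.

Lemma diag_root_weight (alpha : hdual h) X i j (H : subvs_of h) :
  X \in rootspace alpha ->
  f (bracket (vsval H) X) = f (vsval H) *m f X - f X *m f (vsval H) ->
  s X i j != 0 -> alpha H = f (vsval H) i i + f (vsval H) j j.
Proof.
move=> /rootspaceP Xa hX nz; have := diag_weight i j (subvsP H) hX; rewrite Xa.
have -> : s (alpha H *: X) i j = alpha H * s X i j by rewrite fZ -scalemxAl mxE.
by move/(mulIf nz).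
Qed.

(** Equal nonzero roots force equal unordered pairs of indices, and transposed entries of a
    superskew matrix agree up to sign. *)
Lemma diag_coords_proportional (alpha : hdual h) (V : {vspace g}) i j k l X Y :
  alpha != 0 -> {in h & V, forall H X, f (bracket H X) = f H *m f X - f X *m f H} ->
  {in V, forall X, superskew (s X)} -> X \in V -> Y \in V ->
  X \in rootspace alpha -> Y \in rootspace alpha -> s X i j != 0 -> s Y k l != 0 ->
  exists c, {in V, forall Z, s Z k l = c * s Z i j}.
Proof.
move=> a0 Vbr Vskew XV YV Xa Ya sX sY.
have wX H := diag_root_weight Xa (Vbr _ _ (subvsP H) XV) sX.
have wY H := diag_root_weight Ya (Vbr _ _ (subvsP H) YV) sY.
have [||[<- <-]|[<- <-]] := weight_sum_separates diag_weights_scale gram_weight G_par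
    G_sym gram_row zero_weight_diag (i := i) (j := j) (k := k) (l := l).
- have [H aH] : exists H, alpha H != 0.
    apply: contrapT => /forallNP hN; move/negP: a0; apply; apply/eqP/lfunP => H.
    by rewrite zero_lfunE; apply/eqP; have /negP := hN H; rewrite negbK.
  exists (fun a => f (vsval H) a a); first by exists (vsval H); rewrite ?subvsP.
  by rewrite -wX.
- by move=> lam [H Hh HE]; rewrite -!HE -(vsprojK Hh) -wX -wY.
- by exists 1 => Z _; rewrite mul1r.
- by exists (- psgn R[i] j i) => Z ZV; apply: Vskew.
Qed.

End DiagonalCartan.

Section OrthosymplecticFamily.
Variables (R : realType) (g : lieSuperalgebra R[i]) (h : {vspace g}).
Hypothesis h_cartan : cartan_subalgebra h.
Variables (m n : nat) (phi : {linear g -> 'M[R[i]]_(m + (n + n))}).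
Hypotheses (m_gt0 : (0 < m)%N) (n_gt0 : (0 < n)%N).
Hypothesis phi_iso : mx_iso (@osp_mx R[i] m n) phi.
Local Notation C := R[i].
Local Notation MX := 'M[C]_(m + (n + n)).
Local Notation Gm := (osp_gram C m n).
Local Notation Gi := (osp_gram_inv R m n).

Lemma iso_superskew X : superskew (phi X *m Gi).
Proof. by apply: superskew_osp_mx; case: phi_iso => _ hL _ _; apply/hL; exists X. Qed.

Lemma osp_onto z (S : MX) : superskew S -> mx_parity z S ->
  exists2 X, X \in gr g z & phi X *m Gi = S.
Proof.
move=> hS Sz; have par : mx_parity z (S *m Gm).
  by have := mx_parityM Sz (diag2_mx_even 1%:M (sympl_mx R n)); rewrite addbF.
have [X Xz XE] := iso_onto phi_iso (osp_mx_superskew hS) par.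
by exists X => //; rewrite XE -mulmxA osp_gramV mulmx1.
Qed.

(** With Z = G diag(1, -1), which absorbs the sign of the supertrace, testing against the skew units
    shows that Z phi(X) is supersymmetric. Membership of phi(X) in the orthosymplectic algebra makes
    it superskew as well, hence zero. *)
Lemma osp_nondegenerate (form : g -> g -> C) (c : C) : c != 0 ->
  (forall X Y, form X Y = c * strace (phi X *m phi Y)) -> nondegenerate form.
Proof.
move=> c0 formE X hX; apply: (iso_eq0 phi_iso).
pose Z : MX := diag2_mx 1%:M (- sympl_mx R n).
have Zt : Z^T = Gm.
  by rewrite /Z /diag2_mx tr_block_mx !trmx0 trmx1 trmxN sympl_mx_tr opprK.
pose Y := Z *m (phi X *m Gi) *m Z^T.
have Ys : superskew Y by apply: superskew_conj; [apply: diag2_mx_even|apply: iso_superskew].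
have YE : Y = Z *m phi X by rewrite /Y Zt -!mulmxA osp_Vgram mulmx1.
have Yz i j : Y j i = psgn C i j * Y i j.
  have /= hS := @skew_unit_superskew C m (n + n) i j.
  have [W WE] : exists W, phi W = skew_unit C i j *m Gm.
    by case: phi_iso => _ hL _ _; apply/hL; apply: osp_mx_superskew.
  have := hX W; rewrite formE => /eqP; rewrite mulf_eq0 (negPf c0) /= => /eqP.
  rewrite WE strace_trace !mulmxA mxtrace_mulC !mulmxA.
  have -> : Gm *m diag2_mx 1%:M (- 1%:M) = Z.
    by rewrite osp_gramE diag2_mxM mulmx1 mulmxN mulmx1.
  by rewrite -YE trace_skew_unit => /eqP; rewrite subr_eq0 => /eqP.
have Y0 : Y = 0.
  apply/matrixP => i j; rewrite [RHS]mxE; have := Ys i j; rewrite [psgn C i j]psgnC mulNr -Yz => /eqP.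
  by rewrite -addr_eq0 -mulr2n mulrn_eq0 => /eqP.
have ZZ : Gm *m Z = 1%:M.
  by rewrite osp_gramE diag2_mxM mulmx1 mulmxN sympl_mx_sq opprK diag2_mx1.
by rewrite -[phi X]mul1mx -ZZ -mulmxA -YE Y0 mulmx0.
Qed.

Lemma odd_superskew (B : 'M[C]_(m, n + n)) :
  superskew (block_mx 0 B (- B^T) 0) /\ mx_parity true (block_mx 0 B (- B^T) 0).
Proof.
split; last by rewrite /= block_mxKul block_mxKdr.
by apply/superskew_block; rewrite trmx0 trmx0 oppr0 trmxN trmxK opprK.
Qed.

Lemma osp_diagonalization : exists (P0 : 'M[C]_m) (P1 : 'M[C]_(n + n)),
  [/\ P0 \in unitmx, P1 \in unitmx & {in h, forall H i j, i != j ->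
    (diag2_mx P0 P1 *m phi H *m diag2_mx (invmx P0) (invmx P1)) i j = 0}].
Proof.
have phiE X S : phi X *m Gi = S -> phi X = S *m Gm.
  by move=> <-; rewrite -mulmxA osp_Vgram mulmx1.
apply: super_diagonalization => //.
- by rewrite addn_gt0 n_gt0.
- exact: linearP.
- by move=> X; apply: (iso_parity phi_iso).
- by move=> X; apply: (iso_parity phi_iso).
- by move=> H X; apply: (iso_even_bracket phi_iso).
- move=> B; have [h1 h2] := odd_superskew (- (B *m sympl_mx R n)).
  have [X X1 /phiE XE] := osp_onto h1 h2; exists X => //.
  rewrite XE osp_gramE /diag2_mx mulmx_block block_mxKur !mul0mx add0r.
  by rewrite mulNmx -mulmxA sympl_mx_sq mulmxN mulmx1 opprK.
- move=> B; have [h1 h2] := odd_superskew (- B^T).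
  have [X X1 /phiE XE] := osp_onto h1 h2; exists X => //.
  rewrite XE osp_gramE /diag2_mx mulmx_block block_mxKdl !mulmx0 addr0 mulmx1.
  by rewrite trmxN trmxK opprK.
Qed.

(** In the basis that diagonalises h the Gram matrix becomes [G] with inverse [K], and [s X] =
    [f X *m K] is still superskew, so the pairing of weights applies. An odd element has entries
    only between indices of opposite parity, where lam_i + lam_j is not zero on h. *)
Lemma osp_root_mult : root_multiplicity_free h.
Proof.
have [P0 [P1 [P0u P1u hP]]] := osp_diagonalization.
pose P := diag2_mx P0 P1; pose Q := diag2_mx (invmx P0) (invmx P1).
have PQ : P *m Q = 1%:M := diag2_mxV P0u P1u.
have QP : Q *m P = 1%:M := diag2_Vmx P0u P1u.
have PQt : P^T *m Q^T = 1%:M by rewrite -trmx_mul QP trmx1.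
have QPt : Q^T *m P^T = 1%:M by rewrite -trmx_mul PQ trmx1.
pose f := conj_mx phi P0 P1; pose K := P *m Gi *m P^T; pose G := Q^T *m Gm *m Q.
have KG : K *m G = 1%:M.
  by rewrite /K /G !mulmxA -(mulmxA _ P^T) PQt mulmx1 -(mulmxA P) osp_Vgram mulmx1 PQ.
have GK : G *m K = 1%:M.
  by rewrite /K /G !mulmxA -(mulmxA _ Q P) QP mulmx1 -(mulmxA Q^T) osp_gramV mulmx1 QPt.
pose s X := f X *m K.
have sE X : s X = P *m (phi X *m Gi) *m P^T.
  by rewrite /s /K /f /conj_mx !mulmxA -(mulmxA _ Q P) QP mulmx1.
have fE X : f X = s X *m G by rewrite /s -mulmxA KG mulmx1.
have s_skew X : superskew (s X).
  by rewrite sE; apply: superskew_conj; [apply: diag2_mx_even|apply: iso_superskew].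
have s0 X : s X = 0 -> X = 0.
  by move=> e; apply: (conj_mx_eq0 phi_iso P0u P1u); rewrite -/f fE e mul0mx.
have s_onto z S : superskew S -> mx_parity z S -> exists2 X, X \in gr g z & s X = S.
  move=> hS Sz; have [||X Xz XE] := @osp_onto z (Q *m S *m Q^T).
  - by apply: superskew_conj => //; apply: diag2_mx_even.
  - have := mx_parityM (mx_parityM (diag2_mx_even (invmx P0) (invmx P1)) Sz)
      (diag2_mx_even (invmx P0)^T (invmx P1)^T).
    by rewrite addbF /Q /diag2_mx tr_block_mx !trmx0.
  exists X => //; rewrite sE XE !mulmxA PQ mul1mx -mulmxA -trmx_mul PQ trmx1 mulmx1.
  by [].
have f_diag H : H \in h -> forall i j, i != j -> f H i j = 0 := @hP H.
have sD X : s X = f X *m K by [].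
have fbr H X : H \in h -> f (bracket H X) = f H *m f X - f X *m f H.
  by move=> Hh; apply: (conj_mx_bracket phi_iso P0u P1u); apply: (h_even h_cartan).
have fP a X Y : f (a *: X + Y) = a *: f X + f Y := conj_mxP phi P0 P1 a X Y.
have f0 : f 0 = 0 by rewrite /f /conj_mx linear0 mulmx0 mul0mx.
have fZ a X : f (a *: X) = a *: f X by have := fP a X 0; rewrite f0 !addr0.
have f_par z X : X \in gr g z -> mx_parity z (f X) := @conj_mx_parity _ _ _ _ _ _ phi_iso P0 P1 z X.
have KE : K = diag2_mx (P0 *m P0^T) (P1 *m - sympl_mx R n *m P1^T).
  by rewrite /K /P /osp_gram_inv [in X in _ *m X]/diag2_mx tr_block_mx !trmx0
    -/(diag2_mx _ _) !diag2_mxM mulmx1.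
have GE : G = diag2_mx ((invmx P0)^T *m invmx P0) ((invmx P1)^T *m sympl_mx R n *m invmx P1).
  by rewrite /G /Q osp_gramE [in X in X *m _ *m _]/diag2_mx tr_block_mx !trmx0
    -/(diag2_mx _ _) !diag2_mxM mulmx1.
clearbody s K G f; clear sE PQt QPt PQ QP P Q.
have K_par i j : par i != par j -> K i j = 0.
  rewrite KE; have := (mx_parity_entry false _).1 (diag2_mx_even (P0 *m P0^T) (P1 *m - sympl_mx R n *m P1^T)).
  by move=> hK ij; apply: hK; move: ij; case: (par i); case: (par j).
have G_par i j : G i j != 0 -> par i = par j.
  rewrite GE; have := (mx_parity_entry false _).1 (diag2_mx_even
    ((invmx P0)^T *m invmx P0) ((invmx P1)^T *m sympl_mx R n *m invmx P1)).
  move=> hG; apply: contraNeq => ij; apply/eqP/hG.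
  by move: ij; case: (par i); case: (par j).
have K_sym i j : K i j = (-1) ^+ par i * K j i.
  rewrite KE; apply: diag2_sym_entry; first by rewrite trmx_mul trmxK.
  by rewrite !trmx_mul trmxK trmxN sympl_mx_tr opprK mulmxN mulNmx opprK mulmxA.
have G_sym i j : G i j = (-1) ^+ par i * G j i.
  rewrite GE; apply: diag2_sym_entry; first by rewrite trmx_mul trmxK.
  by rewrite !trmx_mul trmxK sympl_mx_tr mulNmx mulmxN mulmxA.
have sP a X Y i j : s (a *: X + Y) i j = a * s X i j + s Y i j.
  by rewrite !sD fP mulmxDl -scalemxAl; move: (f X *m K) (f Y *m K) => A B; rewrite !mxE.
have f_inj : {in gr g false, forall X, f X = 0 -> X = 0}.
  by move=> X _ fX; apply: s0; rewrite sD fX mul0mx.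
have f_skew X : superskew (f X *m K) by rewrite -sD.
have f_onto S : superskew S -> mx_parity false S ->
    exists2 X, X \in gr g false & f X *m K = S.
  by move=> hS Sz; have [X X0 XE] := s_onto _ _ hS Sz; exists X; rewrite -?sD.
have f_skew0 : {in gr g false, forall X, superskew (f X *m K)} by move=> X _.
have fbr0 : {in h & gr g false, forall H X, f (bracket H X) = f H *m f X - f X *m f H}.
  by move=> H X Hh _; apply: fbr.
split.
  move=> alpha X Y a0; apply: (@root_line_coords _ _ _ fullv
    ('I_(m + (n + n)) * 'I_(m + (n + n)))%type
    (fun ij X => s X ij.1 ij.2) _ _ _ alpha X Y a0 (memvf _) (memvf _)).
  - by move=> [i j] a {}X {}Y; apply: sP.
  - by move=> {}X _ hX; apply: s0; apply/matrixP => i j; rewrite (hX (i, j)) mxE.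
  move=> {}alpha [i j] [k l] {}X {}Y {}a0 _ _ Xa Ya /=; rewrite !sD => sX sY.
  have [||c hc] := diag_coords_proportional h_cartan KG GK K_par G_par K_sym G_sym fZ f_diag
    fbr0 f_inj f_skew0 f_onto a0 (V := fullv) _ _ (memvf _) (memvf _) Xa Ya sX sY.
  - by move=> H Z Hh _; apply: fbr.
  - by move=> Z _.
  by exists c => Z ZV; rewrite !sD; apply: hc.
move=> X X1 hX; apply: s0; apply/matrixP => i j; rewrite [RHS]mxE.
apply/eqP/negPn/negP => nz.
have s1 : mx_parity true (s X).
  have := mx_parityM (f_par _ _ X1)
    (diag2_mx_even (P0 *m P0^T) (P1 *m - sympl_mx R n *m P1^T)).
  by rewrite -KE -sD.
have pij : par i != par j.
  apply: contraNneq nz => pij; apply/eqP/((mx_parity_entry true _).1 s1).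
  by rewrite pij addbb.
have [lam [H Hh HE] lnz] := diag_odd_weight_nonzero h_cartan KG GK K_par G_par K_sym G_sym
  fZ f_diag fbr0 f_inj f_skew0 f_onto pij.
have := diag_weight h_cartan K_par K_sym f_diag f_skew0 i j Hh (fbr _ X Hh).
rewrite hX // !HE f0 mul0mx [LHS]mxE => /esym/eqP.
by rewrite -sD mulf_eq0 (negPf lnz) (negPf nz).
Qed.

End OrthosymplecticFamily.

Lemma osp_admissible (R : realType) (g : lieSuperalgebra R[i]) (h : {vspace g})
    (form : g -> g -> R[i]) (m n : nat) (phi : {linear g -> 'M[R[i]]_(m + (n + n))}) :
  cartan_subalgebra h -> (0 < m)%N -> (0 < n)%N -> mx_iso (@osp_mx R[i] m n) phi ->
  (forall X Y, form X Y = 2%:R^-1 * strace (phi X *m phi Y)) ->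
  dirac_admissible h form.
Proof.
move=> hc m0 n0 iso formE; split.
- exact: mx_iso_form_invariant iso formE.
- by apply: (osp_nondegenerate iso _ formE); rewrite invr_eq0 pnatr_eq0.
- exact: osp_root_mult m0 n0 iso.
Qed.

(** * The exceptional superalgebra F(4) *)

(** In a rank factorisation e = C R idempotence gives R C = 1, of size the rank, and the trace of C
    R equals that of R C. *)
Lemma idempotent_trace (K : fieldType) n (e : 'M[K]_n) :
  e *m e = e -> \tr e = (\rank e)%:R.
Proof.
move=> ee; rewrite -{1}(mulmx_base e) mxtrace_mulC -mxtrace1; congr (\tr _).
have [B RB] := row_freeP (row_base_free e).
have [B' B'C] := row_fullP (col_base_full e).
move: (col_base e) (row_base e) RB B'C (mulmx_base e) => C R RB B'C CR.
have : B' *m (C *m R *m (C *m R)) *m B = B' *m (C *m R) *m B by rewrite CR ee.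
by rewrite !mulmxA B'C mul1mx -[_ *m R *m B]mulmxA RB mulmx1.
Qed.

Lemma idempotent_mul (K : fieldType) n (a b : 'M[K]_n) : a *m b = b *m a ->
  a *m a = a -> b *m b = b -> a *m b *m (a *m b) = a *m b.
Proof. by move=> ab aa bb; rewrite {2}ab mulmxA -(mulmxA a) bb -mulmxA -ab mulmxA aa. Qed.

Lemma idempotent_trace1_row (K : numFieldType) n (e : 'M[K]_n) :
  e *m e = e -> \tr e = 1 ->
  exists r : 'rV_n, forall y, y *m e = y -> exists c, y = c *: r.
Proof.
move=> ee tr1; have rk1 : \rank e = 1%N.
  by apply/eqP; rewrite -(eqr_nat K) -idempotent_trace // tr1.
have e0 : e != 0 by rewrite -mxrank_eq0 rk1.
have [k ek] : exists k, row k e != 0.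
  apply: contrapT => /forallNP hN; move/negP: e0; apply; apply/eqP/row_matrixP => k.
  by rewrite row0; apply/eqP; have /negP := hN k; rewrite negbK.
exists (row k e) => y ye; apply/sub_rVP.
have ye1 : (y <= e)%MS by rewrite -ye submxMl.
apply: submx_trans ye1 _.
by have [_] := mxrank_leqif_sup (row_sub k e); rewrite rk1 rank_rV ek eqxx => <-.
Qed.

(** * Creation and annihilation operators, and the weights of the spin module *)

Section CreationAnnihilation.
Variables (K : numFieldType) (u : 'I_3 -> bool -> 'M[K]_8).
Hypothesis u_rel : forall k l b b',
  u k b *m u l b' + u l b' *m u k b = ((k == l) && (b != b'))%:R%:M.
Implicit Types b : bool.

(** The occupation number operator of mode k, or that of the empty mode, according to b:
    complementary idempotents. *)
Definition number_mx k b := u k b *m u k (~~ b).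

Lemma creation_sq k b : u k b *m u k b = 0.
Proof.
have := u_rel k k b b; rewrite !eqxx /= -mulr2n => /eqP.
by rewrite mulr0n raddf0 -scaler_nat scaler_eq0 pnatr_eq0 /= => /eqP.
Qed.

Lemma number_mx_compl k b : number_mx k b + number_mx k (~~ b) = 1%:M.
Proof. by rewrite /number_mx negbK u_rel eqxx; case: b. Qed.

Lemma number_mx_idem k b : number_mx k b *m number_mx k b = number_mx k b.
Proof.
rewrite -[in RHS](mulmx1 (number_mx k b)) -(number_mx_compl k b) mulmxDr.
rewrite [X in _ = _ + X](_ : _ = 0) ?addr0 // /number_mx negbK.
by rewrite mulmxA -[_ *m _ *m u k (~~ b)]mulmxA creation_sq mulmx0 mul0mx.
Qed.

Lemma creation_anticomm k l b b' : k != l -> u k b *m u l b' = - (u l b' *m u k b).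
Proof.
by move=> kl; apply/eqP; rewrite -addr_eq0 u_rel (negPf kl) mulr0n raddf0.
Qed.

Lemma number_mx_creation k l b b' : k != l ->
  number_mx k b *m u l b' = u l b' *m number_mx k b.
Proof.
move=> kl; rewrite /number_mx -mulmxA (creation_anticomm _ _ kl) mulmxN.
by rewrite !mulmxA (creation_anticomm _ _ kl) mulNmx opprK.
Qed.

Lemma number_mx_comm k l b b' : k != l ->
  number_mx k b *m number_mx l b' = number_mx l b' *m number_mx k b.
Proof.
by move=> kl; rewrite [number_mx l b']/number_mx mulmxA number_mx_creation //
  -mulmxA number_mx_creation // mulmxA.
Qed.

(** Cyclicity of the trace gives the two complementary idempotents the same trace against A, and
    they add up to the identity. *)
Lemma number_mx_half_trace A k b : A *m u k b = u k b *m A ->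
  \tr (A *m number_mx k b) *+ 2 = \tr A.
Proof.
move=> hA; rewrite mulr2n.
have {2}-> : \tr (A *m number_mx k b) = \tr (A *m number_mx k (~~ b)).
  by rewrite /number_mx negbK mulmxA hA -mulmxA mxtrace_mulC mulmxA.
by rewrite -mxtraceD -mulmxDr number_mx_compl mulmx1.
Qed.

(* The three commuting idempotents cut an 8-dimensional space in half three times. *)
Lemma number_mx_joint_row (b : 'I_3 -> bool) :
  exists r : 'rV[K]_8, forall y, (forall k, y *m (number_mx k (b k))^T = y) ->
    exists c, y = c *: r.
Proof.
pose p k := number_mx k (b k); pose k0 : 'I_3 := inord 0.
pose k1 : 'I_3 := inord 1; pose k2 : 'I_3 := inord 2.
have [k01 k02 k12] : [/\ k0 != k1, k0 != k2 & k1 != k2].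
  by split; apply/eqP => /(congr1 val); rewrite /= !inordK.
pose e := p k0 *m p k1 *m p k2.
have ee : e *m e = e.
  apply: idempotent_mul; last exact: number_mx_idem.
    have c12 : p k1 *m p k2 = p k2 *m p k1 by apply: number_mx_comm.
    have c02 : p k0 *m p k2 = p k2 *m p k0 by apply: number_mx_comm.
    move: (p k0) (p k1) (p k2) c12 c02 => a0 a1 a2 c12 c02.
    by rewrite -mulmxA c12 !mulmxA c02.
  apply: idempotent_mul; [exact: number_mx_comm|exact: number_mx_idem|].
  exact: number_mx_idem.
have tre : \tr e = 1.
  have h2 : \tr e *+ 2 = \tr (p k0 *m p k1).
    by apply: number_mx_half_trace; rewrite -mulmxA number_mx_creation // mulmxA
      number_mx_creation // -mulmxA.
  have h1 : \tr (p k0 *m p k1) *+ 2 = \tr (p k0).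
    by apply: number_mx_half_trace; rewrite number_mx_creation.
  have h0 : \tr (p k0) *+ 2 = 8%:R.
    by rewrite -[p k0]mul1mx number_mx_half_trace ?mxtrace1 // mul1mx mulmx1.
  have : 8%:R * \tr e = 8%:R.
    by rewrite mulr_natl -[in RHS]h0 -h1 -h2 -!mulrnA.
  by rewrite -{2}[8%:R]mulr1 => /(mulfI _); apply; rewrite pnatr_eq0.
have [||r hr] := @idempotent_trace1_row K 8 e^T.
- by rewrite -trmx_mul ee.
- by rewrite mxtrace_tr.
exists r => y hy; apply: hr; have hp k : y *m (p k)^T = y by apply: hy.
rewrite /e; move: (p k0) (p k1) (p k2) (hp k0) (hp k1) (hp k2) => a0 a1 a2 h0 h1 h2.
by rewrite !trmx_mul !mulmxA h2 h1 h0.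
Qed.

End CreationAnnihilation.

Section SpinWeights.
Variables (K : numFieldType) (gam : 'I_7 -> 'M[K]_8) (P0 : 'M[K]_7).
Hypothesis gam_clifford : clifford7 gam.
Hypothesis P0u : P0 \in unitmx.
Variables (e : 'I_3 -> bool -> 'I_7) (c : 'I_3 -> K).
Hypothesis e_inj : forall k l b b', (e k b == e l b') = (k == l) && (b == b').
Hypothesis gram_e : forall k b m,
  (P0 *m P0^T) (e k b) m = (m == e k (~~ b))%:R * c k.
Hypothesis c_neq0 : forall k, c k != 0.

Definition gam_row m : 'M[K]_8 := \sum_a P0 m a *: gam a.

Lemma gam_row_mul m n :
  gam_row m *m gam_row n = \sum_a \sum_b (P0 m a * P0 n b) *: (gam a *m gam b).
Proof.
rewrite /gam_row mulmx_suml; apply: eq_bigr => a _; rewrite mulmx_sumr.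
by apply: eq_bigr => b _; rewrite -scalemxAl -scalemxAr scalerA.
Qed.

Lemma gam_row_rel m n :
  gam_row m *m gam_row n + gam_row n *m gam_row m = (2%:R * (P0 *m P0^T) m n)%:M.
Proof.
rewrite !gam_row_mul [X in _ + X]exchange_big -big_split /=.
transitivity (\sum_a (P0 m a * P0 n a) *: (2%:R%:M : 'M[K]_8)).
  apply: eq_bigr => a _; rewrite -big_split /= (bigD1 a) //= big1 => [|b ba].
    by rewrite addr0 [P0 n a * _]mulrC -scalerDr gam_clifford eqxx.
  rewrite [P0 n b * _]mulrC -scalerDr gam_clifford eq_sym (negPf ba) mul0rn raddf0.
  by rewrite scaler0.
rewrite -scaler_suml scale_scalar_mx mulrC; congr (_ * _)%:M.
by rewrite mxE; apply: eq_bigr => a _; rewrite mxE.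
Qed.

(* For the isotropic orthogonal rows [e k true], [e k false] of [P0] this is a pair
   of creation and annihilation operators. *)
Definition spin_op k b : 'M[K]_8 :=
  (if b then 1 else (2%:R * c k)^-1) *: gam_row (e k b).

Lemma spin_op_rel k l b b' :
  spin_op k b *m spin_op l b' + spin_op l b' *m spin_op k b
    = ((k == l) && (b != b'))%:R%:M.
Proof.
rewrite /spin_op -!scalemxAl -!scalemxAr !scalerA [X in _ + X *: _]mulrC -scalerDr.
rewrite gam_row_rel gram_e e_inj [l == k]eq_sym.
have [<-|_] := eqVneq k l; last by rewrite /= mul0r mulr0 scale_scalar_mx mulr0.
have c2 : 2%:R * c k != 0 by rewrite mulf_neq0 ?c_neq0 // pnatr_eq0.
rewrite scale_scalar_mx; congr _%:M.
by case: b; case: b'; rewrite /= ?mul0r ?mulr0 // !mul1r ?mulr1 ?mulVf ?mulfV.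
Qed.

(** Z must be the skew matrix built from the two isotropic rows, so its spin image is the commutator
    of their Clifford elements divided by 4 c; the Clifford relation rewrites it as 1/2 minus the
    number operator. *)
Lemma spin7_weight k (Z : 'M[K]_7) :
  P0 *m Z = (delta_mx (e k true) (e k true) - delta_mx (e k false) (e k false)) *m P0 ->
  spin7 gam Z = 2%:R^-1%:M - number_mx spin_op k true.
Proof.
move=> hZ; set i := e k true in hZ *; set j := e k false in hZ *.
have c0 := c_neq0 k.
pose Z' := (c k)^-1 *: ((row j P0)^T *m row i P0 - (row i P0)^T *m row j P0).
have colE m n (l : 'I_7): (P0 *m (row m P0)^T *m row n P0) l =1 fun a => (P0 *m P0^T) m l * P0 n a.
  move=> a; rewrite mxE big_ord1 !mxE; congr (_ * _); apply: eq_bigr => b _.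
  by rewrite !mxE mulrC.
have dE m (l a : 'I_7) : (delta_mx m m *m P0) l a = (l == m)%:R * P0 m a.
  rewrite mxE (bigD1 m) //= big1 ?addr0 => [|n nm]; first by rewrite mxE eqxx andbT.
  by rewrite mxE (negPf nm) andbF mul0r.
have ZE : Z = Z'.
  rewrite -[Z](mulKmx P0u) hZ -[Z'](mulKmx P0u); congr (_ *m _).
  rewrite /Z' -scalemxAr mulmxBr mulmxBl !mulmxA; apply/matrixP => l a.
  rewrite mxE dE [X in _ + X]mxE dE [RHS]mxE [X in _ = _ * X]mxE [X in _ = _ * (_ + X)]mxE.
  rewrite !colE !gram_e -/i -/j /=.
  by field.
have -> : spin7 gam Z = (4%:R * c k)^-1 *: (gam_row j *m gam_row i - gam_row i *m gam_row j).
  rewrite /spin7 !gam_row_mul invfM -scalerA; congr (_ *: _).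
  rewrite -sumrB scaler_sumr; apply: eq_bigr => a _.
  rewrite -sumrB scaler_sumr; apply: eq_bigr => b _.
  rewrite ZE -scalerBl scalerA; congr (_ *: _).
  by rewrite /Z' !mxE !big_ord1 !mxE.
have -> : gam_row j *m gam_row i = (2%:R * c k)%:M - gam_row i *m gam_row j.
  by rewrite -[LHS](addrK (gam_row i *m gam_row j)) gam_row_rel gram_e eqxx mul1r.
rewrite /number_mx /spin_op /= -/i -/j -scalemxAr -scalemxAl scale1r.
rewrite -addrA -opprD -mulr2n -scaler_nat scalerBr scale_scalar_mx scalerA.
by congr (_%:M - _ *: _); field.
Qed.

Variable Z : 'I_3 -> 'M[K]_7.
Hypothesis Z_e : forall k, P0 *m Z k =
  (delta_mx (e k true) (e k true) - delta_mx (e k false) (e k false)) *m P0.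

Lemma spin7_number a k (y : 'rV[K]_8) : y *m (spin7 gam (Z k))^T = a *: y ->
  y *m (number_mx spin_op k true)^T = (2%:R^-1 - a) *: y.
Proof.
rewrite (spin7_weight (Z_e k)) linearB /= tr_scalar_mx mulmxBr mul_mx_scalar => E.
by rewrite scalerBl -E opprB addrC subrK.
Qed.

(** 1/2 - a is an eigenvalue of an idempotent, hence 0 or 1. *)
Lemma spin7_eigenvalue a k (y : 'rV[K]_8) : y != 0 ->
  y *m (spin7 gam (Z k))^T = a *: y -> a = 2%:R^-1 \/ a = - 2%:R^-1.
Proof.
move=> y0 /spin7_number hy.
have := congr1 (fun A => y *m A^T) (number_mx_idem spin_op_rel k true).
rewrite /= trmx_mul mulmxA hy -scalemxAl hy scalerA => /eqP.
rewrite -subr_eq0 -scalerBl scaler_eq0 (negPf y0) orbF subr_eq0 -{3}[_ - a]mulr1.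
have [/eqP|h /eqP/(mulfI h) E] := eqVneq (2%:R^-1 - a) 0.
  by rewrite subr_eq0 eq_sym => /eqP; left.
right; rewrite -[a](subKr 2%:R^-1) E.
by field.
Qed.

Lemma spin7_joint_row (a : 'I_3 -> K) : exists r : 'rV[K]_8,
  forall y, (forall k, y *m (spin7 gam (Z k))^T = a k *: y) -> exists s, y = s *: r.
Proof.
(* For the weight -1/2 the number operator fixes y, for 1/2 its complement does. *)
have [r hr] := number_mx_joint_row spin_op_rel (fun k => a k == - 2%:R^-1).
exists r => y hy; have [->|y0] := eqVneq y 0; first by exists 0; rewrite scale0r.
apply: hr => k; have yn := spin7_number (hy k).
have half : 2%:R^-1 + 2%:R^-1 = 1 :> K by field.
case: (spin7_eigenvalue y0 (hy k)) => ak; rewrite ak in yn *.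
  rewrite -addr_eq0 half oner_eq0 /=.
  have := number_mx_compl spin_op_rel k true => /(congr1 (fun A => y *m A^T)).
  by rewrite /= linearD /= mulmxDr yn subrr scale0r add0r trmx1 mulmx1.
by rewrite eqxx yn opprK half scale1r.
Qed.

End SpinWeights.

Definition sl2_form (K : fieldType) : 'M[K]_2 := delta_mx 0 1 - delta_mx 1 0.

Lemma sl2_form_sq (K : fieldType) : sl2_form K *m sl2_form K = - 1%:M.
Proof.
apply/matrixP => -[[|[|//]] ?] [[|[|//]] ?]; rewrite !mxE !big_ord_recl big_ord0 !mxE /=;
  by rewrite ?subr0 ?sub0r ?mulr0 ?mul0r ?addr0 ?add0r ?oppr0 ?mulrN1 ?mulN1r ?mulr1.
Qed.

Lemma sl2_form_tr (K : fieldType) : (sl2_form K)^T = - sl2_form K.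
Proof.
by apply/matrixP => i j; rewrite !mxE opprB [(j == _) && _]andbC [(j == 1) && _]andbC.
Qed.

(** sl(2) = sp(2): the traceless matrices are those preserving the symplectic form, which fits them
    into the odd block of the orthosymplectic pattern. *)
Lemma sl2_traceless (K : fieldType) (A : 'M[K]_2) :
  \tr A = 0 <-> (A *m sl2_form K)^T = A *m sl2_form K.
Proof.
have trA : \tr A = A 0 0 + A 1 1.
  by rewrite /mxtrace big_ord_recl big_ord1 (_ : lift _ _ = 1) //; apply: val_inj.
have E i : (A *m sl2_form K) i 0 = - A i 1 /\ (A *m sl2_form K) i 1 = A i 0.
  rewrite !mxE !big_ord_recl !big_ord0 !mxE /= (_ : lift ord0 0 = 1); last exact: val_inj.
  by rewrite ?subr0 ?sub0r ?mulr0 ?mul0r ?addr0 ?add0r ?oppr0 ?mulrN1 ?mulN1r ?mulr1.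
rewrite trA; split=> [h0|/matrixP/(_ 0 1)]; last first.
  by rewrite mxE (E 1).1 (E 0).2 => <-; rewrite addNr.
move: h0 => /eqP; rewrite addr_eq0 => /eqP h0.
have sym : (A *m sl2_form K) 1 0 = (A *m sl2_form K) 0 1 by rewrite (E 1).1 (E 0).2 h0.
have ord2 (i : 'I_2) : i = 0 \/ i = 1.
  by case: i => [[|[|//]] i2]; [left|right]; apply: val_inj.
move: (A *m _) sym => B sym; apply/matrixP => i j; rewrite mxE.
by case: (ord2 i) => ->; case: (ord2 j) => ->.
Qed.

Lemma exists_outside (T : finType) (t : T -> T) (r : seq T) :
  (forall i j, t i = i -> t j = j -> i = j) -> ((size r).+1 < #|T|)%N ->
  exists2 i, i \notin r & t i != i.
Proof.
move=> t_fix r_small; apply: contrapT => hN.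
pose F := [pred i | t i == i]; have F1 : (#|F| <= 1)%N.
  by apply/card_le1_eqP => i j; rewrite !inE => /eqP ti /eqP tj; apply: t_fix.
move: r_small; rewrite ltnNge => /negP; apply; rewrite -addn1.
apply: leq_trans (leq_add (card_size r) F1); rewrite -cardUI.
apply: leq_trans (leq_addr _ _); apply: subset_leq_card.
apply/fintype.subsetP => i _; rewrite !inE; apply/negPn/negP; rewrite negb_or => /andP[ir ti].
by apply: hN; exists i.
Qed.

Lemma mx_conjM (K : fieldType) n (P A B : 'M[K]_n) : P \in unitmx ->
  P *m A *m invmx P *m (P *m B *m invmx P) = P *m (A *m B) *m invmx P.
Proof. by move=> Pu; rewrite !mulmxA (mulmxKV Pu). Qed.

Lemma gram_conjV (K : fieldType) n (P J J' : 'M[K]_n) : P \in unitmx -> J *m J' = 1%:M ->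
  P *m J *m P^T *m (invmx P^T *m J' *m invmx P) = 1%:M.
Proof.
move=> Pu JJ; have Ptu : P^T \in unitmx by rewrite unitmx_tr.
by rewrite !mulmxA (mulmxK Ptu) -(mulmxA P) JJ mulmx1 (mulmxV Pu).
Qed.

Lemma diag2_mxB (K : fieldType) p q (A0 B0 : 'M[K]_p) (A1 B1 : 'M[K]_q) :
  diag2_mx A0 A1 - diag2_mx B0 B1 = diag2_mx (A0 - B0) (A1 - B1).
Proof. by rewrite /diag2_mx opp_block_mx add_block_mx !subr0. Qed.

(** * Root spaces of F(4): the even part so(7) + sl(2) and the spin weights of the odd part *)

Section F4EvenPart.
Variables (R : realType) (g : lieSuperalgebra R[i]) (h : {vspace g}).
Hypothesis h_cartan : cartan_subalgebra h.
Local Notation C := R[i].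
Variables (a : {linear g -> 'M[C]_2}) (s : {linear g -> 'M[C]_7}).
Hypothesis as_even : forall X, X \in gr g false -> \tr (a X) = 0 /\ (s X)^T = - s X.
Hypothesis as_onto : forall A Z, \tr A = 0 -> Z^T = - Z ->
  exists! X, [/\ X \in gr g false, a X = A & s X = Z].
Hypothesis a_bracket : {in gr g false &, forall X Y,
  a (bracket X Y) = a X *m a Y - a Y *m a X}.
Hypothesis s_bracket : {in gr g false &, forall X Y,
  s (bracket X Y) = s X *m s Y - s Y *m s X}.

Let h0 H : H \in h -> H \in gr g false. Proof. exact: h_even h_cartan H. Qed.

Let even_weights : {in gr g false, forall X,
  sum_of (fun Y => Y \in gr g false /\ weight_vector h Y) X}.
Proof.
move=> X /(homogeneous_weight_family h_cartan)[r [Y [_ ->] hY]].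
by apply: sum_of_sum => i _; apply: sum_of1; have [] := hY i; split=> //; exists i.
Qed.

Let hsub : (h <= gr g false)%VS. Proof. exact/subvP/h0. Qed.

Lemma so7_diagonalization : exists2 P : 'M[C]_7, P \in unitmx &
  {in h, forall H i j, i != j -> (P *m s H *m invmx P) i j = 0}.
Proof.
have [v|P Pu hP] := @eigenrow_basis _ 7 (subvs_of h) (fun H => s (vsval H)); last first.
  by exists P => // H Hh i j ij; have := hP (vsproj h H) _ _ ij; rewrite vsprojK.
move: v; apply: (weight_rows h_cartan (linearP s) hsub even_weights) => //.
  by move=> H X /h0 H0 X0; apply: s_bracket.
move=> E [w w0 Ew] ED EZ ES _.
have {}ES u Z : Z^T = - Z -> E u -> E (u *m Z).
  move=> hZ; have [|X [[X0 _ <-] _]] := as_onto (A := 0) _ hZ; first exact: raddf0.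
  exact: ES.
pose Z i j : 'M[C]_7 := delta_mx i j - delta_mx j i.
have Zt i j : (Z i j)^T = - Z i j by rewrite linearB /= !trmx_delta opprB.
have uZ (u : 'rV[C]_7) i j : u *m Z i j = u 0 i *: delta_mx 0 j - u 0 j *: delta_mx 0 i.
  have ud k l : u *m delta_mx k l = u 0 k *: delta_mx 0 l.
    by rewrite [u in LHS]row_sum_delta mulmx_suml (bigD1 k) //= big1 ?addr0 => [|m mk];
      rewrite -scalemxAl ?mul_delta_mx // mul_delta_mx_0 // scaler0.
  by rewrite mulmxBr !ud.
have dE m l : (delta_mx 0 m : 'rV[C]_7) 0 l = (m == l)%:R by rewrite mxE /= eq_sym.
have /rV0Pn[i wi] := w0.
(* For a third index j, [w *m Z i j *m Z j k] is the k-th unit row times [w 0 i], which is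
   nonzero. *)
have Ek k : k != i -> E (delta_mx 0 k).
  move=> ki; have [||j] := @exists_outside 'I_7 (fun j => j + 1) [:: i; k].
  - by move=> x y /eqP; rewrite -subr_eq0 addrAC subrr add0r.
  - by rewrite card_ord.
  rewrite !inE negb_or => /andP[ji jk] _.
  have := EZ (w 0 i)^-1 _ (ES _ _ (Zt j k) (ES _ _ (Zt i j) Ew)).
  rewrite (uZ w) mulmxBl -!scalemxAl !uZ !dE eqxx (negPf jk) (eq_sym i j) (negPf ji).
  rewrite (eq_sym i k) (negPf ki) !scale0r scale1r !subr0 scaler0.
  by rewrite subr0 scalerA mulVf // scale1r.
have Ed k : E (delta_mx 0 k).
  have [->|/Ek //] := eqVneq k i.
  have [||j] := @exists_outside 'I_7 (fun j => j + 1) [:: i].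
  - by move=> x y /eqP; rewrite -subr_eq0 addrAC subrr add0r.
  - by rewrite card_ord.
  rewrite !inE => ji _; have := ES _ _ (Zt j i) (Ek _ ji).
  by rewrite uZ !dE eqxx (negPf ji) scale0r scale1r subr0.
move=> v; rewrite (row_sum_delta v); elim/big_ind: _ => [|x y|k _]; first 1 last.
- exact: ED.
- exact: EZ.
by have := EZ 0 _ Ew; rewrite scale0r.
Qed.

Lemma sl2_diagonalization : exists2 P : 'M[C]_2, P \in unitmx &
  {in h, forall H i j, i != j -> (P *m a H *m invmx P) i j = 0}.
Proof.
have [v|P Pu hP] := @eigenrow_basis _ 2 (subvs_of h) (fun H => a (vsval H)); last first.
  by exists P => // H Hh i j ij; have := hP (vsproj h H) _ _ ij; rewrite vsprojK.
move: v; apply: (weight_rows h_cartan (linearP a) hsub even_weights) => //.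
  by move=> H X /h0 H0 X0; apply: a_bracket.
move=> E [w w0 Ew] ED EZ ES _ v.
have {}ES u A : \tr A = 0 -> E u -> E (u *m A).
  move=> hA; have [|X [[X0 <- _] _]] := as_onto (Z := 0) hA; last exact: ES.
  by rewrite trmx0 oppr0.
have [B <-] := row_transitive v w0.
have -> : w *m B = w *m (B - (\tr B / 2%:R)%:M) + (\tr B / 2%:R) *: w.
  by rewrite mulmxBr mul_mx_scalar subrK.
apply: ED; last exact: EZ.
apply: ES => //; rewrite linearB /= mxtrace_scalar -[_ *+ 2]mulr_natr divfK ?subrr //.
by rewrite pnatr_eq0.
Qed.

Variables (P0 : 'M[C]_7) (P1 : 'M[C]_2).
Hypotheses (P0u : P0 \in unitmx) (P1u : P1 \in unitmx).
Hypothesis s_diag : {in h, forall H i j, i != j -> (P0 *m s H *m invmx P0) i j = 0}.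
Hypothesis a_diag : {in h, forall H i j, i != j -> (P1 *m a H *m invmx P1) i j = 0}.
Local Notation J := (sl2_form C).

(** so(7) + sl(2) is placed in block form as the even part of osp(7|2), with the transported Gram
    matrices below, so that the analysis of diagonal Cartan subalgebras applies. *)
Definition even_mx X : 'M[C]_(7 + 2) :=
  diag2_mx (P0 *m s X *m invmx P0) (P1 *m a X *m invmx P1).
Definition even_gram : 'M[C]_(7 + 2) := diag2_mx (P0 *m P0^T) (P1 *m J *m P1^T).
Definition even_gram_inv : 'M[C]_(7 + 2) :=
  diag2_mx (invmx P0^T *m invmx P0) (- (invmx P1^T *m J *m invmx P1)).
Local Notation f := even_mx.
Local Notation K := even_gram.
Local Notation G := even_gram_inv.

Let P0tu : P0^T \in unitmx. Proof. by rewrite unitmx_tr. Qed.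
Let P1tu : P1^T \in unitmx. Proof. by rewrite unitmx_tr. Qed.

Lemma even_gramV : K *m G = 1%:M.
Proof.
rewrite diag2_mxM -(diag2_mx1 C 7 2) -mulNmx -mulmxN; congr diag2_mx.
  by have := gram_conjV P0u (mulmx1 1%:M); rewrite !mulmx1.
by apply: gram_conjV; rewrite // mulmxN sl2_form_sq opprK.
Qed.

Lemma even_Vgram : G *m K = 1%:M.
Proof. exact: mulmx1C even_gramV. Qed.

Lemma diag2_par0 (A : 'M[C]_7) (B : 'M[C]_2) i j :
  par i != par j -> diag2_mx A B i j = 0.
Proof.
move=> ij; apply: ((mx_parity_entry false _).1 (diag2_mx_even A B)).
by move: ij; case: (par i); case: (par j).
Qed.

Lemma even_gram_inv_par i j : G i j != 0 -> par i = par j.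
Proof. by apply: contraNeq => /diag2_par0 ->. Qed.

Lemma even_gram_sym i j : K i j = (-1) ^+ par i * K j i.
Proof.
apply: diag2_sym_entry; first by rewrite trmx_mul trmxK.
by rewrite !trmx_mul trmxK sl2_form_tr mulNmx mulmxN mulmxA.
Qed.

Lemma even_gram_inv_sym i j : G i j = (-1) ^+ par i * G j i.
Proof.
apply: diag2_sym_entry; rewrite ?trmxN !trmx_mul !trmx_inv !trmxK //.
by rewrite sl2_form_tr mulNmx mulmxN mulmxA.
Qed.

Lemma even_mx_linear : linear f.
Proof.
move=> c X Y; rewrite /even_mx (linearP a) (linearP s) /= !mulmxDr !mulmxDl -!scalemxAr -!scalemxAl.
by rewrite /diag2_mx scale_block_mx add_block_mx !scaler0 !addr0.
Qed.

Lemma even_mxZ c X : f (c *: X) = c *: f X.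
Proof.
have f0 : f 0 = 0.
  by rewrite /even_mx (linear0 a) (linear0 s) !mulmx0 !mul0mx; apply: block_mx0.
by have := even_mx_linear c X 0; rewrite f0 !addr0.
Qed.

Lemma even_mx_diag : {in h, forall H i j, i != j -> f H i j = 0}.
Proof. by move=> H Hh; apply: diag2_mx_offdiag; [apply: s_diag|apply: a_diag]. Qed.

Lemma even_mx_bracket : {in h & gr g false, forall H X,
  f (bracket H X) = f H *m f X - f X *m f H}.
Proof.
move=> H X /h0 H0 X0; rewrite /even_mx (a_bracket H0 X0) (s_bracket H0 X0).
move: (s H) (s X) (a H) (a X) => sH sX aH aX; rewrite !diag2_mxM !(mx_conjM _ _ P0u).
rewrite !(mx_conjM _ _ P1u) !mulmxBr !mulmxBl.
exact/esym/diag2_mxB.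
Qed.

Lemma even_mx_eqP X Y : f X = f Y -> s X = s Y /\ a X = a Y.
Proof.
case/eq_block_mx => hs _ _ ha; split.
  by move: hs; move/(can_inj (mulmxKV P0u))/(can_inj (mulKmx P0u)).
by move: ha; move/(can_inj (mulmxKV P1u))/(can_inj (mulKmx P1u)).
Qed.

Lemma even_inj : {in gr g false &, forall X Y, s X = s Y -> a X = a Y -> X = Y}.
Proof.
move=> X Y X0 Y0 sXY aXY; have [aX sX] := as_even X0.
have [Z [_ Zu]] := as_onto aX sX.
by rewrite -(Zu X) // -(Zu Y) // sXY aXY.
Qed.

Lemma even_mx_inj : {in gr g false, forall X, f X = 0 -> X = 0}.
Proof.
move=> X X0 fX; have [|sX aX] := @even_mx_eqP X 0.
  by rewrite fX -(scale0r (0 : g)) even_mxZ scale0r.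
by apply: even_inj => //; apply: mem0v.
Qed.

Lemma even_mx_gram X : f X *m K = diag2_mx (P0 *m s X *m P0^T) (P1 *m (a X *m J) *m P1^T).
Proof. by rewrite diag2_mxM !mulmxA !mulmxKV. Qed.

Lemma even_mx_superskew : {in gr g false, forall X, superskew (f X *m K)}.
Proof.
move=> X /as_even[/sl2_traceless aX sX]; rewrite even_mx_gram; apply/superskew_block.
split; last by rewrite trmx0 oppr0.
- by rewrite !trmx_mul trmxK sX mulNmx mulmxN mulmxA.
- by rewrite trmx_mul (trmx_mul P1) aX trmxK !mulmxA.
Qed.

Lemma even_mx_onto S : superskew S -> mx_parity false S ->
  exists2 X, X \in gr g false & f X *m K = S.
Proof.
rewrite -(submxK S) => /superskew_block[h1 h2 _] [].
rewrite block_mxKur block_mxKdl => -> ->.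
move: (ulsubmx S) (drsubmx S) h1 h2 => S0 S1 h1 h2.
have [||X [[X0 aX sX] _]] := as_onto (A := - (invmx P1 *m S1 *m invmx P1^T *m J))
    (Z := invmx P0 *m S0 *m invmx P0^T).
- apply/sl2_traceless; rewrite mulNmx -(mulmxA _ J) sl2_form_sq mulmxN mulmx1 opprK.
  by rewrite !trmx_mul !trmx_inv trmxK h2 mulmxA.
- by rewrite !trmx_mul !trmx_inv trmxK h1 mulNmx mulmxN mulmxA.
exists X => //; rewrite even_mx_gram sX aX /diag2_mx; congr block_mx.
  by rewrite !mulmxA mulmxV // mul1mx mulmxKV.
rewrite mulNmx -(mulmxA _ J) sl2_form_sq !mulmxN mulmx1 opprK.
by rewrite !mulmxA mulmxV // mul1mx mulmxKV.
Qed.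

Let weight_sep := diag_weight_separates h_cartan even_gramV even_Vgram (@diag2_par0 _ _)
  even_gram_inv_par even_gram_sym even_gram_inv_sym even_mxZ even_mx_diag
  even_mx_bracket even_mx_inj even_mx_superskew even_mx_onto.

Let even_pairing := diag_weight_pairing h_cartan even_gramV even_Vgram (@diag2_par0 _ _)
  even_gram_inv_par even_gram_sym even_gram_inv_sym even_mxZ even_mx_diag
  even_mx_bracket even_mx_inj even_mx_superskew even_mx_onto.

Lemma even_gram_weight lam i j : diag_weights h f lam -> K i j != 0 -> lam i + lam j = 0.
Proof.
move=> [H Hh HE] Kij; have fd := even_mx_diag Hh.
have := congr1 (fun A : 'M_(7 + 2) => A i j) (diag_anticomm h_cartan (@diag2_par0 _ _)
  even_gram_sym even_mx_diag even_mx_superskew Hh).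
have E1 := offdiag_mull K i j fd; have E2 := offdiag_mulr K i j fd.
rewrite /= [RHS]mxE E1 E2 -mulNr => /(mulIf Kij) e.
by rewrite -!HE e addNr.
Qed.

(** The pairing of indices is an involution with at most one fixed point, so the seven indices of
    so(7) contain three disjoint pairs. Gram entries vanish unless weights cancel, hence the rows of
    a pair are isotropic and meet only each other; the pairing also puts the diagonal with 1 and -1
    on a pair into h. *)
Lemma even_weight_spin : exists (e : 'I_3 -> bool -> 'I_7) (c : 'I_3 -> C) (D : 'I_3 -> g),
  [/\ forall k l b b', (e k b == e l b') = (k == l) && (b == b'),
      forall k b m, (P0 *m P0^T) (e k b) m = (m == e k (~~ b))%:R * c k,
      forall k, c k != 0 &
      forall k, D k \in h /\ forall i, f (D k) i i =
        (i == lshift 2 (e k true))%:R - (i == lshift 2 (e k false))%:R].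
Proof.
have [T [T_pair T_fix]] := even_pairing.
have T_opp i lam : T i != i -> diag_weights h f lam -> lam i + lam (T i) = 0.
  by move=> /negPf Ti; have := T_pair i; rewrite Ti => -[_ _]; apply.
have TK i : T i != i -> T (T i) = i.
  move=> Ti; have [e|ne] := eqVneq (T (T i)) (T i).
    have := T_pair (T i); rewrite e eqxx => -[_ fx]; apply: weight_sep => lam hl.
    by have := T_opp _ _ Ti hl; rewrite (fx _ hl) addr0 => ->.
  apply: weight_sep => lam hl; apply: (addrI (lam (T i))).
  by rewrite (T_opp _ _ ne hl) addrC (T_opp _ _ Ti hl).
have T_gram i m : T i != i -> K i m != 0 -> m = T i.
  move=> Ti Kim; apply: weight_sep => lam hl; apply: (addrI (lam i)).
  by rewrite (even_gram_weight hl Kim) (T_opp _ _ Ti hl).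
have : forall i : 'I_7, exists j, T (lshift 2 i) = lshift 2 j.
  move=> i; case: (split_ordP (T (lshift 2 i))) => j E; first by exists j.
  have := T_pair (lshift 2 i); rewrite E.
  rewrite eq_rlshift => -[]; by rewrite par_lshift par_rshift.
move=> /boolp.choice[t tE].
have tT i : (T (lshift 2 i) == lshift 2 i) = (t i == i) by rewrite tE eq_lshift.
have tK i : t i != i -> t (t i) = i.
  by rewrite -tT => /TK; rewrite !tE => /lshift_inj.
have t_fix i j : t i = i -> t j = j -> i = j.
  by move=> ti tj; apply/(@lshift_inj 7 2)/T_fix; rewrite tE ?ti ?tj.
have pick r : (size r < 6)%N -> exists2 i, i \notin r & t i != i.
  by move=> hr; apply: exists_outside t_fix _; rewrite card_ord.
have ext r : (forall i, i \in r -> t i \in r) -> uniq r -> (size r < 6)%N ->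
    exists i, [/\ t i != i, uniq (i :: t i :: r) &
      forall j, j \in i :: t i :: r -> t j \in i :: t i :: r].
  move=> tr ur /pick[i ir ti]; exists i; split=> //=.
    rewrite inE negb_or eq_sym ti ir ur andbT /=.
    by rewrite andbT; apply: contra ir => /tr; rewrite tK.
  move=> j; rewrite !inE => /or3P[/eqP->|/eqP->|/tr->]; rewrite ?tK ?eqxx ?orbT //.
have [i0 [n0 u0 c0]] := ext [::] (fun i => id) isT isT.
have [i1 [n1 u1 c1]] := ext _ c0 u0 isT.
have [i2 [n2 u2 _]] := ext _ c1 u1 isT.
set L := (i2 :: _) in u2.
(* The list is i2, t i2, i1, t i1, i0, t i0: pair k occupies positions 2k for [true] and 2k + 1 for
   [false]. *)
pose e (k : 'I_3) (b : bool) := nth i0 L (k.*2 + ~~ b).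
have te k b : t (e k b) = e k (~~ b).
  by rewrite /e; case: k => [[|[|[|//]]] ?]; case: b; rewrite /= ?tK.
have e_inj k l b b' : (e k b == e l b') = (k == l) && (b == b').
  rewrite /e nth_uniq //; case: k => [[|[|[|//]]] ?]; case: l => [[|[|[|//]]] ?] //;
    by case: b b' => [] [].
have ne k b : t (e k b) != e k b by rewrite te e_inj eqxx; case: b.
exists e, (fun k => (P0 *m P0^T) (e k true) (e k false)).
have Kul i j : K (lshift 2 i) (lshift 2 j) = (P0 *m P0^T) i j by apply: block_mxEul.
have gram_sym i j : (P0 *m P0^T) i j = (P0 *m P0^T) j i.
  by rewrite -[in RHS](trmxK P0) -trmx_mul [RHS]mxE trmxK.
have gram0 k b m : m != e k (~~ b) -> (P0 *m P0^T) (e k b) m = 0.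
  rewrite -te; apply: contraNeq; rewrite -Kul => /T_gram E; apply/eqP/(@lshift_inj 7 2).
  by rewrite -tE E // tT ne.
have : forall k, exists D, D \in h /\ forall i, f D i i =
        (i == lshift 2 (e k true))%:R - (i == lshift 2 (e k false))%:R.
  move=> k; have := T_pair (lshift 2 (e k true)); rewrite tT (negPf (ne k true)) tE te.
  by case=> _ [D Dh DE] _; exists D.
move=> /boolp.choice[D hD]; exists D.
split=> [k l b b'|k b m|k|k]; first exact: e_inj; last exact: hD.
- have [->|/gram0->] := eqVneq m (e k (~~ b)); last by rewrite mul0r.
  by rewrite mul1r; case: b.
- apply/eqP => z; have /matrixP/(_ (lshift 2 (e k true)) (lshift 2 (e k true))) := even_gramV.
  rewrite [RHS]mxE eqxx mxE big1 => [/eqP|j _]; first by rewrite eq_sym oner_eq0.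
  case: (split_ordP j) => j' ->; last by rewrite /even_gram block_mxEur mxE mul0r.
  have [->|jk] := eqVneq j' (e k false); first by rewrite Kul z mul0r.
  by rewrite Kul (gram0 k true) // mul0r.
Qed.

Lemma s_row H : H \in h -> forall i j,
  (P0 *m s H) i j = f H (lshift 2 i) (lshift 2 i) * P0 i j.
Proof.
move=> Hh i j; rewrite -(mulmxKV P0u (P0 *m s H)).
by rewrite (offdiag_mull P0 i j (s_diag Hh)) /even_mx block_mxEul.
Qed.

Lemma a_row H : H \in h -> forall i j,
  (P1 *m a H) i j = f H (rshift 7 i) (rshift 7 i) * P1 i j.
Proof.
move=> Hh i j; rewrite -(mulmxKV P1u (P1 *m a H)).
by rewrite (offdiag_mull P1 i j (a_diag Hh)) /even_mx block_mxEdr.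
Qed.

(** The two odd indices are paired with each other, as an odd index is not fixed; the diagonal with
    1 and -1 there is the coroot of sl(2) and is zero on so(7). *)
Lemma even_weight_sl2 : exists (D : g) (l : 'I_2 -> C),
  [/\ D \in h, s D = 0, l 0 != l 1 & forall i j, (P1 *m a D) i j = l i * P1 i j].
Proof.
have [T [T_pair _]] := even_pairing.
have := T_pair (rshift 7 0); case: eqP => [_|/eqP Tr].
  by rewrite par_rshift => -[].
case=> pT [D Dh DE] _; exists D, (fun i => f D (rshift 7 i) (rshift 7 i)).
move: pT Tr DE; case: (split_ordP (T (rshift 7 0))) => t -> pT Tr DE.
  by move: pT; rewrite par_lshift par_rshift.
split=> //; last exact: a_row.
- suff E : P0 *m s D = 0 by rewrite -[s D](mulKmx P0u) E mulmx0.
  by apply/matrixP => i j; rewrite s_row // DE !eq_lrshift subrr mul0r mxE.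
- rewrite !DE !eq_rshift eqxx; rewrite eq_rshift in Tr.
  have -> : t = 1 by case: t Tr {DE pT} => [[|[|//]]] ? // _; apply: val_inj.
  by rewrite /= subr0 sub0r -subr_eq0 opprK -(natrD _ 1 1) pnatr_eq0.
Qed.

Lemma mx_entryP (F : nzRingType) m n (c : F) (A B : 'M[F]_(m, n)) i j :
  (c *: A + B) i j = c * A i j + B i j.
Proof. by rewrite !mxE. Qed.

Lemma even_root_line (alpha : hdual h) X Y : alpha != 0 -> X \in gr g false ->
  Y \in gr g false -> X \in rootspace alpha -> Y \in rootspace alpha -> X != 0 ->
  exists c, Y = c *: X.
Proof.
move=> a0; apply: (@root_line_coords _ _ _ (gr g false) ('I_(7 + 2) * 'I_(7 + 2))%type
  (fun ij X => (f X *m K) ij.1 ij.2) _ _ _ alpha X Y a0).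
- move=> [i j] c {}X {}Y /=; rewrite even_mx_linear mulmxDl -scalemxAl.
  exact: mx_entryP.
- move=> {}X X0 hX; apply: even_mx_inj => //; rewrite -[f X]mulmx1 -even_gramV mulmxA.
  suff -> : f X *m K = 0 by rewrite mul0mx.
  by apply/matrixP => i j; rewrite (hX (i, j)) mxE.
move=> {}alpha [i j] [k l] {}X {}Y {}a0 X0 Y0 Xa Ya /=.
exact: (diag_coords_proportional h_cartan even_gramV even_Vgram (@diag2_par0 _ _)
  even_gram_inv_par even_gram_sym even_gram_inv_sym even_mxZ even_mx_diag
  even_mx_bracket even_mx_inj even_mx_superskew even_mx_onto a0 even_mx_bracket
  even_mx_superskew X0 Y0 Xa Ya).
Qed.

Lemma even_root_weight (alpha : hdual h) X : X \in gr g false -> X \in rootspace alpha ->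
  X != 0 -> exists i j, forall H, H \in h -> alpha (vsproj h H) = f H i i + f H j j.
Proof.
move=> X0 Xa Xn; have [i [j nz]] : exists i j, (f X *m K) i j != 0.
  apply: contrapT => /forallNP hN; move/negP: Xn; apply; apply/eqP/even_mx_inj => //.
  rewrite -[f X]mulmx1 -even_gramV mulmxA; suff -> : f X *m K = 0 by rewrite mul0mx.
  apply/matrixP => i j; rewrite [RHS]mxE; apply/eqP.
  by have /forallNP/(_ j)/negP := hN i; rewrite negbK.
exists i, j => H Hh.
rewrite (diag_root_weight h_cartan (@diag2_par0 _ _) even_gram_sym even_mxZ even_mx_diag
  even_mx_superskew Xa _ nz) (vsprojK Hh) //.
exact: even_mx_bracket.
Qed.

Variables (gam : 'I_7 -> 'M[C]_8) (o : {linear g -> 'M[C]_(2, 8)}).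
Hypothesis gam_clifford : clifford7 gam.
Hypothesis o_onto : forall B, exists! X, X \in gr g true /\ o X = B.
Hypothesis o_bracket : forall X Y, X \in gr g false -> Y \in gr g true ->
  o (bracket X Y) = a X *m o Y + o Y *m (spin7 gam (s X))^T.

Lemma odd_inj X : X \in gr g true -> o X = 0 -> X = 0.
Proof.
move=> X1 X0; have [Y [_ Yu]] := o_onto 0.
by rewrite -(Yu X) // -(Yu 0) // linear0 mem0v.
Qed.

(** Since [a (D k)] = 0, each row of [o X] is a joint eigenrow of the three spin operators, hence a
    multiple of one row r. The element [D0] acts through sl(2) alone, with two distinct eigenvalues,
    so [P1 *m o X] has at most one nonzero row. *)
Lemma odd_weights : exists D : 'I_3 -> g, [/\ forall k, D k \in h,
  forall (alpha : hdual h) X Y, X \in gr g true -> Y \in gr g true ->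
    X \in rootspace alpha -> Y \in rootspace alpha -> X != 0 -> exists c, Y = c *: X,
  forall (alpha : hdual h) X k, X \in gr g true -> X \in rootspace alpha -> X != 0 ->
    alpha (vsproj h (D k)) = 2%:R^-1 \/ alpha (vsproj h (D k)) = - 2%:R^-1 &
  forall k i, exists n m : nat, f (D k) i i = n%:R - m%:R].
Proof.
have [e [c [D [e_inj gram_e c0 hD]]]] := even_weight_spin.
have [D0 [l [D0h sD0 l01 aD0]]] := even_weight_sl2.
have aD k : a (D k) = 0.
  have [Dh DE] := hD k; suff E : P1 *m a (D k) = 0 by rewrite -[a _](mulKmx P1u) E mulmx0.
  by apply/matrixP => i j; rewrite a_row // DE !eq_rlshift subrr mul0r mxE.
have sD k : P0 *m s (D k) =
    (delta_mx (e k true) (e k true) - delta_mx (e k false) (e k false)) *m P0.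
  have [Dh DE] := hD k; apply/matrixP => i j; rewrite s_row // DE !eq_lshift.
  have dE (m : 'I_7) : (delta_mx m m *m P0) i j = (i == m)%:R * P0 i j.
    rewrite mxE (bigD1 m) //= big1 ?addr0 => [|n nm].
      by rewrite mxE eqxx andbT; case: eqP => [->|_]; rewrite ?mul0r.
    by rewrite mxE (negPf nm) andbF mul0r.
  by rewrite mulmxBl [RHS]mxE [X in _ = _ + X]mxE !dE mulrBl.
have rows (alpha : hdual h) X k i : X \in gr g true -> X \in rootspace alpha ->
    row i (o X) *m (spin7 gam (s (D k)))^T = alpha (vsproj h (D k)) *: row i (o X).
  move=> X1 Xa; have [Dh _] := hD k; have := o_bracket (h0 Dh) X1.
  rewrite (rootspace_ad Xa Dh) linearZ aD mul0mx add0r => E.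
  by rewrite -row_mul -E; apply/rowP => j; rewrite !mxE.
exists D; split=> //.
- by move=> k; have [] := hD k.
- move=> alpha X Y X1 Y1 Xa Ya Xn.
  have [r hr] := spin7_joint_row gam_clifford P0u e_inj gram_e c0 sD
    (fun k => alpha (vsproj h (D k))).
  (* Only the row whose [D0]-eigenvalue is the value of alpha can survive; if that is not row 0,
     then row 1 is the only candidate. *)
  pose i0 : 'I_2 := if l 0 == alpha (vsproj h D0) then 0 else 1.
  have l_ne i : i != i0 -> l i != alpha (vsproj h D0).
    have i01 j : j != 0 -> j = 1 :> 'I_2.
      by case: j => [[|[|//]]] ? // _; apply: val_inj.
    have i10 j : j != 1 -> j = 0 :> 'I_2.
      by case: j => [[|[|//]]] ? // _; apply: val_inj.
    rewrite /i0; case: (eqVneq (l 0) (alpha (vsproj h D0))) => [<- /i01->|l0 /i10->//].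
    by rewrite eq_sym.
  have line Z : Z \in gr g true -> Z \in rootspace alpha ->
      exists z, P1 *m o Z = z *: (delta_mx i0 0 *m r).
    move=> Z1 Za; have := o_bracket (h0 D0h) Z1.
    have -> : spin7 gam (s D0) = 0.
      by rewrite sD0 /spin7 big1 ?scaler0 // => m _; rewrite big1 // => n _; rewrite mxE scale0r.
    rewrite trmx0 mulmx0 addr0 (rootspace_ad Za D0h) linearZ /= => E.
    have /boolp.choice[y hy] : forall m, exists y, row m (o Z) = y *: r.
      by move=> m; apply: hr => k; apply: rows.
    exists (\sum_m P1 i0 m * y m); apply/matrixP => i j.
    have -> w : (w *: (delta_mx i0 0 *m r)) i j = w * ((i == i0)%:R * r 0 j).
      by rewrite mxE; congr (_ * _); rewrite mxE big_ord1 mxE eqxx andbT.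
    have [->|ii0] := eqVneq i i0; last first.
      rewrite mul0r mulr0; have := congr1 (fun A => (P1 *m A) i j) E.
      rewrite /= -scalemxAr mulmxA [LHS]mxE.
      have -> : (P1 *m a D0 *m o Z) i j = l i * (P1 *m o Z) i j.
        rewrite !mxE mulr_sumr; apply: eq_bigr => m _.
        by rewrite aD0 mulrA.
      move/eqP; rewrite -subr_eq0 -mulrBl mulf_eq0 subr_eq0 eq_sym (negPf (l_ne i ii0)).
      by move/eqP.
    rewrite mul1r mxE mulr_suml; apply: eq_bigr => m _.
    by have /rowP/(_ j) := hy m; rewrite !mxE => ->; rewrite mulrA.
  have [x hx] := line X X1 Xa; have [y hy] := line Y Y1 Ya.
  have x0 : x != 0.
    apply: contraNneq Xn => x0; apply/eqP/odd_inj => //.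
    by rewrite -[o X](mulKmx P1u) hx x0 scale0r mulmx0.
  exists (y / x); apply/eqP; rewrite -subr_eq0; apply/eqP/odd_inj.
    by rewrite rpredB // rpredZ.
  rewrite linearB linearZ /= -[o Y](mulKmx P1u) -[o X](mulKmx P1u) hx hy.
  by rewrite -!scalemxAr scalerA (divfK x0) subrr.
- move=> alpha X k X1 Xa Xn.
  have [i oi] : exists i, row i (o X) != 0.
    apply: contrapT => /forallNP hN; move/negP: Xn; apply; apply/eqP/odd_inj => //.
    apply/row_matrixP => i; rewrite row0; apply/eqP.
    by have /negP := hN i; rewrite negbK.
  exact: (spin7_eigenvalue gam_clifford P0u e_inj gram_e c0 sD oi (rows _ _ _ _ X1 Xa)).
- move=> k i; have [_ ->] := hD k.
  by exists (i == lshift 2 (e k true)), (i == lshift 2 (e k false)).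
Qed.

(** The value at [D 0] tells the parities apart, so X and Y are homogeneous of the same parity,
    where root spaces are lines. An odd weight takes the value 1/2 or -1/2 there and cannot
    vanish. *)
Lemma F4_even_odd_mult : root_multiplicity_free h.
Proof.
have [D [Dh line half int]] := odd_weights.
split=> [alpha X Y a0 Xa Ya Xn|X X1 hX]; last first.
  apply/eqP/negPn/negP => Xn; have Xz : X \in rootspace (0 : hdual h).
    by apply/rootspaceP => H; rewrite zero_lfunE scale0r hX ?subvsP.
  have [] := half 0 X 0 X1 Xz Xn; rewrite zero_lfunE => /esym/eqP.
    by rewrite invr_eq0 pnatr_eq0.
  by rewrite oppr_eq0 invr_eq0 pnatr_eq0.
have [X0 [X1 [X00 X11 XE]]] := gr_split X; have [Y0 [Y1 [Y00 Y11 YE]]] := gr_split Y.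
have := Xa; rewrite XE => /(rootspace_parts h_cartan X00 X11)[X0a X1a].
have := Ya; rewrite YE => /(rootspace_parts h_cartan Y00 Y11)[Y0a Y1a].
have excl Z0 Z1 : Z0 \in gr g false -> Z1 \in gr g true -> Z0 \in rootspace alpha ->
    Z1 \in rootspace alpha -> Z0 = 0 \/ Z1 = 0.
  (* D takes integral values on even weights, half-integral ones on odd weights. *)
  move=> Z00 Z11 Z0a Z1a; have [->|n0] := eqVneq Z0 0; first by left.
  right; apply/eqP/negPn/negP => n1.
  have [i [j hij]] := even_root_weight Z00 Z0a n0.
  have [n [m nm]] := int 0 i; have [n' [m' nm']] := int 0 j.
  have : alpha (vsproj h (D 0)) = (n + n')%:R - (m + m')%:R.
    by rewrite hij // nm nm' !natrD opprD addrACA.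
  move: (n + n')%N (m + m')%N => u v E.
  (* Doubling gives 1 + 2q = 2p, impossible modulo 2. *)
  have parity (p q : nat) : 2%:R^-1 != p%:R - q%:R :> C.
    apply/eqP => /(congr1 (fun x => x * 2%:R + q%:R * 2%:R)).
    rewrite mulVf ?pnatr_eq0 // -mulrDl subrK -!natrM -(natrD _ 1) => /eqP.
    rewrite eqr_nat => /eqP /(congr1 odd).
    by rewrite add1n /= !oddM !andbF.
  have := half _ _ 0 Z11 Z1a n1; rewrite E => -[] h2.
    by have := parity u v; rewrite h2 eqxx.
  by have := parity v u; rewrite -opprB h2 opprK eqxx.
have [X0z|X0n] := eqVneq X0 0.
  have X1n : X1 != 0 by move: Xn; rewrite XE X0z add0r.
  have Y0z : Y0 = 0 by case: (excl _ _ Y00 X11 Y0a X1a) => // X1z; rewrite X1z eqxx in X1n.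
  have [c cE] := line _ _ _ X11 Y11 X1a Y1a X1n.
  by exists c; rewrite X0z Y0z !add0r.
have X1z : X1 = 0 by case: (excl _ _ X00 X11 X0a X1a) => // z; rewrite z eqxx in X0n.
have Y1z : Y1 = 0 by case: (excl _ _ X00 Y11 X0a Y1a) => // z; rewrite z eqxx in X0n.
have [c cE] := even_root_line a0 X00 Y00 X0a Y0a X0n.
by exists c; rewrite X1z Y1z !addr0.
Qed.

End F4EvenPart.

Lemma F4_root_mult (R : realType) (g : lieSuperalgebra R[i]) (h : {vspace g}) :
  cartan_subalgebra h -> is_F4 g -> root_multiplicity_free h.
Proof.
move=> hc [_ [gam [a [s [o [cl [ev onto abr sbr] oonto obr]]]]]].
have [P0 P0u sd] := so7_diagonalization hc onto sbr.
have [P1 P1u ad] := sl2_diagonalization hc onto abr.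
exact: (F4_even_odd_mult hc ev onto abr sbr P0u P1u sd ad cl oonto obr).
Qed.

(** * The adjoint representation as supermatrices, and the form of F(4) *)

Section AdjointSupermatrix.
Variables (K : fieldType) (g : lieSuperalgebra K).
Local Notation p := (\dim (gr g false)).
Local Notation q := (\dim (gr g true)).
Local Notation pr b := (daddv_pi (gr g b) (gr g (~~ b))).
Let bb := bracket_bil g.

Definition gr_basis (i : 'I_(p + q)) : g :=
  match fintype.split i with
  | inl k => (vbasis (gr g false))`_k
  | inr k => (vbasis (gr g true))`_k
  end.

Definition gr_coord (i : 'I_(p + q)) (Z : g) : K :=
  match fintype.split i with
  | inl k => coord (vbasis (gr g false)) k (pr false Z)
  | inr k => coord (vbasis (gr g true)) k (pr true Z)
  end.

Lemma gr_cap0 b : (gr g b :&: gr g (~~ b))%VS = 0%VS.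
Proof. by case: b; rewrite /= ?[(gr g true :&: _)%VS]capvC gr_cap. Qed.

Lemma gr_coordP i a Y Z : gr_coord i (a *: Y + Z) = a * gr_coord i Y + gr_coord i Z.
Proof. by rewrite /gr_coord; case: (fintype.split i) => k; rewrite !linearP. Qed.

Lemma pr_id b Z : Z \in gr g b -> pr b Z = Z.
Proof. exact: daddv_pi_id (gr_cap0 b). Qed.

Lemma pr_add Z : pr false Z + pr true Z = Z.
Proof.
by apply: (daddv_pi_add (gr_cap0 false)); rewrite gr_sum memvf.
Qed.

Lemma pr_other b Z : Z \in gr g (~~ b) -> pr b Z = 0.
Proof.
move=> Zb; have := pr_add Z; have := pr_id Zb.
by case: b {Zb} => /= ->; [move/(canRL (addKr _)); rewrite addNr
  |move/(canRL (addrK _)); rewrite subrr].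
Qed.

Lemma gr_coord_sum Z : Z = \sum_i gr_coord i Z *: gr_basis i.
Proof.
rewrite big_split_ord /= -{1}(pr_add Z); congr (_ + _).
  rewrite {1}(coord_vbasis (memv_pi _ _ Z)); apply: eq_bigr => k _.
  by rewrite /gr_coord /gr_basis (unsplitK (inl _ k)).
rewrite {1}(coord_vbasis (memv_pi _ _ Z)); apply: eq_bigr => k _.
by rewrite /gr_coord /gr_basis (unsplitK (inr _ k)).
Qed.

Lemma gr_basis_gr i : gr_basis i \in gr g (par i).
Proof.
case: (split_ordP i) => k ->; rewrite ?par_lshift ?par_rshift /gr_basis.
  by rewrite (unsplitK (inl _ k)); apply: vbasis_mem; rewrite mem_nth ?size_tuple.
by rewrite (unsplitK (inr _ k)); apply: vbasis_mem; rewrite mem_nth ?size_tuple.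
Qed.

Lemma gr_coord_other i z Z : Z \in gr g z -> par i != z -> gr_coord i Z = 0.
Proof.
move=> Zz; case: (split_ordP i) => k ->; rewrite ?par_lshift ?par_rshift /gr_coord.
  rewrite (unsplitK (inl _ k)); case: z Zz => // Zz _.
  by rewrite (@pr_other false) // linear0.
rewrite (unsplitK (inr _ k)); case: z Zz => // Zz _.
by rewrite (@pr_other true) // linear0.
Qed.

(** The matrix of ad X in a basis adapted to the grading; it turns [lsa_str] into [strace], so that
    invariance follows as for matrix superalgebras. *)
Definition ad_mx X : 'M[K]_(p + q) := \matrix_(i, j) gr_coord i (bracket X (gr_basis j)).

Lemma ad_mx_linear : linear ad_mx.
Proof.
move=> a X Y; apply/matrixP => i j.
by rewrite !mxE (bilDl bb) (bilZl bb) gr_coordP.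
Qed.

Lemma ad_mx_parity z X : X \in gr g z -> mx_parity z (ad_mx X).
Proof.
move=> Xz; apply/mx_parity_entry => i j ij; rewrite mxE.
apply: gr_coord_other (bracket_gr Xz (gr_basis_gr j)) _.
by move: ij; case: (par i); case: (par j); case: (z).
Qed.

Lemma ad_mx_mul X Y i j :
  (ad_mx X *m ad_mx Y) i j = gr_coord i (bracket X (bracket Y (gr_basis j))).
Proof.
have lin Z : linear (fun Z' => gr_coord i (bracket Z Z') : K^o).
  by move=> a U V; rewrite (bilDr bb) (bilZr bb) gr_coordP.
have [F hF] := linear_hom (lin X).
rewrite -hF [in RHS](gr_coord_sum (bracket Y (gr_basis j))) linear_sum mxE.
by apply: eq_bigr => k _; rewrite linearZ /= hF !mxE mulrC.
Qed.

Lemma ad_mx_bracket z z' X Y : X \in gr g z -> Y \in gr g z' ->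
  ad_mx (bracket X Y) = ad_mx X *m ad_mx Y - (-1) ^+ (z && z') *: (ad_mx Y *m ad_mx X).
Proof.
move=> Xz Yz; apply/matrixP => i j.
rewrite [in RHS]mxE [X in _ = _ + X]mxE [X in _ = _ - X]mxE !ad_mx_mul [LHS]mxE.
rewrite (bracket_jacobi (gr_basis j) Xz Yz) [X in _ = gr_coord i X - _]addrC.
by rewrite gr_coordP addrAC subrr add0r.
Qed.

Lemma strace_ad_mx X Y : strace (ad_mx X *m ad_mx Y) = lsa_str (bracket X \o bracket Y).
Proof.
rewrite /lsa_str big_bool /= expr0 expr1 mul1r mulN1r addrC; congr (_ - _).
  apply: eq_bigr => k _; rewrite mxE mxE ad_mx_mul /gr_coord /gr_basis.
  by rewrite (unsplitK (inl _ k)).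
apply: eq_bigr => k _; rewrite mxE mxE ad_mx_mul /gr_coord /gr_basis.
by rewrite (unsplitK (inr _ k)).
Qed.

Lemma lsa_str_invariant (form : g -> g -> K) c :
  (forall X Y, form X Y = c * lsa_str (bracket X \o bracket Y)) -> invariant_form form.
Proof.
move=> formE; apply: (@strace_invariant _ _ _ g ad_mx form c).
- exact: ad_mx_linear.
- exact: ad_mx_parity.
- exact: ad_mx_bracket.
- by move=> X Y; rewrite strace_ad_mx.
Qed.

End AdjointSupermatrix.

(* The radical of an invariant form is a graded ideal. *)
Lemma simple_form_nondegenerate (K : fieldType) (g : lieSuperalgebra K)
    (form : g -> g -> K) : simple_lsa g -> invariant_form form ->
  (forall X Y, form X Y = 0) \/ nondegenerate form.
Proof.
move=> [_ simple] [fb fpar _ finv]; have bb := bracket_bil g.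
(* The radical is the kernel of the map sending X to its pairings with a basis, which makes it a
   [{vspace g}] to which simplicity applies. *)
have [F FE] : exists F : 'Hom(g, 'rV[K]_(\dim {:g})),
    F =1 fun X => \row_i form X (vbasis {:g})`_i.
  apply: linear_hom => a X Y; apply/rowP => i.
  by rewrite !mxE (bilDl fb) (bilZl fb).
have radP X : reflect (forall Y, form X Y = 0) (X \in lker F).
  rewrite memv_ker FE; apply: (iffP eqP) => [/rowP E Y|E]; last first.
    by apply/rowP => i; rewrite !mxE E.
  rewrite (coord_vbasis (memvf Y)) (bil_sumr fb) big1 // => i _.
  by have := E i; rewrite !mxE (bilZr fb) => ->; rewrite scaler0.
have part X0 X1 : X0 \in gr g false -> X1 \in gr g true -> X0 + X1 \in lker F ->
    X0 \in lker F.
  move=> h0 h1 /radP hX; apply/radP => Y.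
  have [Y0 [Y1 [Y00 Y11 ->]]] := gr_split Y.
  rewrite (bilDr fb) [form X0 Y1](fpar _ _ _ _ h0 Y11) // addr0.
  have := hX Y0; rewrite (bilDl fb) [form X1 Y0](fpar _ _ _ _ h1 Y00) // addr0.
  by [].
have part1 X0 X1 : X0 \in gr g false -> X1 \in gr g true -> X0 + X1 \in lker F ->
    X1 \in lker F.
  move=> h0 h1 hX; have <- : X0 + X1 - X0 = X1 by rewrite addrC addKr.
  by apply: rpredB => //; apply: part h0 h1 hX.
have [||I0|I1] := simple (lker F).
- apply/eqP; rewrite eqEsubv subv_add !capvSl !andbT; apply/subvP => X.
  have [X0 [X1 [h0 h1 ->]]] := gr_split X => hX.
  apply: memv_add; rewrite memv_cap.
    by rewrite h0 (part _ _ h0 h1 hX).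
  by rewrite h1 (part1 _ _ h0 h1 hX).
- move=> X Y; have [Y0 [Y1 [h0 h1 ->]]] := gr_split Y => hY.
  have key z Z : Z \in gr g z -> Z \in lker F -> bracket X Z \in lker F.
    move=> Zz /radP hZ; elim/gr_ind: X => [X X' hX hX'|z' X Xz].
      by rewrite (bilDl bb) rpredD.
    rewrite (bracket_skew Xz Zz) rpredN rpredZ //; apply/radP => U.
    by rewrite finv hZ.
  rewrite (bilDr bb) rpredD //.
    exact: key h0 (part _ _ h0 h1 hY).
  exact: key h1 (part1 _ _ h0 h1 hY).
- right=> X /radP; rewrite I0 memv0 => /eqP.
  by [].
- by left=> X; apply/radP; rewrite I1 memvf.
Qed.

(** The Killing form is not computed: simplicity leaves only the zero form and a nondegenerate one,
    and both alternatives are carried on. *)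
Lemma F4_admissible (R : realType) (g : lieSuperalgebra R[i]) (h : {vspace g})
    (form : g -> g -> R[i]) (c : R[i]) : cartan_subalgebra h -> is_F4 g ->
  (forall X Y, form X Y = c * lsa_str (bracket X \o bracket Y)) ->
  (forall X Y, form X Y = 0) \/ dirac_admissible h form.
Proof.
move=> hc hF formE; have inv := lsa_str_invariant formE.
have [simple _] := hF; have [z|nd] := simple_form_nondegenerate simple inv; first by left.
by right; split=> //; apply: F4_root_mult.
Qed.

(** * The scalar of D^2 for the listed superalgebras *)

Lemma listed_admissible (R : realType) (g : lieSuperalgebra R[i]) (h : {vspace g})
    (form : g -> g -> R[i]) : cartan_subalgebra h -> listed_algebra form ->
  (forall X Y, form X Y = 0) \/ dirac_admissible h form.
Proof.
move=> hc [m n m0 n0 mn [phi iso E]|n n0 [phi iso E]|m n m0 n0 [phi iso E]|hF E].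
- by right; apply: sl_admissible hc m0 n0 mn iso E.
- by right; apply: gl_admissible hc n0 iso E.
- by right; apply: osp_admissible hc m0 n0 iso E.
- exact: F4_admissible hc hF E.
Qed.

(* Duality of the odd root vectors leaves none when the form vanishes. *)
Lemma dirac_sq_zero_form (R : realType) (g : lieSuperalgebra R[i])
    (form : g -> g -> R[i]) (form0 : forall X Y, form X Y = 0)
    (h : {vspace g}) (N : nat) (d x : N.-tuple g)
    (dx_dual : forall i j : 'I_N,
       Bform form (tnth d i) (tnth x j) = 2%:R^-1 * (i == j)%:R)
    (M : supermodule g) (T : tensor_product M {mpoly R[i][N]})
    (lambda mu lambda' mu' : hdual h) (u : T) :
  dirac d x (dirac d x u)
    - (2%:R * (hform form lambda mu - hform form lambda' mu')) *: u = 0.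
Proof.
have N0 (i : 'I_N) : False.
  have := dx_dual i i; rewrite /Bform form0 mulr0 eqxx mulr1 => /esym/eqP.
  by rewrite invr_eq0 pnatr_eq0.
rewrite /hform !form0 subrr mulr0 scale0r subr0 /dirac big1 ?scaler0 //.
Qed.

Theorem theorem34 (R : realType) (g : lieSuperalgebra R[i])
    (form : g -> g -> R[i]) (g_listed : listed_algebra form)
    (h : {vspace g}) (h_cartan : cartan_subalgebra h)
    (Dp : set (hdual h)) (Dp_positive : positive_system Dp)
    (N : nat) (d x : N.-tuple g)
    (d_basis : basis_of (nplus_odd Dp) d)
    (x_basis : basis_of (nminus_odd Dp) x)
    (dx_dual : forall i j : 'I_N,
       Bform form (tnth d i) (tnth x j) = 2%:R^-1 * (i == j)%:R)
    (M : supermodule g) (Lambda : hdual h)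
    (M_simple : simple_supermodule M)
    (M_hw : highest_weight_module Dp M Lambda)
    (T : tensor_product M {mpoly R[i][N]})
    (mu : hdual h) (U V : set T)
    (UV_factor : composition_factor form d x Dp mu U V) :
  forall u, U u ->
    V (dirac d x (dirac d x u)
       - (2%:R * (hform form (mu + rho_of Dp true + 2%:R *: rho Dp)
                             (mu + rho_of Dp true)
                  - hform form (Lambda + 2%:R *: rho Dp) Lambda)) *: u).
Proof.
case: (listed_admissible h_cartan g_listed) => [form0|[inv nd mult]] u Uu.
  rewrite (dirac_sq_zero_form form0 dx_dual).
  by case: UV_factor => _ [[V0 _] _] _ _ _.
exact: (dirac_sq_composition_factor h_cartan inv nd mult Dp_positive d_basis
  x_basis dx_dual M_hw UV_factor Uu).
Qed.
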